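(* Let $A_f$ be a Hilbert-Schmidt operator on $L^2(\mathbb{R}_+)$ with affine Weyl symbol $f\in L^2_r(\mathrm{Aff})$. Then $$\mathcal{F}_{\mathrm{KO}}(\mathcal{F}_W(A_f))=f.$$ That is, the diagram formed by $f\mapsto A_f:L^2_r(\mathrm{Aff})\to\mathcal{S}_2$, $\mathcal{F}_W:\mathcal{S}_2\to\mathcal{Q}_1$ and $\mathcal{F}_{\mathrm{KO}}:\mathcal{Q}_1\to L^2_r(\mathrm{Aff})$ commutes.
   Context: $\mathrm{Aff}=\mathbb{R}\times\mathbb{R}_+$, $\mathbb{R}_+=(0,\infty)$; $L^2_r(\mathrm{Aff})=L^2(\mathrm{Aff},a^{-1}dx\,da)$; $L^2(\mathbb{R}_+)=L^2(\mathbb{R}_+,r^{-1}dr)$; $\mathcal{S}_2$ is the space of Hilbert-Schmidt operators on $L^2(\mathbb{R}_+)$. An operator $A$ has integral kernel $A_K$ if $A\psi(r)=\int_0^\infty A_K(r,s)\psi(s)\frac{ds}{s}$. Put $\lambda(u)=\frac{ue^u}{e^u-1}$, $\lambda(0)=1$. Integrals below are understood in the $L^2$ sense (as partial Fourier transforms). Affine Weyl quantization: for $\phi,\psi\in L^2(\mathbb{R}_+)$ let $W^{\psi,\phi}_{\mathrm{Aff}}(x,a)=\int_{-\infty}^\infty\psi(a\lambda(u))\overline{\phi(a\lambda(-u))}e^{-2\pi i xu}du$. For $f\in L^2_r(\mathrm{Aff})$, $A_f\in\mathcal{S}_2$ is given by $\langle A_f\phi,\psi\rangle_{L^2(\mathbb{R}_+)}=\langle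 f,W^{\psi,\phi}_{\mathrm{Aff}}\rangle_{L^2_r(\mathrm{Aff})}$ for all $\phi,\psi$; $f\mapsto A_f$ is unitary from $L^2_r(\mathrm{Aff})$ onto $\mathcal{S}_2$, with inverse sending $A$ to its affine Weyl symbol $f_A(x,a)=\int_{-\infty}^\infty A_K(a\lambda(u),a\lambda(-u))e^{-2\pi i xu}du$. Affine Fourier-Wigner transform: let $\mathcal{F}_1$ be the Fourier transform in the first variable, $\mathcal{F}_1g(\xi,a)=\int_{\mathbb{R}}g(x,a)e^{-2\pi i x\xi}dx$, and $\mathcal{Q}_1=\{g\in L^2_r(\mathrm{Aff}):\mathrm{ess\,supp}(\mathcal{F}_1g)\subset\mathbb{R}_+\times\mathbb{R}_+\}$. For $g\in\mathcal{Q}_1$, $\mathcal{F}_W^{-1}(g)$ is the Hilbert-Schmidt operator with integral kernel $K_g(s,r)=\sqrt{r}\,(\mathcal{F}_1g)(r,s/r)$; this is a unitary map $\mathcal{Q}_1\to\mathcal{S}_2$, and $\mathcal{F}_W:\mathcal{S}_2\to\mathcal{Q}_1$ is its inverse. Affine Fourier-Kirillov transform: for $g\in\mathcal{Q}_1$, $$(\mathcal{F}_{\mathrm{KO}}g)(x,a)=\sqrt{a}\int_{\mathbb{R}^2}g\Big(\frac{v}{\lambda(-u)},e^u\Big)e^{-2\pi i(xu+av)}\,\frac{du\,dv}{\sqrt{\lambda(-u)}}.$$ *)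

(* Defs.v *)
From HB Require Import structures.
From mathcomp Require Import all_boot all_order all_algebra.
From mathcomp Require Import all_classical all_reals all_analysis.
From mathcomp Require Export complex.

Set Implicit Arguments.
Unset Strict Implicit.
Unset Printing Implicit Defensive.

Import Order.TTheory GRing.Theory Num.Theory.
Import numFieldNormedType.Exports.

Local Open Scope classical_set_scope.
Local Open Scope ring_scope.
Local Open Scope complex_scope.

(** Complex-valued functions: measurability, integrability and the integral
    are taken on real and imaginary parts. *)

Definition cmeasurable_fun (R : realType) d (T : measurableType d)
    (D : set T) (f : T -> R[i]) : Prop :=
  measurable_fun D (fun x => complex.Re (f x) : R) /\
  measurable_fun D (fun x => complex.Im (f x) : R).

Definition cintegrable (R : realType) d (T : measurableType d)
    (mu : {measure set T -> \bar R}) (D : set T) (f : T -> R[i]) : Prop :=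
  mu.-integrable D (fun x => (complex.Re (f x))%:E) /\
  mu.-integrable D (fun x => (complex.Im (f x))%:E).

Definition cintegral (R : realType) d (T : measurableType d)
    (mu : {measure set T -> \bar R}) (D : set T) (f : T -> R[i]) : R[i] :=
  (\int[mu]_(x in D) complex.Re (f x))%R +i*
  (\int[mu]_(x in D) complex.Im (f x))%R.

(** The space L^2(D, w dmu), for a positive weight w on D.  Its elements are
    represented by measurable functions, of which only the values on D matter;
    equality in L^2 is equality mu-almost everywhere on D. *)

Definition sqnormL2 (R : realType) d (T : measurableType d)
    (mu : {measure set T -> \bar R}) (D : set T) (w : T -> R)
    (f : T -> R[i]) : \bar R :=
  (\int[mu]_(x in D) (w x * Normc.normc (f x) ^+ 2)%:E)%E.

Definition inL2 (R : realType) d (T : measurableType d)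
    (mu : {measure set T -> \bar R}) (D : set T) (w : T -> R)
    (f : T -> R[i]) : Prop :=
  cmeasurable_fun D f /\ (sqnormL2 mu D w f < +oo)%E.

Definition innerL2 (R : realType) d (T : measurableType d)
    (mu : {measure set T -> \bar R}) (D : set T) (w : T -> R)
    (f g : T -> R[i]) : R[i] :=
  cintegral mu D (fun x => (w x)%:C * (f x * (g x)^*)).

Definition cvgL2 (R : realType) d (T : measurableType d)
    (mu : {measure set T -> \bar R}) (D : set T) (w : T -> R)
    (F : nat -> T -> R[i]) (f : T -> R[i]) : Prop :=
  sqnormL2 mu D w (fun x => F n x - f x) @[n --> \oo] --> 0%E.

Definition leb (R : realType) : {measure set (measurableTypeR R) -> \bar R} :=
  @lebesgue_measure R.

Definition leb2 (R : realType) :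
    {measure set (measurableTypeR R * measurableTypeR R)%type -> \bar R} :=
  (@lebesgue_measure R \x @lebesgue_measure R)%E.

Definition Rpos (R : realType) : set R := [set r | 0 < r].

Definition inL2pos (R : realType) (f : R -> R[i]) : Prop :=
  inL2 (leb R) (@Rpos R) (fun r => r^-1) f.

Definition sqnormL2pos (R : realType) (f : R -> R[i]) : \bar R :=
  sqnormL2 (leb R) (@Rpos R) (fun r => r^-1) f.

Definition innerL2pos (R : realType) (f g : R -> R[i]) : R[i] :=
  innerL2 (leb R) (@Rpos R) (fun r => r^-1) f g.

Definition eqL2pos (R : realType) (f g : R -> R[i]) : Prop :=
  {ae leb R, forall r, Rpos r -> f r = g r}.

(** Aff = R x R_+ with the right Haar measure dx da / a. *)

Definition Aff (R : realType) : set (R * R) := [set p | 0 < p.2].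

Definition inL2Aff (R : realType) (f : R * R -> R[i]) : Prop :=
  inL2 (leb2 R) (@Aff R) (fun p => p.2^-1) f.

Definition innerL2Aff (R : realType) (f g : R * R -> R[i]) : R[i] :=
  innerL2 (leb2 R) (@Aff R) (fun p => p.2^-1) f g.

Definition cvgL2Aff (R : realType) (F : nat -> R * R -> R[i])
    (f : R * R -> R[i]) : Prop :=
  cvgL2 (leb2 R) (@Aff R) (fun p => p.2^-1) F f.

(* Operators on L^2(R_+) act on representatives, so identities between values
   are almost everywhere identities. *)

Definition linearL2pos (R : realType) (A : (R -> R[i]) -> (R -> R[i])) : Prop :=
  forall (c : R[i]) (phi psi : R -> R[i]), inL2pos phi -> inL2pos psi ->
    eqL2pos (A (fun r => c * phi r + psi r)) (fun r => c * A phi r + A psi r).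

(* Together with linearity, boundedness makes A compatible with almost
   everywhere equality. *)
Definition boundedL2pos (R : realType) (A : (R -> R[i]) -> (R -> R[i])) : Prop :=
  (forall phi, inL2pos phi -> inL2pos (A phi)) /\
  exists M : R, forall phi, inL2pos phi ->
    (sqnormL2pos (A phi) <= M%:E * sqnormL2pos phi)%E.

Definition orthonormal_basis (R : realType) (e : nat -> R -> R[i]) : Prop :=
  [/\ forall n, inL2pos (e n),
      forall m n, innerL2pos (e m) (e n) = (m == n)%:R
    & forall phi, inL2pos phi -> (forall n, innerL2pos phi (e n) = 0) ->
        eqL2pos phi (fun=> 0)].

Definition hilbert_schmidt (R : realType) (A : (R -> R[i]) -> (R -> R[i])) :
    Prop :=
  [/\ linearL2pos A, boundedL2pos A
    & exists2 e, orthonormal_basis e &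
        (\sum_(0 <= n <oo) sqnormL2pos (A (e n)) < +oo)%E].

Definition integral_kernel (R : realType) (A : (R -> R[i]) -> (R -> R[i]))
    (K : R -> R -> R[i]) : Prop :=
  forall psi, inL2pos psi ->
    {ae leb R, forall r, Rpos r ->
      cintegrable (leb R) (@Rpos R) (fun s => (s^-1)%:C * (K r s * psi s)) /\
      A psi r = cintegral (leb R) (@Rpos R)
        (fun s => (s^-1)%:C * (K r s * psi s))}.

(* e^{-2 pi i t} *)
Definition expmi (R : realType) (t : R) : R[i] :=
  cos (2 * pi * t) -i* sin (2 * pi * t).

(* G is F_1 g in L^2_r(Aff): the L^2 limit, as n tends to infinity, of the
   integrals over [-n, n]. This determines G up to equality in L^2_r(Aff). *)
Definition partial_fourier (R : realType) (g G : R * R -> R[i]) : Prop :=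
  inL2Aff G /\
  cvgL2Aff (fun n p => cintegral (leb R) `[- n%:R, n%:R]
    (fun x => g (x, p.2) * expmi (x * p.1))) G.

Definition lambda (R : realType) (u : R) : R :=
  if u == 0 then 1 else u * expR u / (expR u - 1).

(* W is (a representative of) the affine Wigner function W^{psi,phi}. *)
Definition affine_wigner (R : realType) (psi phi : R -> R[i])
    (W : R * R -> R[i]) : Prop :=
  partial_fourier
    (fun p => psi (p.2 * lambda p.1) * (phi (p.2 * lambda (- p.1)))^*) W.

(* A = A_f, i.e. f is the affine Weyl symbol of A. *)
Definition affine_weyl (R : realType) (f : R * R -> R[i])
    (A : (R -> R[i]) -> (R -> R[i])) : Prop :=
  forall (phi psi : R -> R[i]) (W : R * R -> R[i]),
    inL2pos phi -> inL2pos psi -> affine_wigner psi phi W ->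
    innerL2pos (A phi) psi = innerL2Aff f W.

(* G = F_1 g is supported in R_+ x R_+: it vanishes almost everywhere on the
   complement of R_+ x R_+ in R x R_+. *)
Definition Q1 (R : realType) (g : R * R -> R[i]) : Prop :=
  inL2Aff g /\
  exists2 G, partial_fourier g G &
    {ae leb2 R, forall p, Aff p -> ~ Rpos p.1 -> G p = 0}.

(* g = F_W A, i.e. g is in Q_1 and F_W^{-1} g = A, the operator with kernel
   K_g(s, r) = sqrt r (F_1 g)(r, s / r). *)
Definition fourier_wigner (R : realType) (A : (R -> R[i]) -> (R -> R[i]))
    (g : R * R -> R[i]) : Prop :=
  Q1 g /\
  exists2 G, partial_fourier g G &
    integral_kernel A (fun s r => (Num.sqrt r)%:C * G (r, s / r)).

(* f = F_KO g: the integral over R^2 is the limit in L^2_r(Aff) of the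
   integrals over [-n, n]^2; in the inner integral q = (u, v). *)
Definition fourier_kirillov (R : realType) (g f : R * R -> R[i]) : Prop :=
  inL2Aff f /\
  cvgL2Aff (fun n p => (Num.sqrt p.2)%:C *
    cintegral (leb2 R) (`[- n%:R, n%:R] `*` `[- n%:R, n%:R])
      (fun q => ((Num.sqrt (lambda (- q.1)))^-1)%:C *
        (g (q.2 / lambda (- q.1), expR q.1) *
         expmi (p.1 * q.1 + p.2 * q.2)))) f.

(* Main.v *)
Require Import Defs.
From mathcomp Require Import all_boot all_order all_algebra.
From mathcomp Require Import all_classical all_reals all_analysis.
From mathcomp Require Import complex.
From mathcomp Require Import ring lra.
From mathcomp Require Import measurable_realfun.

(** Everything is read in logarithmic coordinates. With a = e^t, the space
    L^2_r(Aff) becomes L^2 of the plane and L^2(R_+) becomes L^2 of the line, and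
    an operator on L^2(R_+) with kernel A_K becomes one with the kernel
    K(rho, sigma) = A_K(e^rho, e^sigma).

    Let k be the inverse Fourier transform of f in the first variable, put
    m(u) = lambda(- u), ell(u) = ln m(u), and let
    S(u, t) = (t + ell(u) + u, t + ell(u)), which preserves the measure. Since
    lambda(u) = e^u m(u), the Wigner function of psi and phi is the transform of
    the function psi(rho) conj(phi(sigma)) at (rho, sigma) = S(u, t). Parseval's
    identity turns <A phi, psi> = <f, W> into a pairing with k, and it follows
    that A has the kernel K with K o S = k ([weyl_kapp], [weyl_integral_kernel]).

    Existence. The function G(r, a) = K(ln (r a), ln r) / sqrt r, extended by 0 to
    r <= 0, is square integrable, and sqrt r G(r, s / r) is the kernel of A; so
    g can be the inverse transform of G ([exists_fourier_wigner]).

    Inversion. If g is any Fourier-Wigner transform of A and G its transform in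
    the first variable, then K(ln s, ln r) = sqrt r G(r, s / r) almost everywhere,
    kernels being unique ([kernel_unique]). At r = a m(u), s = a lambda(u) this
    says k(u, ln a) = sqrt(a m(u)) G(a m(u), e^u). The right-hand side is sqrt a
    times the transform in v of h(u, v) = g(v / m(u), e^u) / sqrt(m(u)), and the
    transform of the left-hand side in u is f. So f is sqrt a times the transform
    of h in both variables, which is the Fourier-Kirillov transform of g; the
    integrals over [-n, n]^2 converge to it because the truncations of h converge
    to h and the transform is isometric ([kirillov_limit]).

    The transforms are handled on real functions, through the Hartley transform
    H g(xi) = int g(x) (cos + sin)(2 pi x xi) dx. It is symmetric and its own
    inverse, and its even and odd parts in xi are the cosine and sine transforms,
    from which the real and imaginary parts of a Fourier transform are assembled
    ([fourier1], [partial_fourierP]). Its L^2 theory rests on the damped integral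
    of (H g)^2 against exp(- e |xi|), which is the double integral of g(x) g(y)
    against a Poisson kernel. As that kernel is an approximate identity of mass 1,
    H is a contraction ([hart_contraction]) and is isometric on indicators of
    intervals ([hart_indic_cc]). Together with symmetry and completeness
    ([L2_complete]) this is enough to extend H to L^2 and to show that it is an
    involution ([hartley_inv]). *)

Set Implicit Arguments.
Unset Strict Implicit.
Unset Printing Implicit Defensive.

Import Order.TTheory GRing.Theory Num.Theory.
Import numFieldNormedType.Exports.

Local Open Scope classical_set_scope.
Local Open Scope ring_scope.

(** * Measurability and changes of variables on the line *)

Lemma measurable_sqrtr {R : realType} : measurable_fun [set: R] (@Num.sqrt R).
Proof. by apply: continuous_measurable_fun; exact: sqrt_continuous. Qed.

Lemma measurable_sin {R : realType} : measurable_fun [set: R] (@sin R).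
Proof. by apply: continuous_measurable_fun; exact: continuous_sin. Qed.

Lemma measurable_cos {R : realType} : measurable_fun [set: R] (@cos R).
Proof. by apply: continuous_measurable_fun; exact: continuous_cos. Qed.

Lemma measurable_normr {R : realType} : measurable_fun [set: R] (@Num.norm R R).
Proof. by apply: continuous_measurable_fun; exact: norm_continuous. Qed.

(** Decomposes a measurability goal along the syntax of the function. *)
Ltac mstep :=
  lazymatch goal with
  | |- measurable_fun _ (fun _ => ?c) => exact: measurable_cst
  | |- measurable_fun _ (fun x => x) => exact: measurable_id
  | |- measurable_fun _ (EFin \o ?f) => refine ((measurable_EFinP _ f).2 _)
  | |- measurable_fun _ (fun x => EFin (@?f x)) => refine ((measurable_EFinP _ f).2 _)
  | |- measurable_fun _ (fun x => mule (@?f x) (@?g x)) =>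
      refine (@emeasurable_funM _ _ _ _ f g _ _)
  | |- measurable_fun _ (fun x => adde (@?f x) (@?g x)) =>
      refine (@emeasurable_funD _ _ _ _ f g _ _)
  | |- measurable_fun _ (fun x => GRing.add (@?f x) (GRing.opp (@?g x))) =>
      refine (@measurable_funB _ _ _ _ f g _ _)
  | |- measurable_fun _ (fun x => GRing.add (@?f x) (@?g x)) =>
      refine (@measurable_funD _ _ _ _ f g _ _)
  | |- measurable_fun _ (fun x => GRing.mul (@?f x) (@?g x)) =>
      refine (@measurable_funM _ _ _ _ f g _ _)
  | |- measurable_fun _ (fun x => GRing.opp (@?f x)) =>
      refine (@measurable_funN _ _ _ _ f _)
  | |- measurable_fun _ (fun x => GRing.exp (@?f x) ?n) =>
      refine (@measurable_funX _ _ _ _ f n _)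
  | |- measurable_fun _ (fun x => pair (@?f x) (@?g x)) =>
      apply: measurable_fun_pair
  | |- measurable_fun _ (GRing.mul ?c) =>
      refine (@measurable_funM _ _ _ _ (fun=> c) (fun x => x) _ _)
  | |- measurable_fun _ (GRing.add ?c) =>
      refine (@measurable_funD _ _ _ _ (fun=> c) (fun x => x) _ _)
  | |- measurable_fun _ GRing.opp => refine (@measurable_funN _ _ _ _ (fun x => x) _)
  | |- measurable_fun _ ln => refine (measurable_funTS (@measurable_ln _))
  | |- measurable_fun _ expR => refine (measurable_funTS (@measurable_expR _))
  | |- measurable_fun _ (@Num.sqrt _) => refine (measurable_funTS measurable_sqrtr)
  | |- measurable_fun _ (fun x => abse (@?f x)) =>
      refine (measurableT_comp (abse_measurable _) _)
  | |- measurable_fun _ fst => exact: measurable_fst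
  | |- measurable_fun _ snd => exact: measurable_snd
  | |- measurable_fun _ (fun x => fst (@?f x)) => refine (measurableT_comp measurable_fst _)
  | |- measurable_fun _ (fun x => snd (@?f x)) => refine (measurableT_comp measurable_snd _)
  | |- measurable_fun _ (fun x => ln (@?f x)) =>
      refine (measurableT_comp (@measurable_ln _) _)
  | |- measurable_fun _ (fun x => expR (@?f x)) =>
      refine (measurableT_comp (@measurable_expR _) _)
  | |- measurable_fun _ (fun x => sin (@?f x)) =>
      refine (measurableT_comp measurable_sin _)
  | |- measurable_fun _ (fun x => cos (@?f x)) =>
      refine (measurableT_comp measurable_cos _)
  | |- measurable_fun _ (fun x => Num.sqrt (@?f x)) =>
      refine (measurableT_comp measurable_sqrtr _)
  | |- measurable_fun _ (fun x => Num.norm (@?f x)) =>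
      refine (measurableT_comp measurable_normr _)
  | |- measurable_fun _ (fun x => Order.lt (@?f x) (@?g x)) =>
      refine (measurable_fun_ltr _ _)
  | |- measurable_fun _ (fun x => Order.le (@?f x) (@?g x)) =>
      refine (measurable_fun_ler _ _)
  | |- measurable_fun _ (fun x => andb (@?f x) (@?g x)) =>
      refine (measurable_and _ _)
  | H : measurable_fun setT ?f |- measurable_fun _ ?f => exact: (measurable_funTS H)
  | H : measurable_fun setT ?f |- measurable_fun _ (fun x => ?f (@?g x)) =>
      refine (measurableT_comp H _)
  | |- measurable_fun _ (fun x => _) => refine (measurable_fun_ifT _ _ _)
  end.
Ltac meas := repeat mstep.

Section change_of_variables.
Context {R : realType}.
Notation mu := (@lebesgue_measure R).
Local Notation RR := (measurableTypeR R).

(** The image of Lebesgue measure under a translation, and under a dilation below,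
    is identified by its values on intervals. *)
Lemma ge0_integral_translate (c : R) (F : RR -> \bar R) :
  measurable_fun setT F -> (forall x, 0 <= F x)%E ->
  (\int[mu]_x F (x + c)%R = \int[mu]_x F x)%E.
Proof.
move=> mF F0.
have mc : measurable_fun setT (fun x : RR => (x + c)%R : RR).
  by apply: measurable_funD.
have H := @ge0_integral_pushforward _ _ RR RR R _ mc mu setT F measurableT mF (fun y _ => F0 y).
rewrite preimage_setT in H.
rewrite -[LHS]H; apply: eq_measure_integral => A mA _.
symmetry; apply: lebesgue_measure_unique => //= _ [[a b]] _ <-.
rewrite /pushforward/=.
rewrite (_ : _ @^-1` _ = `]a - c, b - c]%classic); last first.
  by apply/seteqP; split => x /=; rewrite !in_itv/= ltrBlDr lerBrDr.
rewrite !lebesgue_measure_itv/= !lte_fin ltrD2r -!EFinB.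
by case: ifPn => // _; congr (_%:E); ring.
Qed.

Lemma ge0_integral_opp (F : RR -> \bar R) :
  measurable_fun setT F -> (forall x, 0 <= F x)%E ->
  (\int[mu]_x F (- x)%R = \int[mu]_x F x)%E.
Proof.
move=> mF F0.
have mc : measurable_fun setT (fun x : RR => (- x)%R : RR).
  exact: measurableT_comp.
have H := @ge0_integral_pushforward _ _ RR RR R _ mc mu setT F measurableT mF (fun y _ => F0 y).
rewrite preimage_setT in H.
rewrite -[LHS]H; apply: eq_measure_integral => A mA _.
exact: lebesgue_measureN.
Qed.

Lemma ge0_integral_scale (c : R) (F : RR -> \bar R) : 0 < c ->
  measurable_fun setT F -> (forall x, 0 <= F x)%E ->
  (\int[mu]_x F (c * x)%R = (c^-1)%:E * \int[mu]_x F x)%E.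
Proof.
move=> c0 mF F0.
have mc : measurable_fun setT (fun x : RR => (c * x)%R : RR).
  by apply: measurable_funM.
have ci0 : 0 <= c^-1 by rewrite invr_ge0 ltW.
have H := @ge0_integral_pushforward _ _ RR RR R _ mc mu setT F measurableT mF (fun y _ => F0 y).
rewrite preimage_setT in H.
have H2 := @ge0_integral_mscale _ RR R mu setT measurableT (NngNum ci0) F mF (fun x _ => F0 x).
rewrite -[LHS]H -[RHS]H2; apply: eq_measure_integral => A mA _.
have c1 : 0 <= c by exact: ltW.
have E : forall B, measurable B -> mu B = mscale (NngNum c1) (pushforward mu (fun x : RR => (c * x)%R : RR)) B.
  move=> B mB; apply: lebesgue_measure_unique => //= _ [[a b]] _ <-.
  rewrite /mscale/= /pushforward/=.
  rewrite (_ : _ @^-1` _ = `]a / c, b / c]%classic); last first.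
    by apply/seteqP; split => x /=; rewrite !in_itv/= ltr_pdivrMr// ler_pdivlMr// ![_ * c]mulrC.
  rewrite !lebesgue_measure_itv/= !lte_fin ltr_pM2r ?invr_gt0// -!EFinB.
  case: ifPn => // _; last by rewrite mule0.
  by rewrite -EFinM; congr (_%:E); field; rewrite gt_eqF.
change (pushforward mu (fun x : RR => (c * x)%R : RR) A = (c^-1)%:E * mu A)%E.
by rewrite (E mc A mA) /mscale/= muleA -EFinM mulVf ?gt_eqF// mul1e.
Qed.

(** [if 0 < r then r^-1 else 0], in a form whose measurability is immediate. *)
Definition invpos (r : R) : R := if 0 < r then expR (- ln r) else 0.

Lemma invposE r : 0 < r -> invpos r = r^-1.
Proof. by move=> r0; rewrite /invpos r0 expRN lnK. Qed.

Lemma invpos_ge0 r : 0 <= invpos r.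
Proof. by rewrite /invpos; case: ifPn => // _; exact: expR_ge0. Qed.

Lemma measurable_invpos : measurable_fun [set: R] invpos.
Proof.
apply: measurable_fun_ifT => //.
  exact: measurable_fun_ltr.
apply: measurableT_comp => //; apply: measurable_funN; exact: measurable_ln.
Qed.

(** The normalization in [ge0_integral_ln]. *)
Lemma integral_invpos_1e : (\int[mu]_r (\1_`[0%R, 1%R] (ln r) * invpos r)%:E = 1)%E.
Proof.
have e1 : (1:R) < expR 1 by rewrite expR_gt1.
transitivity (\int[mu]_(r in `[1%R, expR 1%R]) (r^-1)%:E)%E.
  rewrite [RHS]integral_mkcond; apply: eq_integral => r _.
  rewrite patchE indicE !mem_setE !in_itv/=.
  have [r0|r0] := ltP 0 r; last first.
    rewrite /invpos ltNge r0/= mulr0; case: ifPn => // /andP[].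
    by move=> r1; have := le_trans r1 r0; rewrite ler10.
  rewrite invposE//.
  have E1 : (0 <= ln r) = (1 <= r) by rewrite -[in RHS](lnK r0) -expR0 ler_expR.
  have E2 : (ln r <= 1) = (r <= expR 1) by rewrite -[in RHS](lnK r0) ler_expR.
  by rewrite E1 E2; case: ifPn => _; rewrite ?mul1r ?mul0r.
rewrite (@continuous_FTC2 _ _ (@ln R))//.
- by rewrite ln1 expRK sube0.
- apply: continuous_in_subspaceT => x; rewrite inE/= in_itv/= => /andP[x1 _].
  by apply: cvgV => //; rewrite gt_eqF// (lt_le_trans _ x1).
- split.
  + move=> x; rewrite in_itv/= => /andP[x1 _].
    by apply: ex_derive; apply: is_derive1_ln; exact: lt_trans x1.
  + apply: cvg_at_right_filter; exact: continuous_ln.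
  + apply: cvg_at_left_filter; apply: continuous_ln; exact: expR_gt0.
- move=> x; rewrite in_itv/= => /andP[x1 _].
  by rewrite derive1E; apply: derive_val; apply: is_derive1_ln; exact: lt_trans x1.
Qed.

Lemma measurable_indic_itv (a b : R) : measurable_fun [set: R] (\1_`[a, b] : R -> R).
Proof. by apply: measurable_indic; exact: measurable_itv. Qed.

(** Uniqueness of Haar measure: both sides are invariant under translations of
    [F], and they agree on the indicator [G] of [0, 1]. Computing the double
    integral of F(t + ln r) G(ln r) / r in both orders turns this into a
    proof. *)
Lemma ge0_integral_ln (F : R -> \bar R) :
  measurable_fun [set: R] F -> (forall x, 0 <= F x)%E ->
  (\int[mu]_r (F (ln r) * (invpos r)%:E) = \int[mu]_t F t)%E.
Proof.
move=> mF F0; pose G : R -> R := \1_`[0%R, 1%R].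
have mG : measurable_fun [set: R] G by exact: measurable_indic_itv.
have G0 x : 0 <= G x by rewrite /G indicE.
have IG : (\int[mu]_t (G t)%:E = 1)%E.
  rewrite /G integral_indic//= setIT.
  by rewrite lebesgue_measure_itv/= lte_fin ltr01 -EFinB subr0.
have mi := measurable_invpos.
have i0 := invpos_ge0.
symmetry.
transitivity (\int[mu]_r \int[mu]_t (F (t + ln r)%R * (G (ln r) * invpos r)%:E))%E.
  rewrite -[LHS]mule1 -integral_invpos_1e -ge0_integralZl//; last 3 first.
    - by meas.
    - by move=> r _; rewrite lee_fin mulr_ge0.
    - by apply: integral_ge0 => *; exact: F0.
  apply: eq_integral => r _; rewrite -(ge0_integral_translate (ln r) mF F0).
  rewrite -ge0_integralZr//.
  - by meas.
  - by rewrite lee_fin mulr_ge0.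
rewrite -(@fubini_tonelli _ _ RR RR R mu mu (fun p : RR * RR => (F (p.1 + ln p.2)%R * (G (ln p.2) * invpos p.2)%:E)%E)); last 2 first.
  - by meas.
  - by move=> x; rewrite mule_ge0// lee_fin mulr_ge0.
(* the substitution of [expR t * r] for [r] *)
transitivity (\int[mu]_t \int[mu]_r (F (ln r)%R * (G (ln r - t) * invpos r)%:E))%E.
  apply: eq_integral => t _ /=.
  rewrite -[RHS]mul1e -(mulfV (lt0r_neq0 (expR_gt0 t))) EFinM -muleA.
  rewrite -(@ge0_integral_scale (expR t) (fun r => F (ln r)%R * (G (ln r - t) * invpos r)%:E)%E); last 3 first.
    - exact: expR_gt0.
    - by meas.
    - by move=> x; rewrite mule_ge0// lee_fin mulr_ge0.
  rewrite -ge0_integralZl//; last 2 first.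
    - meas.
    - by move=> x _; rewrite mule_ge0// lee_fin mulr_ge0.
  apply: eq_integral => r _.
  have [r0|r0] := ltP 0 r; last first.
    rewrite /invpos pmulr_rgt0 ?expR_gt0// ltNge r0/=.
    by rewrite !mulr0 !mule0.
  have er0 : 0 < expR t * r by rewrite mulr_gt0// expR_gt0.
  rewrite !invposE// lnM ?posrE ?expR_gt0// expRK (addrC t) addrK.
  rewrite muleCA -EFinM; congr (_ * _%:E)%E.
  by field; rewrite !gt_eqF ?expR_gt0.
rewrite (@fubini_tonelli _ _ RR RR R mu mu (fun p : RR * RR => (F (ln p.2)%R * (G (ln p.2 - p.1) * invpos p.2)%:E)%E)); last 2 first.
  - by meas.
  - by move=> x; rewrite mule_ge0// lee_fin mulr_ge0.
apply: eq_integral => r _ /=.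
under eq_integral do rewrite EFinM muleCA.
rewrite ge0_integralZr//; last 3 first.
  - by meas.
  - by move=> x _; rewrite lee_fin.
  - by rewrite mule_ge0// lee_fin.
have mG1 : measurable_fun [set: R] (fun x => (G (ln r - x))%:E) by meas.
rewrite -(ge0_integral_opp mG1); last by move=> x; rewrite lee_fin.
under eq_integral do rewrite opprK addrC.
have mG2 : measurable_fun [set: R] (EFin \o G) by meas.
rewrite (ge0_integral_translate (ln r) mG2); last by move=> x; rewrite lee_fin.
by rewrite IG mul1e.
Qed.

End change_of_variables.

Section signed_change_of_variables.

(** A change of variables with Jacobian [w], known for nonnegative functions,
    passes to signed ones, integrable or not. *)
Lemma integral_transport {R : realType} {d1 d2} {T1 : measurableType d1}
    {T2 : measurableType d2} (mu : {measure set T1 -> \bar R})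
    (nu : {measure set T2 -> \bar R}) (phi : T1 -> T2) (w : T1 -> R) :
  (forall F : T2 -> \bar R, measurable_fun setT F -> (forall y, 0 <= F y)%E ->
     (\int[mu]_x (F (phi x) * (w x)%:E) = \int[nu]_y F y)%E) ->
  (forall x, 0 <= w x) ->
  forall f : T2 -> R, measurable_fun setT f ->
    (\int[mu]_x (f (phi x) * w x)%:E = \int[nu]_y (f y)%:E)%E.
Proof.
move=> H w0 f mf.
have mf' : measurable_fun setT (EFin \o f) by exact/measurable_EFinP.
rewrite [LHS]integralE [RHS]integralE; congr (_ - _)%E.
- rewrite -H; [|exact: measurable_funepos|by move=> y; exact: funepos_ge0].
  by apply: eq_integral => x _; rewrite !funeposE EFinM muleC [RHS]muleC maxe_pMr ?mule0 ?lee_fin.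
- rewrite -H; [|exact: measurable_funeneg|by move=> y; exact: funeneg_ge0].
  by apply: eq_integral => x _; rewrite !funenegE EFinM -mulNe [RHS]muleC muleC maxe_pMr ?mule0 ?lee_fin.
Qed.

(** When the integral of [f] is infinite, [fine] makes both sides 0. *)
Lemma ge0_RintegralZl {R : realType} {d} {T : measurableType d}
    (mu : {measure set T -> \bar R}) (k : R) (f : T -> R) : 0 <= k ->
  measurable_fun setT f ->
  \int[mu]_x (k * f x) = k * \int[mu]_x f x.
Proof.
move=> k0 mf; have [->|kn0] := eqVneq k 0.
  rewrite mul0r; under eq_Rintegral do rewrite mul0r.
  by rewrite /Rintegral integral0.
have kp : 0 < k by rewrite lt_neqAle eq_sym kn0.
have mf' : measurable_fun setT (EFin \o f) by exact/measurable_EFinP.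
rewrite /Rintegral integralE [in RHS]integralE.
rewrite (_ : (fun x => (k * f x)%:E) = (fun x => k%:E * (EFin \o f) x)%E)//.
rewrite ge0_funeposM// ge0_funenegM//.
rewrite !ge0_integralZl_EFin//; last 2 first.
- exact: measurable_funeneg.
- exact: measurable_funepos.
rewrite -/(EFin \o f).
have := integral_ge0 mu (D := setT) (fun x _ => funepos_ge0 (EFin \o f) x).
have := integral_ge0 mu (D := setT) (fun x _ => funeneg_ge0 (EFin \o f) x).
move: (\int[mu]_x _)%E => a; move: (\int[mu]_x _)%E => b.
case: a => [a| |] //; case: b => [b| |] // _ _ /=.
- by rewrite -mulrBr.
- by rewrite gt0_muley ?lte_fin//= mulr0.
- by rewrite gt0_muley ?lte_fin//= mulr0.
- by rewrite gt0_muley ?lte_fin//= mulr0.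
Qed.

Context {R : realType}.
Notation mu := (@lebesgue_measure R).

Lemma Rintegral_opp (f : R -> R) : measurable_fun [set: R] f ->
  \int[mu]_x f (- x) = \int[mu]_x f x.
Proof.
move=> mf; have := @integral_transport R _ _ _ _ mu mu -%R (cst 1) _ _ f mf.
rewrite /Rintegral => <-//; last first.
  by move=> F mF F0; under eq_integral do rewrite mule1; exact: ge0_integral_opp.
by congr fine; apply: eq_integral => x _; rewrite /= mulr1.
Qed.

Lemma Rintegral_scale (c : R) (f : R -> R) : 0 < c -> measurable_fun [set: R] f ->
  \int[mu]_x f (c * x) = c^-1 * \int[mu]_x f x.
Proof.
move=> c0 mf; have c1 := ltW c0.
have := @integral_transport R _ _ _ _ mu mu ( *%R c) (fun=> c) _ _ f mf.
rewrite /Rintegral => <-//; last first.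
  move=> F mF F0; rewrite ge0_integralZr//; [|by meas].
  by rewrite ge0_integral_scale// muleAC -EFinM mulVf ?gt_eqF// mul1e.
have mfc : measurable_fun [set: R] (fun x => f (c * x)) by meas.
have := ge0_RintegralZl mu c1 mfc; rewrite /Rintegral => E.
transitivity (c^-1 * fine (\int[mu]_x (c * f (c * x))%:E)).
  by rewrite E mulrA mulVf ?gt_eqF// mul1r.
by congr (_ * fine _); apply: eq_integral => x _; rewrite mulrC.
Qed.

End signed_change_of_variables.

(** * The Poisson kernel *)

Section poisson_kernel.
Context {R : realType}.
Notation mu := (@lebesgue_measure R).
Local Notation RR := (measurableTypeR R).

Lemma ge0_FTC2_0y (f F : R -> R) (l : R) :
  (forall x, 0 <= f x) -> continuous f ->
  (forall x : R, is_derive x (1 : R) F (f x)) -> F x @[x --> +oo%R] --> l ->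
  (\int[mu]_(x in `[0%R, +oo[) (f x)%:E = (l - F 0)%:E)%E.
Proof.
move=> f0 cf dF Fl.
have cF : continuous F.
  by move=> x; apply: differentiable_continuous; apply/derivable1_diffP; exact: ex_derive.
rewrite (ge0_continuous_FTC2y _ _ Fl)//.
- by apply: continuous_subspaceT.
- by apply: cvg_at_right_filter; exact: cF.
- by move=> x _; rewrite derive1E; exact: derive_val.
Qed.

(** [f] is a function of the absolute value, not differentiable at 0; [g] is
    its smooth version on the half-line, with primitive [F]. *)
Lemma integral_even_ge0 (f g F : R -> R) (l : R) :
  (forall x, 0 <= f x) -> continuous f -> (forall x, f (- x) = f x) ->
  (forall x, 0 <= x -> f x = g x) ->
  (forall x, 0 <= g x) -> continuous g ->
  (forall x : R, is_derive x (1 : R) F (g x)) -> F x @[x --> +oo%R] --> l ->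
  (\int[mu]_x (f x)%:E = (2 * (l - F 0))%:E)%E.
Proof.
move=> f0 cf fN fg g0 cg dF Fl.
rewrite ge0_symfun_integralT//; last by move=> x /=; rewrite fN.
rewrite EFinM -(ge0_FTC2_0y g0 cg dF Fl); congr (_ * _)%E.
have -> : [set x : R | 0 <= x] = `[0, +oo[%classic.
  by apply/seteqP; split => x /=; rewrite in_itv/= andbT.
by apply: eq_integral => x; rewrite inE/= in_itv/= andbT => x0; rewrite fg.
Qed.

Lemma cvg_expRN (e : R) : 0 < e -> expR (- (e * x)) @[x --> +oo%R] --> (0 : R).
Proof.
move=> e0; rewrite (_ : (fun x => expR (- (e * x))) = (fun z => expR (- z)) \o (fun z => e * z))//.
apply: (@cvg_comp _ _ _ _ _ _ (pinfty_nbhs R)); last exact: cvgr_expR.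
exact: gt0_cvgMry.
Qed.

Lemma cvg_expRN_mul (e M : R) (h : R -> R) : 0 < e -> (forall x, `|h x| <= M) ->
  expR (- (e * x)) * h x @[x --> +oo%R] --> (0 : R).
Proof.
move=> e0 hM; apply: norm_cvg0; apply: (@squeeze_cvgr _ _ _ _ (cst 0) (fun x => expR (- (e * x)) * M)).
- near=> x; rewrite normr_ge0/= normrM ger0_norm ?expR_ge0// ler_wpM2l ?expR_ge0//.
- exact: cvg_cst.
- rewrite -[X in _ --> X](mul0r M); apply: cvgM; [exact: cvg_expRN|exact: cvg_cst].
Unshelve. all: by end_near. Qed.

Lemma integral_expR_abs (e : R) : 0 < e ->
  (\int[mu]_x (expR (- (e * `|x|)))%:E = (2 / e)%:E)%E.
Proof.
move=> e0.
have dF (x : R) : is_derive x (1 : R) (fun x => expR (- (e * x)) * - e^-1) (expR (- (e * x))).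
  by apply: is_derive_eq; rewrite /GRing.scale/=; field; rewrite gt_eqF.
rewrite (@integral_even_ge0 _ _ _ 0 _ _ _ _ _ _ dF).
- by rewrite mulr0 oppr0 expR0 mul1r sub0r opprK.
- by move=> x; exact: expR_ge0.
- move=> x; apply: continuous_comp; last exact: continuous_expR.
  by apply: continuousN; apply: continuousM; [exact: cst_continuous|exact: norm_continuous].
- by move=> x; rewrite normrN.
- by move=> x x0; rewrite ger0_norm.
- by move=> x; exact: expR_ge0.
- move=> x; apply: continuous_comp; last exact: continuous_expR.
  by apply: continuousN; apply: continuousM; [exact: cst_continuous|exact: cvg_id].
- by apply: (@cvg_expRN_mul _ (e^-1)) => // x; rewrite normrN ger0_norm// invr_ge0 ltW.
Qed.

Lemma continuous_expR_abs (e : R) : continuous (fun x : R => expR (- (e * `|x|))).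
Proof.
move=> x; apply: continuous_comp; last exact: continuous_expR.
by apply: continuousN; apply: continuousM; [exact: cst_continuous|exact: norm_continuous].
Qed.

Lemma continuous_cosM (b : R) : continuous (fun x : R => cos (b * x)).
Proof.
move=> x; apply: continuous_comp; last exact: continuous_cos.
by apply: continuousM; [exact: cst_continuous|exact: cvg_id].
Qed.

(** The summand 1 makes the integrand nonnegative, so that a primitive with a
    limit at infinity gives the integral. *)
Lemma integral_expR_abs_1cos (e b : R) : 0 < e ->
  (\int[mu]_x (expR (- (e * `|x|)) * (1 + cos (b * x)))%:E
   = (2 * (e^-1 + e / (e ^+ 2 + b ^+ 2)))%:E)%E.
Proof.
move=> e0.
have eb0 : 0 < e ^+ 2 + b ^+ 2 by rewrite ltr_wpDr ?sqr_ge0// exprn_gt0.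
have eb1 : e ^+ 2 + b ^+ 2 != 0 by rewrite gt_eqF.
have c0 (x : R) : 0 <= 1 + cos x by rewrite addrC -lerBlDr sub0r cos_geN1.
have cf : continuous (fun x : R => expR (- (e * `|x|)) * (1 + cos (b * x))).
  move=> x; apply: cvgM; first exact: continuous_expR_abs.
  by apply: cvgD; [exact: cvg_cst|exact: continuous_cosM].
have dF (x : R) : is_derive x (1 : R)
    (fun x => expR (- (e * x)) * (- e^-1 + (- e * cos (b * x) + b * sin (b * x)) / (e ^+ 2 + b ^+ 2)))
    (expR (- (e * x)) * (1 + cos (b * x))).
  by apply: is_derive_eq; rewrite /GRing.scale/=; field; rewrite eb1 gt_eqF.
rewrite (@integral_even_ge0 _ _ _ 0 _ _ _ _ _ _ dF).
- by congr (_%:E); rewrite !mulr0 cos0 sin0 oppr0 expR0; field; rewrite eb1 gt_eqF.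
- by move=> x; rewrite mulr_ge0// expR_ge0.
- exact: cf.
- by move=> x; rewrite normrN mulrN cosN.
- by move=> x x0; rewrite ger0_norm.
- by move=> x; rewrite mulr_ge0// expR_ge0.
- move=> x; apply: cvgM; last first.
    by apply: cvgD; [exact: cvg_cst|exact: continuous_cosM].
  apply: continuous_comp; last exact: continuous_expR.
  by apply: continuousN; apply: continuousM; [exact: cst_continuous|exact: cvg_id].
- apply: (@cvg_expRN_mul _ (e^-1 + (e + `|b|) / (e ^+ 2 + b ^+ 2))) => // x.
  rewrite (le_trans (ler_normD _ _))// lerD//.
    by rewrite normrN ger0_norm// invr_ge0 ltW.
  rewrite normrM [`|_^-1|]ger0_norm ?invr_ge0 ?(ltW eb0)// ler_pM2r ?invr_gt0//.
  rewrite (le_trans (ler_normD _ _))// lerD//.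
    by rewrite mulNr normrN normrM [`|e|]ger0_norm ?(ltW e0)//; apply: ler_piMr; [exact: ltW|exact: cos_max].
  by rewrite normrM; apply: ler_piMr; [exact: normr_ge0|exact: sin_max].
Qed.

Lemma integrable_expR_abs (e : R) : 0 < e ->
  mu.-integrable [set: RR] (fun x => (expR (- (e * `|x|)))%:E).
Proof.
move=> e0; apply/integrableP; split.
  by apply/measurable_EFinP; apply: continuous_measurable_fun; exact: continuous_expR_abs.
under eq_integral do rewrite gee0_abs ?lee_fin ?expR_ge0//.
by rewrite integral_expR_abs// ltry.
Qed.

Lemma integrable_expR_absM (e : R) (h : RR -> R) : 0 < e ->
  measurable_fun [set: RR] h -> (forall x, `|h x| <= 2) ->
  mu.-integrable [set: RR] (fun x => (expR (- (e * `|x|)) * h x)%:E).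
Proof.
move=> e0 mh hM.
have me : measurable_fun [set: R] (fun x : R => expR (- (e * `|x|))).
  by apply: continuous_measurable_fun; exact: continuous_expR_abs.
apply: (@le_integrable _ RR R mu setT measurableT _ (fun x : RR => 2%:E * (expR (- (e * `|x|)))%:E)%E).
- by meas.
- move=> x _; rewrite -EFinM !abse_EFin lee_fin !normrM mulrC.
  by rewrite ler_wpM2r// (le_trans (hM x))// ler_norm.
- by apply: integrableZl => //; exact: integrable_expR_abs.
Qed.

Lemma Rintegral_expR_abs_cos (e b : R) : 0 < e ->
  \int[mu]_x (expR (- (e * `|x|)) * cos (b * x)) = 2 * e / (e ^+ 2 + b ^+ 2).
Proof.
move=> e0.
transitivity (\int[mu]_x (expR (- (e * `|x|)) * (1 + cos (b * x)) - expR (- (e * `|x|)))).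
  by apply: eq_Rintegral => x _; ring.
rewrite RintegralB//.
- rewrite /Rintegral integral_expR_abs_1cos// integral_expR_abs//=.
  by ring.
- apply: integrable_expR_absM => //.
    by meas.
  move=> x; rewrite (le_trans (ler_normD _ _))// normr1.
  by have := cos_max (b * x); rewrite -(lerD2l 1).
- exact: integrable_expR_abs.
Qed.

Lemma Rintegral_expR_abs_sin (e b : R) : 0 < e ->
  \int[mu]_x (expR (- (e * `|x|)) * sin (b * x)) = 0.
Proof.
move=> e0.
have ms : measurable_fun [set: R] (fun x : R => sin (b * x)).
  by apply: (measurableT_comp measurable_sin); meas.
have me : measurable_fun [set: R] (fun x : R => expR (- (e * `|x|))).
  by apply: continuous_measurable_fun; exact: continuous_expR_abs.
have H := @Rintegral_opp R (fun x => expR (- (e * `|x|)) * sin (b * x)) (measurable_funM me ms).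
have E : \int[mu]_x (expR (- (e * `|- x|)) * sin (b * - x)) =
    - \int[mu]_x (expR (- (e * `|x|)) * sin (b * x)).
  rewrite -mulN1r -RintegralZl//; last first.
    by apply: integrable_expR_absM => // x; rewrite (le_trans (sin_max _))// ler1n.
  by apply: eq_Rintegral => x _; rewrite normrN mulrN sinN mulrN mulN1r.
move: H; rewrite E; move: (Rintegral _ _ _) => I; lra.
Qed.

(** The kernel of the Hartley transform, a real form of the Fourier transform
    that is symmetric and its own inverse. *)
Definition cas (t : R) : R := cos (2 * pi * t) + sin (2 * pi * t).

(** The Fourier transform of [exp (- e |x|)]. *)
Definition poisson (e t : R) : R := 2 * e / (e ^+ 2 + (2 * pi * t) ^+ 2).

Lemma cas_bound t : `|cas t| <= 2.
Proof.
rewrite (le_trans (ler_normD _ _))//.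
by have := cos_max (2 * pi * t); have := sin_max (2 * pi * t); lra.
Qed.

Lemma measurable_cas : measurable_fun [set: R] cas.
Proof.
by rewrite /cas; meas.
Qed.

(** The product cas(xt) cas(yt) equals cos(2 pi (x - y) t) + sin(2 pi (x + y) t),
    and the odd term integrates to 0. *)
Lemma Rintegral_cas_cas (e x y : R) : 0 < e ->
  \int[mu]_t (expR (- (e * `|t|)) * (cas (x * t) * cas (y * t))) = poisson e (x - y).
Proof.
move=> e0.
transitivity (\int[mu]_t (expR (- (e * `|t|)) * cos ((2 * pi * (x - y)) * t) +
                          expR (- (e * `|t|)) * sin ((2 * pi * (x + y)) * t))).
  apply: eq_Rintegral => t _; rewrite -mulrDr; congr (_ * _).
  rewrite /cas.
  rewrite (_ : 2 * pi * (x - y) * t = 2 * pi * (x * t) - 2 * pi * (y * t)); last by ring.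
  rewrite (_ : 2 * pi * (x + y) * t = 2 * pi * (x * t) + 2 * pi * (y * t)); last by ring.
  by rewrite cosB sinD; ring.
rewrite RintegralD//.
- by rewrite Rintegral_expR_abs_cos// Rintegral_expR_abs_sin// addr0.
- apply: integrable_expR_absM => //.
    by meas.
  by move=> t; rewrite (le_trans (cos_max _))// ler1n.
- apply: integrable_expR_absM => //.
    by meas.
  by move=> t; rewrite (le_trans (sin_max _))// ler1n.
Qed.

End poisson_kernel.

Section partial_integrals.
Context {d1 d2 : measure_display} {T1 : measurableType d1} {T2 : measurableType d2}
  {R : realType}.

Lemma measurable_Rintegral_snd (m2 : {sigma_finite_measure set T2 -> \bar R})
    (f : T1 * T2 -> R) : measurable_fun setT f ->
  measurable_fun setT (fun x => \int[m2]_y f (x, y)).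
Proof.
move=> mf; have mf' : measurable_fun setT (EFin \o f) by exact/measurable_EFinP.
rewrite /Rintegral; apply: measurableT_comp; first exact: fine_measurable.
rewrite (_ : (fun x => _) = (fubini_F m2 (EFin \o f)^\+ \- fubini_F m2 (EFin \o f)^\-)%E).
  apply: emeasurable_funB.
    by apply: measurable_fun_fubini_tonelli_F => //; exact: measurable_funepos.
  by apply: measurable_fun_fubini_tonelli_F => //; exact: measurable_funeneg.
apply/funext => x; rewrite integralE /fubini_F/=.
by congr (_ - _)%E; apply: eq_integral => y _; rewrite ?funeposE ?funenegE.
Qed.

End partial_integrals.

Lemma measurable_Rintegral_fst {d1 d2} {T1 : measurableType d1} {T2 : measurableType d2}
    {R : realType} (m1 : {sigma_finite_measure set T1 -> \bar R})
    (f : T1 * T2 -> R) : measurable_fun setT f ->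
  measurable_fun setT (fun y => \int[m1]_x f (x, y)).
Proof.
move=> mf; apply: (@measurable_Rintegral_snd _ _ T2 T1 R m1 (fun p => f (p.2, p.1))); meas.
Qed.

Section bounded_kernels.
Context {d : measure_display} {T : measurableType d} {R : realType}.
Context (mu : {measure set T -> \bar R}).

Lemma integrable_mul_bounded (M : R) (a h : T -> R) :
  mu.-integrable setT (EFin \o a) -> measurable_fun setT h ->
  (forall x, `|h x| <= M) -> mu.-integrable setT (fun x => (a x * h x)%:E).
Proof.
move=> ia mh hM.
have ma : measurable_fun setT a by apply/measurable_EFinP; exact: measurable_int ia.
apply: (@le_integrable _ _ _ mu setT measurableT _ (fun x => M%:E * (a x)%:E)%E).
- by meas.
- move=> x _; rewrite -EFinM !abse_EFin lee_fin !normrM mulrC ler_wpM2r//.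
  by rewrite (le_trans (hM x))// ler_norm.
- exact: integrableZl.
Qed.

End bounded_kernels.

Section fubini_bilinear.
Context {R : realType}.
Notation mu := (@lebesgue_measure R).
Local Notation RR := (measurableTypeR R).

Lemma Rintegral_fubini_bilinear (a b : RR -> R) (m : RR * RR -> R) (M : R) :
  mu.-integrable setT (EFin \o a) -> mu.-integrable setT (EFin \o b) ->
  measurable_fun setT m -> (forall p, `|m p| <= M) ->
  \int[mu]_x (a x * \int[mu]_y (b y * m (x, y))) =
  \int[mu]_y (b y * \int[mu]_x (a x * m (x, y))).
Proof.
move=> ia ib mm mM.
have ma : measurable_fun setT a by apply/measurable_EFinP; exact: measurable_int ia.
have mb : measurable_fun setT b by apply/measurable_EFinP; exact: measurable_int ib.
have M0 : 0 <= M by rewrite (le_trans _ (mM (0, 0))).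
have ix x : mu.-integrable setT (fun y => (b y * m (x, y))%:E).
  by apply: (integrable_mul_bounded (M := M)) => //; meas.
have iy y : mu.-integrable setT (fun x => (a x * m (x, y))%:E).
  by apply: (integrable_mul_bounded (M := M)) => //; meas.
have i2 : (mu \x mu)%E.-integrable setT (fun p : RR * RR => (a p.1 * (b p.2 * m p))%:E).
  apply/(integrable12ltyP mu mu); first by meas.
  apply: (@le_lt_trans _ _ (\int[mu]_x (`|(a x)%:E| * \int[mu]_y (`|(b y)%:E| * M%:E)))%E).
    apply: ge0_le_integral => //.
    - by move=> x _; exact: integral_ge0.
    - apply: (@measurable_fun_fubini_tonelli_F _ _ RR RR R mu (fun p : RR * RR => `|(a p.1 * (b p.2 * m p))%:E|%E)).
        by apply: measurableT_comp => //; meas.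
      by move=> ?; exact: abse_ge0.
    - by meas; apply: measurableT_comp => //; meas.
    - move=> x _; rewrite -ge0_integralZl//=; last 2 first.
      + by meas; apply: measurableT_comp => //; meas.
      + by move=> y _; rewrite mule_ge0// lee_fin.
      apply: ge0_le_integral => //=.
      + by apply: measurableT_comp => //; meas.
      + by meas; apply: measurableT_comp => //; meas.
      + move=> y _; rewrite -!EFinM lee_fin !normrM.
        by rewrite ler_wpM2l// ler_wpM2l.
  rewrite ge0_integralZr//; last 2 first.
  - by apply: measurableT_comp => //; meas.
  - by apply: integral_ge0 => y _; rewrite mule_ge0// lee_fin.
  rewrite ge0_integralZr//; last first.
  - by apply: measurableT_comp => //; meas.
  move/integrableP : ia => [_ ia]; move/integrableP : ib => [_ ib].
  rewrite lte_mul_pinfty//; first exact: integral_ge0.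
    rewrite ge0_fin_numE//; exact: integral_ge0.
  rewrite muleC lte_mul_pinfty// ?lee_fin//.
have := @Fubini _ _ RR RR R mu mu _ i2.
rewrite /= => E; rewrite /Rintegral; congr fine.
transitivity (\int[mu]_x \int[mu]_y (a x * (b y * m (x, y)))%:E)%E.
  apply: eq_integral => x _; rewrite EFinM fineK; last exact: integrable_fin_num.
  by rewrite -integralZl.
rewrite E; apply: eq_integral => y _; rewrite EFinM fineK; last exact: integrable_fin_num.
rewrite -integralZl//; apply: eq_integral => x _; rewrite -EFinM; congr (_%:E); ring.
Qed.

End fubini_bilinear.

Section poisson_mass.
Context {R : realType}.
Notation mu := (@lebesgue_measure R).
Local Notation RR := (measurableTypeR R).
Implicit Types e t : R.

Lemma poisson_denom_gt0 e t : 0 < e -> 0 < e ^+ 2 + (2 * pi * t) ^+ 2.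
Proof. by move=> e0; rewrite ltr_wpDr ?sqr_ge0// exprn_gt0. Qed.

Lemma poisson_ge0 e t : 0 < e -> 0 <= poisson e t.
Proof. by move=> e0; rewrite divr_ge0 ?mulr_ge0 ?(ltW e0)// ltW// poisson_denom_gt0. Qed.

Lemma poissonN e t : poisson e (- t) = poisson e t.
Proof. by rewrite /poisson mulrN sqrrN. Qed.

Lemma poissonE e t : 0 < e ->
  poisson e t = (2 / e) * (1 + ((2 * pi / e) * t) ^+ 2)^-1.
Proof.
move=> e0; rewrite /poisson; have := poisson_denom_gt0 t e0 => d0.
have e1 : e != 0 by rewrite gt_eqF.
have -> : 1 + ((2 * pi / e) * t) ^+ 2 = (e ^+ 2 + (2 * pi * t) ^+ 2) / e ^+ 2.
  by field.
move: d0 => /lt0r_neq0; move: (e ^+ 2 + _) => D d0; by field; rewrite e1 d0.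
Qed.

Lemma continuous_poisson e : 0 < e -> continuous (poisson e).
Proof.
move=> e0 t; apply: cvgM; first exact: cvg_cst.
apply: cvgV; first by rewrite gt_eqF// poisson_denom_gt0.
apply: cvgD; first exact: cvg_cst.
rewrite expr2; under eq_fun do rewrite expr2.
by apply: cvgM; apply: cvgM; [exact: cvg_cst|exact: cvg_id|exact: cvg_cst|exact: cvg_id].
Qed.

Lemma measurable_poisson e : 0 < e -> measurable_fun [set: R] (poisson e).
Proof. by move=> e0; apply: continuous_measurable_fun; exact: continuous_poisson. Qed.

Lemma is_derive_atan_poisson e t : 0 < e ->
  is_derive t (1 : R) (fun t => pi^-1 * atan ((2 * pi / e) * t)) (poisson e t).
Proof.
move=> e0; have pi0 : pi != 0 :> R by rewrite gt_eqF// pi_gt0.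
apply: is_derive_eq; rewrite poissonE// /GRing.scale/=.
have d0 : 1 + ((2 * pi / e) * t) ^+ 2 != 0 by rewrite gt_eqF// ltr_wpDr ?sqr_ge0.
rewrite mulr1.
move: (1 + _ ^+ 2) d0 => D d0.
have e1 : e != 0 by rewrite gt_eqF.
move: (@pi R) pi0 => p p0; by field; rewrite d0 e1 p0.
Qed.

Lemma integral_poisson e : 0 < e -> (\int[mu]_t (poisson e t)%:E = 1)%E.
Proof.
move=> e0; have pi0 : pi != 0 :> R by rewrite gt_eqF// pi_gt0.
have dF t := is_derive_atan_poisson t e0.
rewrite (@integral_even_ge0 _ _ _ _ (2^-1) _ _ _ _ _ _ dF)//.
- by rewrite mulr0 atan0 mulr0 subr0 mulfV.
- by move=> t; exact: poisson_ge0.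
- exact: continuous_poisson.
- by move=> t; rewrite poissonN.
- by move=> t; exact: poisson_ge0.
- exact: continuous_poisson.
- rewrite (_ : 2^-1 = pi^-1 * (pi / 2)); last by rewrite mulrA mulVf ?mul1r.
  apply: cvgM; first exact: cvg_cst.
  rewrite (_ : (fun x => _) = atan \o (fun z => (2 * pi / e) * z))//.
  apply: (@cvg_comp _ _ _ _ _ _ (pinfty_nbhs R)); last exact: cvgy_atan.
  apply: gt0_cvgMry; last exact: cvg_id.
  by rewrite divr_gt0 ?mulr_gt0 ?pi_gt0.
Qed.

Lemma integral_poisson_translate e x : 0 < e ->
  (\int[mu]_y (poisson e (x - y))%:E = 1)%E.
Proof.
move=> e0; rewrite -(integral_poisson e0).
have mp := measurable_poisson e0.
rewrite -(@ge0_integral_translate _ (- x) (fun t => (poisson e t)%:E)); last 2 first.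
- by meas.
- by move=> t; rewrite lee_fin poisson_ge0.
by apply: eq_integral => y _; rewrite -poissonN opprB.
Qed.

Lemma integral_poisson_itv e (a : R) : 0 < e -> 0 < a ->
  (\int[mu]_(t in `[(- a)%R, a]) (poisson e t)%:E = (2 / pi * atan (2 * pi / e * a))%:E)%E.
Proof.
move=> e0 a0.
have dF t := is_derive_atan_poisson t e0.
have cF : continuous (fun t => pi^-1 * atan ((2 * pi / e) * t)).
  by move=> x; apply: differentiable_continuous; apply/derivable1_diffP; exact: ex_derive.
rewrite (@continuous_FTC2 _ _ (fun t => pi^-1 * atan ((2 * pi / e) * t))).
- by rewrite mulrN atanN -EFinB; congr (_%:E); ring.
- by rewrite gtrN.
- by apply: continuous_subspaceT; exact: continuous_poisson.
- by split=> [x _||]; [exact: ex_derive|apply: cvg_at_right_filter; exact: cF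
    |apply: cvg_at_left_filter; exact: cF].
- by move=> x _; rewrite derive1E; exact: derive_val.
Qed.

End poisson_mass.

(** * The Hartley transform on the line *)

Lemma integrable_scalel {d} {T : measurableType d} {R : realType}
    (mu : {measure set T -> \bar R}) (k : R) (f : T -> R) :
  mu.-integrable setT (EFin \o f) -> mu.-integrable setT (EFin \o (fun x => k * f x)).
Proof.
move=> i_f; rewrite (_ : _ \o _ = (fun x => k%:E * (EFin \o f) x)%E)//.
exact: integrableZl.
Qed.

Section hartley_line.
Context {R : realType}.
Notation mu := (@lebesgue_measure R).
Local Notation RR := (measurableTypeR R).

Definition hart (g : RR -> R) (xi : R) : R := \int[mu]_x (g x * cas (x * xi)).

Lemma measurable_casM : measurable_fun setT (fun p : RR * RR => cas (p.1 * p.2) : R).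
Proof. by have mc := @measurable_cas R; meas. Qed.

Lemma measurable_hart (g : RR -> R) : measurable_fun setT g -> measurable_fun setT (hart g).
Proof.
move=> mg; have mc := measurable_casM.
apply: (@measurable_Rintegral_fst _ _ RR RR R mu (fun p : RR * RR => g p.1 * cas (p.1 * p.2))).
by meas.
Qed.

Lemma hart_bounded (g : RR -> R) xi : mu.-integrable setT (EFin \o g) ->
  `|hart g xi| <= 2 * \int[mu]_x `|g x|.
Proof.
move=> ig; have mc := @measurable_cas R.
have ig' : mu.-integrable setT (EFin \o (fun x => `|g x|)) by exact: integrable_norm.
have igc : mu.-integrable setT (EFin \o (fun x => g x * cas (x * xi))).
  by apply: (integrable_mul_bounded (M := 2)) => //; [meas|move=> x; exact: cas_bound].
rewrite (le_trans (le_normr_Rintegral _ igc))//.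
rewrite -RintegralZl//; apply: le_Rintegral => //.
- exact: (integrable_norm igc).
- exact: integrable_scalel.
- by move=> x _; rewrite normrM mulrC ler_wpM2r// cas_bound.
Qed.

(** The square is opened into a double integral; integrating the damping factor
    first produces the Poisson kernel. The damping makes Fubini legitimate. *)
Lemma Rintegral_hart_sqr_expR (g : RR -> R) (e : R) : 0 < e ->
  mu.-integrable setT (EFin \o g) ->
  \int[mu]_t (expR (- (e * `|t|)) * hart g t ^+ 2) =
  \int[mu]_y (g y * \int[mu]_x (g x * poisson e (x - y))).
Proof.
move=> e0 ig; have mc := measurable_casM; have mc1 := @measurable_cas R.
have mg : measurable_fun setT g by apply/measurable_EFinP; exact: measurable_int ig.
have mh := measurable_hart mg.
have ie := @integrable_expR_abs R e e0.
have me : measurable_fun [set: RR] (fun t : RR => expR (- (e * `|t|)) : R) by meas.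
have ia : mu.-integrable setT (EFin \o (fun t : RR => expR (- (e * `|t|)) * hart g t)).
  exact: (integrable_mul_bounded ie mh (fun x => hart_bounded x ig)).
transitivity (\int[mu]_t ((expR (- (e * `|t|)) * hart g t) * \int[mu]_y (g y * cas (y * t)))).
  by apply: eq_Rintegral => t _; rewrite -/(hart g t); ring.
rewrite (@Rintegral_fubini_bilinear R _ g (fun p => cas (p.2 * p.1)) 2 ia ig); last 2 first.
- by meas.
- by move=> p; exact: cas_bound.
apply: eq_Rintegral => y _; congr (_ * _) => /=.
transitivity (\int[mu]_t (expR (- (e * `|t|)) * \int[mu]_x (g x * (cas (x * t) * cas (y * t))))).
  apply: eq_Rintegral => t _; rewrite -mulrA; congr (_ * _).
  rewrite mulrC -RintegralZl//; last first.
    by apply: (integrable_mul_bounded (M := 2)) => //; [meas|move=> x; exact: cas_bound].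
  by apply: eq_Rintegral => x _; ring.
rewrite (@Rintegral_fubini_bilinear R _ g (fun p => cas (p.2 * p.1) * cas (y * p.1)) (2 * 2) ie ig); last 2 first.
- by meas.
- by move=> p; rewrite normrM ler_pM// cas_bound.
by apply: eq_Rintegral => x _; rewrite /= Rintegral_cas_cas.
Qed.

Lemma integrable_hart_sqr_expR (g : RR -> R) (e : R) : 0 < e ->
  mu.-integrable setT (EFin \o g) ->
  mu.-integrable setT (fun t : RR => (expR (- (e * `|t|)) * hart g t ^+ 2)%:E).
Proof.
move=> e0 ig.
have mg : measurable_fun setT g by apply/measurable_EFinP; exact: measurable_int ig.
have mh := measurable_hart mg.
have ie := @integrable_expR_abs R e e0.
apply: (integrable_mul_bounded (M := (2 * \int[mu]_x `|g x|) ^+ 2)) => //; first by meas.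
by move=> x; rewrite normrX ler_sqr ?nnegrE// ?hart_bounded// (le_trans _ (hart_bounded 0 ig)).
Qed.

(** By 2 |g(x) g(y)| <= g(x)^2 + g(y)^2, since the Poisson kernel has mass 1 in
    each variable. *)
Lemma hart_sqr_expR_le (g : RR -> R) (e : R) : 0 < e ->
  mu.-integrable setT (EFin \o g) ->
  (\int[mu]_t (expR (- (e * `|t|)) * hart g t ^+ 2)%:E <= \int[mu]_x (g x ^+ 2)%:E)%E.
Proof.
move=> e0 ig.
have mg : measurable_fun setT g by apply/measurable_EFinP; exact: measurable_int ig.
have mh := measurable_hart mg.
have me : measurable_fun [set: RR] (fun t : RR => expR (- (e * `|t|)) : R) by meas.
have mp := measurable_poisson e0.
have ie := @integrable_expR_abs R e e0.
have iL := integrable_hart_sqr_expR e0 ig.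
have P0 x y : 0 <= poisson e (x - y) by exact: poisson_ge0.
have igp y : mu.-integrable setT (fun x => (g x * poisson e (x - y))%:E).
  apply: (integrable_mul_bounded (M := 2 / e)) => //; first by meas.
  move=> x; rewrite ger0_norm// poissonE// ler_piMr ?divr_ge0 ?(ltW e0)//.
  by rewrite invf_le1 ?lerDl ?sqr_ge0// ltr_wpDr ?sqr_ge0.
rewrite -[leLHS]fineK; last exact: integrable_fin_num.
rewrite -/(Rintegral _ _ _) Rintegral_hart_sqr_expR//.
have mJ : measurable_fun setT (fun y : RR => \int[mu]_x (g x * poisson e (x - y))).
  by apply: (@measurable_Rintegral_fst _ _ RR RR R mu (fun p : RR * RR => g p.1 * poisson e (p.1 - p.2))); meas.
have mG : measurable_fun setT (fun p : RR * RR => (2^-1 * (g p.1 ^+ 2 + g p.2 ^+ 2) * poisson e (p.1 - p.2))%:E).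
  by meas.
have G0 (p : RR * RR) : (0 <= (2^-1 * (g p.1 ^+ 2 + g p.2 ^+ 2) * poisson e (p.1 - p.2))%:E)%E.
  by rewrite lee_fin mulr_ge0// mulr_ge0// addr_ge0// sqr_ge0.
rewrite (le_trans (lee_abs _))//.
have fine_le (X : \bar R) : (`|(fine X)%:E| <= `|X|)%E by case: X => [r||] /=; rewrite ?normr0 ?leey ?lexx.
rewrite (le_trans (fine_le _))//.
rewrite (le_trans (le_abse_integral _ _ _))//; first by meas.
apply: (@le_trans _ _ (\int[mu]_y \int[mu]_x (2^-1 * (g x ^+ 2 + g y ^+ 2) * poisson e (x - y))%:E)%E).
  apply: ge0_le_integral => //.
  - by apply: measurableT_comp => //; meas.
  - exact: (@measurable_fun_fubini_tonelli_G _ _ RR RR R mu _ mG G0).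
  - move=> y _; rewrite EFinM abseM.
    apply: (@le_trans _ _ (`|(g y)%:E| * \int[mu]_x `|(g x * poisson e (x - y))%:E|)%E).
      rewrite lee_wpmul2l// (le_trans (fine_le _))//.
      by apply: le_abse_integral => //; meas.
    rewrite -ge0_integralZl//; last by apply: measurableT_comp => //; meas.
    apply: ge0_le_integral => //.
    + by meas; apply: measurableT_comp => //; meas.
    + by meas.
    + move=> x _; rewrite -EFinM lee_fin normrM (ger0_norm (P0 _ _)) mulrA.
      rewrite ler_wpM2r// -(real_normK (num_real (g x))) -(real_normK (num_real (g y))).
      by have := sqr_ge0 (`|g x| - `|g y|); lra.
have mA : measurable_fun setT (fun p : RR * RR => (2^-1 * g p.1 ^+ 2 * poisson e (p.1 - p.2))%:E) by meas.
have mB : measurable_fun setT (fun p : RR * RR => (2^-1 * g p.2 ^+ 2 * poisson e (p.1 - p.2))%:E) by meas.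
have A0 (p : RR * RR) : (0 <= (2^-1 * g p.1 ^+ 2 * poisson e (p.1 - p.2))%:E)%E.
  by rewrite lee_fin mulr_ge0// mulr_ge0// sqr_ge0.
have B0 (p : RR * RR) : (0 <= (2^-1 * g p.2 ^+ 2 * poisson e (p.1 - p.2))%:E)%E.
  by rewrite lee_fin mulr_ge0// mulr_ge0// sqr_ge0.
rewrite (eq_integral (fun y : RR => \int[mu]_x (2^-1 * g x ^+ 2 * poisson e (x - y))%:E +
    \int[mu]_x (2^-1 * g y ^+ 2 * poisson e (x - y))%:E)%E); last first.
  move=> y _; rewrite -ge0_integralD//=.
  - by apply: eq_integral => x _; rewrite -EFinD; congr (_%:E); ring.
  - by move=> x _; exact: (A0 (x, y)).
  - by meas.
  - by move=> x _; exact: (B0 (x, y)).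
  - by meas.
rewrite ge0_integralD//; last 4 first.
- by move=> y _; apply: integral_ge0 => x _; exact: (A0 (x, y)).
- exact: (@measurable_fun_fubini_tonelli_G _ _ RR RR R mu _ mA A0).
- by move=> y _; apply: integral_ge0 => x _; exact: (B0 (x, y)).
- exact: (@measurable_fun_fubini_tonelli_G _ _ RR RR R mu _ mB B0).
rewrite -(@fubini_tonelli _ _ RR RR R mu mu _ mA A0)/=.
have half : (\int[mu]_x (2^-1 * g x ^+ 2)%:E = (2^-1)%:E * \int[mu]_x (g x ^+ 2)%:E)%E.
  rewrite -ge0_integralZl//; [by meas|by move=> x _; rewrite lee_fin sqr_ge0].
rewrite (eq_integral (fun x : RR => (2^-1 * g x ^+ 2)%:E)); last first.
  move=> x _; under eq_integral do rewrite EFinM.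
  rewrite ge0_integralZl//=.
  - by rewrite integral_poisson_translate// mule1.
  - by meas.
  - by move=> y _; rewrite lee_fin.
  - by rewrite lee_fin mulr_ge0 ?sqr_ge0.
rewrite [X in (_ + X)%E](eq_integral (fun y : RR => (2^-1 * g y ^+ 2)%:E)); last first.
  move=> y _; under eq_integral do rewrite EFinM.
  rewrite ge0_integralZl//=.
  - under eq_integral do rewrite -poissonN opprB.
    by rewrite integral_poisson_translate// mule1.
  - by meas.
  - by move=> x _; rewrite lee_fin.
  - by rewrite lee_fin mulr_ge0 ?sqr_ge0.
rewrite half -ge0_muleDl ?lee_fin// -EFinD.
by rewrite (_ : 2^-1 + 2^-1 = 1 :> R) ?mul1e//; lra.
Qed.

Lemma ge0_monotone_sup (f : nat -> RR -> \bar R) (h : RR -> \bar R) (M : \bar R) :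
  (forall n, measurable_fun setT (f n)) -> (forall n x, 0 <= f n x)%E ->
  (forall x, {homo f^~ x : m n / (m <= n)%N >-> (m <= n)%E}) ->
  (forall x, f^~ x @ \oo --> h x) -> (forall n, \int[mu]_x f n x <= M)%E ->
  (\int[mu]_x h x <= M)%E.
Proof.
move=> mf f0 ndf fh fM.
have := @monotone_convergence _ RR R mu setT measurableT f mf (fun n x _ => f0 n x) (fun x _ => ndf x).
rewrite (_ : (fun x => limn (f^~ x)) = h); last by apply/funext => x; exact: cvg_lim.
move=> ->; apply: lime_le; last exact: nearW.
by apply: ereal_nondecreasing_is_cvgn => m n mn; apply: ge0_le_integral => // x _; exact: ndf.
Qed.

(** Monotone convergence in [hart_sqr_expR_le] as the damping disappears. *)
Lemma hart_contraction (g : RR -> R) : mu.-integrable setT (EFin \o g) ->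
  (\int[mu]_t (hart g t ^+ 2)%:E <= \int[mu]_x (g x ^+ 2)%:E)%E.
Proof.
move=> ig.
have mg : measurable_fun setT g by apply/measurable_EFinP; exact: measurable_int ig.
have mh := measurable_hart mg.
apply: (@ge0_monotone_sup (fun n t => (expR (- (n.+1%:R^-1 * `|t|)) * hart g t ^+ 2)%:E)).
- by move=> n; meas.
- by move=> n x; rewrite lee_fin mulr_ge0 ?sqr_ge0// expR_ge0.
- move=> x m n mn; rewrite lee_fin ler_wpM2r ?sqr_ge0// ler_expR lerN2 ler_wpM2r//.
  by rewrite lef_pV2 ?posrE// ler_nat.
- move=> x; apply: cvg_EFin; first exact: nearW.
  rewrite /comp/= -[X in _ --> X]mul1r; apply: cvgM; last exact: cvg_cst.
  rewrite -[X in _ --> X]expR0; apply: continuous_cvg; first exact: continuous_expR.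
  rewrite -[X in _ --> X]oppr0; apply: cvgN.
  rewrite -[X in _ --> X](mul0r `|x|); apply: cvgM; [exact: cvg_harmonic|exact: cvg_cst].
- by move=> n; apply: hart_sqr_expR_le => //; rewrite invr_gt0.
Qed.

Definition indic_cc (a b : R) : RR -> R := \1_`[a, b].

Lemma indic_ccE (a b x : R) : indic_cc a b x = ((a <= x <= b)%R)%:R.
Proof. by rewrite /indic_cc indicE mem_setE in_itv. Qed.

Lemma measurable_indic_cc (a b : R) : measurable_fun [set: RR] (indic_cc a b).
Proof. by apply: measurable_indic; exact: measurable_itv. Qed.

Lemma itv_measure_fin (a b : R) : (mu `[a, b] < +oo)%E.
Proof. by rewrite /= lebesgue_measure_itv/=; case: ifPn => //= _; rewrite -EFinB ltry. Qed.

Lemma bounded_measure_fin (J : set RR) (n : nat) : measurable J ->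
  (forall y : R, J y -> `|y| <= n%:R) -> (mu J < +oo)%E.
Proof.
move=> mJ Jn; apply: le_lt_trans (itv_measure_fin (- n%:R) n%:R).
apply: le_measure; rewrite ?inE//.
by move=> y Jy; rewrite /= in_itv/= -ler_norml; exact: Jn.
Qed.

Lemma integrable_indic_cc (a b : R) :
  mu.-integrable [set: RR] (EFin \o (indic_cc a b)).
Proof. exact: (@integrable_indic_itv R a b true false). Qed.

Lemma integral_indic_cc (a b : R) : a <= b ->
  (\int[mu]_x (indic_cc a b x)%:E = (b - a)%:E)%E.
Proof.
move=> ab; rewrite /indic_cc integral_indic//= setIT lebesgue_measure_itv/= lte_fin.
case: ifPn => [_|]; first by rewrite EFinB.
by rewrite -leNgt => ba; rewrite (@le_anti _ _ a b) ?ab// subrr.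
Qed.

(** With damping d^2 the Poisson kernel concentrates on a scale smaller than d:
    its mass on [-d, d] is the arctangent factor, close to 1. For y in
    [a + d, b - d] that mass lies in [a, b]. *)
Lemma hart_indic_ge (a b d : R) : 0 < d -> 2 * d <= b - a ->
  (((b - a - 2 * d) * (2 / pi * atan (2 * pi / d)))%:E <=
   \int[mu]_t (hart (indic_cc a b) t ^+ 2)%:E)%E.
Proof.
move=> d0 dab; have e0 : 0 < d ^+ 2 by rewrite exprn_gt0.
pose I := indic_cc a b; rewrite -/I.
have mI : measurable_fun setT I by exact: measurable_indic_cc.
have I0 x : 0 <= I x by rewrite /I indic_ccE.
have I1 x : I x <= 1 by rewrite /I indic_ccE; case: (_ <= _ <= _).
have iI : mu.-integrable [set: RR] (EFin \o I) by exact: integrable_indic_cc.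
have mp := measurable_poisson e0.
have mh := measurable_hart mI.
set c := 2 / pi * _.
have P0 x y : 0 <= poisson (d ^+ 2) (x - y) by exact: poisson_ge0.
pose J (y : RR) : R := \int[mu]_x (I x * poisson (d ^+ 2) (x - y)).
have mJ : measurable_fun setT J.
  by apply: (@measurable_Rintegral_fst _ _ RR RR R mu (fun p : RR * RR => I p.1 * poisson (d ^+ 2) (p.1 - p.2))); meas.
have EJ1 y : (\int[mu]_x (I x * poisson (d ^+ 2) (x - y))%:E <= 1)%E.
  rewrite -(integral_poisson_translate y e0); apply: ge0_le_integral => //.
  - by move=> x _; rewrite lee_fin mulr_ge0.
  - by meas.
  - by meas.
  - by move=> x _; rewrite -[poisson _ (y - x)]poissonN opprB lee_fin; apply: ler_piMl.
have EJ y : (\int[mu]_x (I x * poisson (d ^+ 2) (x - y))%:E)%E = (J y)%:E.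
  rewrite /J /Rintegral fineK// ge0_fin_numE ?(le_lt_trans (EJ1 y)) ?ltry//.
  by apply: integral_ge0 => x _; rewrite lee_fin mulr_ge0.
have J0 y : 0 <= J y by apply: Rintegral_ge0 => x _; rewrite mulr_ge0.
have J1 y : J y <= 1 by rewrite -lee_fin -EJ.
have Jc y : a + d <= y <= b - d -> c <= J y.
  move=> /andP[y1 y2]; rewrite -lee_fin -EJ.
  have mi := measurable_indic_cc (- d) d.
  have i0 x : 0 <= indic_cc (- d) d x by rewrite indic_ccE.
  have -> : c%:E = (\int[mu]_x (indic_cc (- d) d (x - y) * poisson (d ^+ 2) (x - y))%:E)%E.
    rewrite (@ge0_integral_translate _ (- y) (fun t => (indic_cc (- d) d t * poisson (d ^+ 2) t)%:E)); last 2 first.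
    - by meas.
    - by move=> x; rewrite lee_fin mulr_ge0// poisson_ge0.
    transitivity (\int[mu]_(t in `[(- d)%R, d]) (poisson (d ^+ 2) t)%:E)%E.
      rewrite integral_poisson_itv//; congr (_%:E); rewrite /c; congr (_ * atan _).
      by field; rewrite gt_eqF.
    rewrite integral_mkcond; apply: eq_integral => x _.
    by rewrite patchE mem_setE in_itv/= indic_ccE; case: ifPn => _; rewrite ?mul1r ?mul0r.
  apply: ge0_le_integral => //.
  - by move=> x _; rewrite lee_fin mulr_ge0.
  - by meas.
  - by meas.
  - move=> x _; rewrite lee_fin ler_wpM2r// /I !indic_ccE ler_nat.
    case: (boolP (- d <= x - y <= d)) => // /andP[h1 h2].
    by rewrite (_ : (a <= x <= b) = true)//; apply/andP; split; lra.
have iL := integrable_hart_sqr_expR e0 iI.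
have me : measurable_fun [set: RR] (fun t : RR => expR (- (d ^+ 2 * `|t|)) : R) by meas.
apply: (@le_trans _ _ (\int[mu]_t (expR (- (d ^+ 2 * `|t|)) * hart I t ^+ 2)%:E)%E); last first.
  apply: ge0_le_integral => //.
  - by move=> x _; rewrite lee_fin mulr_ge0 ?sqr_ge0// expR_ge0.
  - exact: measurable_int iL.
  - by meas.
  - move=> x _; rewrite lee_fin; apply: ler_piMl; first exact: sqr_ge0.
    by rewrite -expR0 ler_expR oppr_le0 mulr_ge0// ltW.
rewrite -[leRHS]fineK; last exact: integrable_fin_num.
rewrite -/(Rintegral _ _ _) Rintegral_hart_sqr_expR// lee_fin -/J.
have -> : (b - a - 2 * d) * c = \int[mu]_y (c * indic_cc (a + d) (b - d) y).
  rewrite RintegralZl//; last exact: integrable_indic_cc.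
  rewrite mulrC /Rintegral integral_indic_cc/=; last by lra.
  by congr (_ * _); ring.
apply: le_Rintegral => //.
- by apply: integrable_scalel; exact: integrable_indic_cc.
- have J1' y : `|J y| <= 1 by rewrite ger0_norm.
  exact: (integrable_mul_bounded iI mJ J1').
- move=> y _; rewrite -/(J y) indic_ccE; case: (boolP (a + d <= y <= b - d)) => [h|_]; last by rewrite mulr0 mulr_ge0.
  rewrite mulr1 /I indic_ccE (_ : (a <= y <= b) = true) ?mul1r; first exact: Jc.
  by move/andP: h => [h1 h2]; apply/andP; split; lra.
Qed.

(** The upper bound is [hart_contraction]; the lower one is the limit of
    [hart_indic_ge] along d = 1 / (n + 1). *)
Lemma hart_indic_cc (a b : R) : a <= b ->
  (\int[mu]_t (hart (indic_cc a b) t ^+ 2)%:E = (b - a)%:E)%E.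
Proof.
move=> ab; apply/eqP; rewrite eq_le; apply/andP; split.
  rewrite (le_trans (hart_contraction (integrable_indic_cc a b)))//.
  rewrite -integral_indic_cc// le_eqVlt; apply/orP; left; apply/eqP.
  by apply: eq_integral => x _; rewrite indic_ccE; case: (_ <= _ <= _); rewrite ?expr1n ?expr0n.
pose u n : R := (b - a - 2 * n.+1%:R^-1) * (2 / pi * atan (2 * pi * n.+1%:R)).
have c0 (n : nat) : 0 <= 2 / pi * atan (2 * pi * n.+1%:R) :> R.
  rewrite mulr_ge0 ?divr_ge0 ?pi_ge0//.
  by rewrite -(@atan0 R) le_atan// !mulr_ge0// pi_ge0.
have uX n : ((u n)%:E <= \int[mu]_t (hart (indic_cc a b) t ^+ 2)%:E)%E.
  have [h|h] := leP (2 * n.+1%:R^-1) (b - a); last first.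
    apply: (@le_trans _ _ 0%E); last by apply: integral_ge0 => t _; rewrite lee_fin sqr_ge0.
    by rewrite lee_fin mulr_le0_ge0// subr_le0 ltW.
  have := hart_indic_ge (a := a) (b := b) _ h.
  by rewrite invr_gt0 invrK; apply.
have cu : u n @[n --> \oo] --> (b - a).
  rewrite [X in _ --> X](_ : _ = (b - a - 2 * 0) * (2 / pi * (pi / 2))); last first.
    by rewrite mulr0 subr0 mulf_div [X in X / _]mulrC divff ?mulr1// mulf_neq0 ?gt_eqF ?pi_gt0.
  apply: cvgM.
    apply: cvgB; first exact: cvg_cst.
    by apply: cvgM; [exact: cvg_cst|exact: cvg_harmonic].
  apply: cvgM; first exact: cvg_cst.
  rewrite (_ : (fun n : nat => _) = (@atan R) \o (fun n : nat => 2 * pi * n.+1%:R))//.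
  apply: (@cvg_comp _ _ _ _ _ _ (pinfty_nbhs R)); last exact: cvgy_atan.
  rewrite (_ : (fun n : nat => _) = ( *%R (2 * pi : R)) \o (fun n : nat => n.+1%:R))//.
  apply: (@cvg_comp _ _ _ _ _ _ (pinfty_nbhs R)).
    by apply/cvgrnyP; rewrite (cvg_shiftS id); exact: cvg_id.
  by apply: gt0_cvgMry; [rewrite mulr_gt0 ?pi_gt0|exact: cvg_id].
move: uX; move: (\int[mu]_t _)%E => [r| |] uX; last 2 first.
- by rewrite leey.
- by have := uX 0%N.
rewrite lee_fin; rewrite -(cvg_lim _ cu)//; apply: limr_le; first by apply: cvgP cu.
by apply: nearW => n; rewrite -lee_fin.
Qed.

End hartley_line.

(** * Square-integrable functions *)

Section square_integrable.
Context {d : measure_display} {T : measurableType d} {R : realType}.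
Context (mu : {measure set T -> \bar R}).
Implicit Types f g h : T -> R.

Definition sqint f : \bar R := (\int[mu]_x (f x ^+ 2)%:E)%E.

Definition L2 f : Prop := measurable_fun setT f /\ (sqint f < +oo)%E.

Definition ip f g : R := \int[mu]_x (f x * g x).

(** The squared norm. Working with it spares square roots, at the price of
    factors 2 in the triangle inequalities. *)
Definition sqn f : R := ip f f.

Lemma L2_meas f : L2 f -> measurable_fun setT f.
Proof. by case. Qed.

Lemma sqint_ge0 f : (0 <= sqint f)%E.
Proof. by apply: integral_ge0 => x _; rewrite lee_fin sqr_ge0. Qed.

Lemma L2_mul_integrable f g : L2 f -> L2 g ->
  mu.-integrable setT (fun x => (f x * g x)%:E).
Proof.
move=> [mf if2] [mg ig2].
apply: (@le_integrable _ _ _ mu setT measurableT _ (fun x => (f x ^+ 2)%:E + (g x ^+ 2)%:E)%E).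
- by meas.
- move=> x _; rewrite -EFinD !abse_EFin lee_fin [leRHS]ger0_norm ?addr_ge0 ?sqr_ge0//.
  rewrite normrM -(real_normK (num_real (f x))) -(real_normK (num_real (g x))).
  have := sqr_ge0 (`|f x| - `|g x|); have := normr_ge0 (f x); have := normr_ge0 (g x); nra.
- apply: integrableD => //; apply/integrableP; split; [by meas| |by meas|].
  + by under eq_integral do rewrite gee0_abs ?lee_fin ?sqr_ge0//.
  + by under eq_integral do rewrite gee0_abs ?lee_fin ?sqr_ge0//.
Qed.

Lemma L2_sqr_integrable f : L2 f -> mu.-integrable setT (fun x => (f x ^+ 2)%:E).
Proof. by move=> Lf; under eq_fun do rewrite expr2; exact: L2_mul_integrable. Qed.

Lemma sqintE f : L2 f -> sqint f = (sqn f)%:E.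
Proof.
move=> Lf; rewrite /sqn /ip /Rintegral fineK; last exact: integrable_fin_num (L2_mul_integrable Lf Lf).
by rewrite /sqint; under eq_integral do rewrite expr2.
Qed.

Lemma sqn_ge0 f : 0 <= sqn f.
Proof. by apply: Rintegral_ge0 => x _; rewrite -expr2 sqr_ge0. Qed.

Lemma L2_le_sqint f g : measurable_fun setT f -> L2 g -> (sqint f <= sqint g)%E -> L2 f.
Proof. by move=> mf [_ ig] fg; split => //; exact: le_lt_trans ig. Qed.

Lemma L2_le f g : measurable_fun setT f -> L2 g -> (forall x, `|f x| <= `|g x|) -> L2 f.
Proof.
move=> mf Lg fg; apply: L2_le_sqint (Lg) _ => //.
have mg := L2_meas Lg.
apply: ge0_le_integral => //; [by move=> x _; rewrite lee_fin sqr_ge0|by meas|by meas|].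
move=> x _; rewrite lee_fin -(real_normK (num_real (f x))) -(real_normK (num_real (g x))).
by rewrite ler_sqr ?nnegrE.
Qed.

Lemma L2_indic (A : set T) : measurable A -> (mu A < +oo)%E -> L2 (\1_A).
Proof.
move=> mA Aoo; split; first exact: measurable_indic.
rewrite /sqint (eq_integral (fun x => (\1_A x)%:E)); last first.
  by move=> x _; rewrite indicE; case: (_ \in _); rewrite ?expr1n ?expr0n.
by rewrite integral_indic// setIT.
Qed.

Lemma L2Z (k : R) f : L2 f -> L2 (fun x => k * f x).
Proof.
move=> [mf if2]; split; first by meas.
rewrite /sqint; under eq_integral do rewrite exprMn EFinM.
rewrite ge0_integralZl//; last 3 first.
- by meas.
- by move=> x _; rewrite lee_fin sqr_ge0.
- by rewrite lee_fin sqr_ge0.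
by rewrite lte_mul_pinfty// lee_fin sqr_ge0.
Qed.

Lemma L2D f g : L2 f -> L2 g -> L2 (fun x => f x + g x).
Proof.
move=> Lf Lg; have [mf _] := Lf; have [mg _] := Lg; split; first by meas.
have i1 := L2_sqr_integrable Lf; have i2 := L2_sqr_integrable Lg.
have i3 := L2_mul_integrable (L2Z 2 Lf) Lg.
have : mu.-integrable setT (fun x => ((f x + g x) ^+ 2)%:E).
  rewrite (_ : (fun x => _) = ((fun x => (f x ^+ 2)%:E) \+ ((fun x => (2 * f x * g x)%:E) \+ (fun x => (g x ^+ 2)%:E)))%E).
    by apply: integrableD => //; exact: integrableD.
  by apply/funext => x /=; rewrite -!EFinD; congr (_%:E); ring.
by move/integrableP => [_]; under eq_integral do rewrite gee0_abs ?lee_fin ?sqr_ge0//.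
Qed.

Lemma L2N f : L2 f -> L2 (fun x => - f x).
Proof. by move=> Lf; under eq_fun do rewrite -mulN1r; exact: L2Z. Qed.

Lemma L2B f g : L2 f -> L2 g -> L2 (fun x => f x - g x).
Proof. by move=> Lf Lg; apply: L2D => //; exact: L2N. Qed.

Lemma L20 : L2 (fun=> 0).
Proof. by split; [meas|rewrite /sqint; under eq_integral do rewrite expr0n/=; rewrite integral0]. Qed.

Lemma ipC f g : ip f g = ip g f.
Proof. by apply: eq_Rintegral => x _; rewrite mulrC. Qed.

Lemma ipDl f g h : L2 f -> L2 g -> L2 h -> ip (fun x => f x + g x) h = ip f h + ip g h.
Proof.
move=> Lf Lg Lh; rewrite /ip -RintegralD//; try exact: L2_mul_integrable.
by apply: eq_Rintegral => x _; rewrite mulrDl.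
Qed.

Lemma ipZl k f g : L2 f -> L2 g -> ip (fun x => k * f x) g = k * ip f g.
Proof.
move=> Lf Lg; rewrite /ip -RintegralZl//; try exact: L2_mul_integrable.
by apply: eq_Rintegral => x _; rewrite mulrA.
Qed.

Lemma ipNl f g : L2 f -> L2 g -> ip (fun x => - f x) g = - ip f g.
Proof.
by move=> Lf Lg; rewrite -mulN1r -ipZl//; apply: eq_Rintegral => x _; rewrite mulN1r.
Qed.

Lemma ipBl f g h : L2 f -> L2 g -> L2 h -> ip (fun x => f x - g x) h = ip f h - ip g h.
Proof. by move=> Lf Lg Lh; rewrite ipDl ?ipNl//; exact: L2N. Qed.

Lemma ipDr f g h : L2 f -> L2 g -> L2 h -> ip h (fun x => f x + g x) = ip h f + ip h g.
Proof. by move=> Lf Lg Lh; rewrite ipC ipDl// !(ipC h). Qed.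

Lemma ipZr k f g : L2 f -> L2 g -> ip g (fun x => k * f x) = k * ip g f.
Proof. by move=> Lf Lg; rewrite ipC ipZl// (ipC g). Qed.

Lemma ipNr f g : L2 f -> L2 g -> ip g (fun x => - f x) = - ip g f.
Proof. by move=> Lf Lg; rewrite ipC ipNl// (ipC g). Qed.

Lemma ipBr f g h : L2 f -> L2 g -> L2 h -> ip h (fun x => f x - g x) = ip h f - ip h g.
Proof. by move=> Lf Lg Lh; rewrite ipC ipBl// !(ipC h). Qed.

Lemma sqnD f g : L2 f -> L2 g -> sqn (fun x => f x + g x) = sqn f + 2 * ip f g + sqn g.
Proof.
move=> Lf Lg; rewrite /sqn ipDl ?ipDr//; try exact: L2D.
by rewrite (ipC g f); ring.
Qed.

Lemma sqnB f g : L2 f -> L2 g -> sqn (fun x => f x - g x) = sqn f - 2 * ip f g + sqn g.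
Proof.
move=> Lf Lg; rewrite /sqn ipBl ?ipBr//; try exact: L2B.
by rewrite (ipC g f); ring.
Qed.

Lemma sqnZ k f : L2 f -> sqn (fun x => k * f x) = k ^+ 2 * sqn f.
Proof.
by move=> Lf; rewrite /sqn ipZl ?ipZr// ?mulrA -?expr2//; exact: L2Z.
Qed.

Lemma sqnN f : sqn (fun x => - f x) = sqn f.
Proof. by apply: eq_Rintegral => x _; rewrite mulrNN. Qed.

Lemma sqn_subC f g : sqn (fun x => f x - g x) = sqn (fun x => g x - f x).
Proof. by rewrite -sqnN; congr sqn; apply/funext => x; rewrite opprB. Qed.

Lemma sqn_addle f g : L2 f -> L2 g -> sqn (fun x => f x + g x) <= 2 * sqn f + 2 * sqn g.
Proof.
move=> Lf Lg; rewrite sqnD//; have := sqn_ge0 (fun x => f x - g x).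
by rewrite sqnB//; lra.
Qed.

Lemma sqn_tri f g h : L2 f -> L2 g -> L2 h ->
  sqn (fun x => f x - h x) <= 2 * sqn (fun x => f x - g x) + 2 * sqn (fun x => g x - h x).
Proof.
move=> Lf Lg Lh; have := sqn_addle (L2B Lf Lg) (L2B Lg Lh).
by rewrite (_ : (fun x => f x - g x + (g x - h x)) = (fun x => f x - h x))//; apply/funext => x; ring.
Qed.

Lemma cauchy_schwarz f g : L2 f -> L2 g -> ip f g ^+ 2 <= sqn f * sqn g.
Proof.
move=> Lf Lg; have g0 := sqn_ge0 g; have f0 := sqn_ge0 f.
have H t : 0 <= sqn f + 2 * t * ip f g + t ^+ 2 * sqn g.
  have := sqn_ge0 (fun x => f x + t * g x).
  by rewrite sqnD ?ipZr ?sqnZ//; [rewrite mulrA|exact: L2Z].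
have [g1|g1] := eqVneq (sqn g) 0.
  rewrite g1 mulr0; have [->|b0] := eqVneq (ip f g) 0; first by rewrite expr0n.
  have := H (- (sqn f + 1) / (2 * ip f g)).
  rewrite g1 mulr0 addr0 (_ : 2 * _ * _ = - (sqn f + 1)); last by field.
  lra.
have gp : 0 < sqn g by rewrite lt_neqAle eq_sym g1.
have := H (- ip f g / sqn g).
rewrite (_ : _ + _ = (sqn f * sqn g - ip f g ^+ 2) / sqn g); last by field.
by rewrite pmulr_lge0 ?invr_gt0// subr_ge0.
Qed.

Lemma sqn0_ip0 f g : L2 f -> L2 g -> sqn f = 0 -> ip f g = 0.
Proof.
move=> Lf Lg f0; have := cauchy_schwarz Lf Lg.
by rewrite f0 mul0r => h; apply/eqP; rewrite -sqrf_eq0 eq_le h sqr_ge0.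
Qed.

Lemma sqn0_ae f : L2 f -> sqn f = 0 -> {ae mu, forall x, f x = 0}.
Proof.
move=> Lf f0; have [mf _] := Lf; have mf2 : measurable_fun setT (fun x => (f x ^+ 2)%:E) by meas.
have := (ae_eq_integral_abs mu measurableT mf2).1.
under eq_integral do rewrite gee0_abs ?lee_fin ?sqr_ge0//.
rewrite -/(sqint f) sqintE// f0 => /(_ erefl).
apply: filterS => x /= /(_ Logic.I)/= [] /eqP.
by rewrite sqrf_eq0 => /eqP.
Qed.

Lemma ae_sqint f g : measurable_fun setT f -> measurable_fun setT g ->
  {ae mu, forall x, f x = g x} -> sqint f = sqint g.
Proof.
move=> mf mg fg; apply: ge0_ae_eq_integral => //; [by meas|by meas| | |].
- by move=> x _; rewrite lee_fin sqr_ge0.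
- by move=> x _; rewrite lee_fin sqr_ge0.
- by apply: filterS fg => x fg _; rewrite fg.
Qed.

Lemma ae_sqn0 f : measurable_fun setT f -> {ae mu, forall x, f x = 0} -> L2 f /\ sqn f = 0.
Proof.
move=> mf f0; have E : sqint f = sqint (fun=> 0) by apply: ae_sqint => //; meas.
have Lf : L2 f by apply: L2_le_sqint L20 _ => //; rewrite E.
split=> //; apply: EFin_inj; rewrite -sqintE// E sqintE; last exact: L20.
by rewrite /sqn /ip; under eq_Rintegral do rewrite mulr0; rewrite /Rintegral integral0.
Qed.

Definition cvgl2 (F : nat -> T -> R) f : Prop :=
  sqn (fun x => F n x - f x) @[n --> \oo] --> (0 : R).

Lemma sqn_cvg0_le (u v : nat -> R) : (forall n, 0 <= u n) -> (forall n, u n <= v n) ->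
  v n @[n --> \oo] --> (0 : R) -> u n @[n --> \oo] --> (0 : R).
Proof.
move=> u0 uv v0; apply: (@squeeze_cvgr _ _ _ _ (cst 0) v) => //; last exact: cvg_cst.
by apply: nearW => n; rewrite u0 uv.
Qed.

Lemma cvgl2D F G f g : (forall n, L2 (F n)) -> (forall n, L2 (G n)) -> L2 f -> L2 g ->
  cvgl2 F f -> cvgl2 G g -> cvgl2 (fun n x => F n x + G n x) (fun x => f x + g x).
Proof.
move=> LF LG Lf Lg Ff Gg.
apply: (@sqn_cvg0_le _ (fun n => 2 * sqn (fun x => F n x - f x) + 2 * sqn (fun x => G n x - g x))).
- by move=> n; exact: sqn_ge0.
- move=> n; rewrite (_ : (fun x => _) = (fun x => (F n x - f x) + (G n x - g x))).
    by apply: sqn_addle; exact: L2B.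
  by apply/funext => x; ring.
- rewrite -[X in _ --> X](addr0 0) -[X in _ --> X + _](mulr0 2) -[X in _ --> _ + X](mulr0 2).
  by apply: cvgD; apply: cvgM => //; exact: cvg_cst.
Qed.

Lemma cvgl2Z k F f : (forall n, L2 (F n)) -> L2 f ->
  cvgl2 F f -> cvgl2 (fun n x => k * F n x) (fun x => k * f x).
Proof.
move=> LF Lf Ff; rewrite /cvgl2.
rewrite (_ : (fun n => _) = (fun n => k ^+ 2 * sqn (fun x => F n x - f x))).
  by rewrite -[X in _ --> X](mulr0 (k ^+ 2)); apply: cvgM => //; exact: cvg_cst.
apply/funext => n; rewrite -sqnZ; last exact: L2B.
by congr sqn; apply/funext => x; ring.
Qed.

Lemma cvgl2_unique F f g : (forall n, L2 (F n)) -> L2 f -> L2 g ->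
  cvgl2 F f -> cvgl2 F g -> sqn (fun x => f x - g x) = 0.
Proof.
move=> LF Lf Lg Ff Fg; apply/eqP; rewrite eq_le sqn_ge0 andbT.
have h : 2 * sqn (fun x => F n x - f x) + 2 * sqn (fun x => F n x - g x) @[n --> \oo] --> (0 : R).
  rewrite -[X in _ --> X](addr0 0) -[X in _ --> X + _](mulr0 2) -[X in _ --> _ + X](mulr0 2).
  by apply: cvgD; apply: cvgM => //; exact: cvg_cst.
rewrite -(cvg_lim _ h)//; apply: limr_ge; first by apply: cvgP h.
by apply: nearW => n; rewrite (sqn_subC (F n) f); exact: sqn_tri.
Qed.

Lemma cvgl2_ip F f g : (forall n, L2 (F n)) -> L2 f -> L2 g ->
  cvgl2 F f -> ip (F n) g @[n --> \oo] --> ip f g.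
Proof.
move=> LF Lf Lg Ff.
suff h : ip (F n) g - ip f g @[n --> \oo] --> (0 : R).
  rewrite (_ : (fun n => ip (F n) g) = (fun n => (ip (F n) g - ip f g) + ip f g)); last first.
    by apply/funext => n; rewrite subrK.
  by rewrite -[X in _ --> X]add0r; apply: cvgD => //; exact: cvg_cst.
apply: norm_cvg0.
have h2 : (ip (F n) g - ip f g) ^+ 2 @[n --> \oo] --> (0 : R).
  apply: (@sqn_cvg0_le _ (fun n => sqn (fun x => F n x - f x) * sqn g)).
  - by move=> n; exact: sqr_ge0.
  - by move=> n; rewrite -ipBl//; apply: cauchy_schwarz => //; exact: L2B.
  - by rewrite -[X in _ --> X](mul0r (sqn g)); apply: cvgM => //; exact: cvg_cst.
rewrite -[X in _ --> X](@sqrtr0 R).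
under eq_fun do rewrite -sqrtr_sqr.
by apply: continuous_cvg => //; exact: sqrt_continuous.
Qed.

Lemma cvgl2_sqn F f : (forall n, L2 (F n)) -> L2 f ->
  cvgl2 F f -> sqn (F n) @[n --> \oo] --> sqn f.
Proof.
move=> LF Lf Ff.
rewrite (_ : (fun n => _) = (fun n => sqn (fun x => F n x - f x) + 2 * ip (F n) f - sqn f)); last first.
  by apply/funext => n; rewrite sqnB//; ring.
rewrite [X in _ --> X](_ : _ = 0 + 2 * ip f f - sqn f); last by rewrite /sqn; ring.
apply: cvgB; last exact: cvg_cst.
by apply: cvgD => //; apply: cvgM; [exact: cvg_cst|exact: cvgl2_ip].
Qed.

Lemma cvgl2_nn_le F f (M : R) : (forall n, L2 (F n)) -> L2 f ->
  cvgl2 F f -> (forall n, sqn (F n) <= M) -> sqn f <= M.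
Proof.
move=> LF Lf Ff FM; rewrite -(cvg_lim _ (cvgl2_sqn LF Lf Ff))//.
by apply: limr_le; [apply: cvgP (cvgl2_sqn LF Lf Ff)|exact: nearW].
Qed.

Lemma cvgl2_near F f G : (forall n, sqn (fun x => F n x - G n x) = 0) ->
  (forall n, L2 (F n)) -> (forall n, L2 (G n)) -> L2 f -> cvgl2 F f -> cvgl2 G f.
Proof.
move=> FG LF LG Lf Ff.
apply: (@sqn_cvg0_le _ (fun n => 2 * sqn (fun x => F n x - f x))).
- by move=> n; exact: sqn_ge0.
- move=> n; rewrite (le_trans (sqn_tri (LG n) (LF n) Lf))//.
  by rewrite sqn_subC FG mulr0 add0r.
- by rewrite -[X in _ --> X](mulr0 2); apply: cvgM => //; exact: cvg_cst.
Qed.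

End square_integrable.

(** * Completeness of L^2 *)

Section completeness.
Context {d : measure_display} {T : measurableType d} {R : realType}.
Context (mu : {measure set T -> \bar R}).

Lemma telescope_cvg (u : nat -> R) (M : R) :
  (forall n, \sum_(0 <= k < n) `|u k.+1 - u k| <= M) -> cvgn u.
Proof.
move=> uM; have c1 : cvgn (series (fun k => u k.+1 - u k)).
  apply: normed_cvg; apply: nondecreasing_is_cvgn.
    by apply: nondecreasing_series => n _ _; exact: normr_ge0.
  by exists M => _ [n _ <-]; exact: uM.
have -> : u = (fun n => series (fun k => u k.+1 - u k) n + u 0%N).
  by apply/funext => n; rewrite seriesEnat/= telescope_sumr// subrK.
by apply: is_cvgD => //; exact: is_cvg_cst.
Qed.

(** Pointwise increments d_k satisfy |d_k| <= 2^-k + 2^k d_k^2, and the sum of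
    the 2^k d_k^2 has a finite integral, hence is finite almost everywhere. *)
Lemma ae_cvg_fast (X : nat -> T -> R) : (forall n, L2 mu (X n)) ->
  (forall k, sqn mu (fun x => X k.+1 x - X k x) <= (4 ^ k)%:R^-1) ->
  {ae mu, forall x, cvgn (X ^~ x)}.
Proof.
move=> LX Xk; have mX n := L2_meas (LX n).
pose W x : \bar R := (\sum_(0 <= k <oo) (2 ^+ k * (X k.+1 x - X k x) ^+ 2)%:E)%E.
have LD k := L2B (LX k.+1) (LX k).
have t0 k x : (0 <= (2 ^+ k * (X k.+1 x - X k x) ^+ 2)%:E :> \bar R)%E.
  by rewrite lee_fin mulr_ge0 ?sqr_ge0 ?exprn_ge0.
have IW : (\int[mu]_x W x < +oo)%E.
  rewrite integral_nneseries//; last by move=> k; have mX1 := mX k; have mX2 := mX k.+1; meas.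
  apply: (@le_lt_trans _ _ (\sum_(0 <= k <oo) (2 / (2 ^ (k + 1))%:R)%:E)%E); last first.
    have /cvg_lim -> // := @cvg_geometric_eseries_half R 2 0.
    by rewrite ltry.
  apply: lee_nneseries => [k _ _|k _].
    by apply: integral_ge0 => x _.
  have mX1 := mX k; have mX2 := mX k.+1.
  under eq_integral do rewrite EFinM.
  rewrite ge0_integralZl//; last 2 first.
  - by meas.
  - by move=> x _; rewrite lee_fin sqr_ge0.
  rewrite -/(sqint mu _) (sqintE (LD k)) -EFinM lee_fin.
  apply: (@le_trans _ _ (2 ^+ k * (4 ^ k)%:R^-1)); first by rewrite ler_wpM2l ?exprn_ge0.
  rewrite addn1 expnS natrM invfM mulrA divff// mul1r.
  rewrite (_ : 4 = 2 * 2)%N// expnMn natrM invfM mulrA natrX divff ?expf_neq0// mul1r.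
  by [].
have mW : measurable_fun setT W.
  by apply: ge0_emeasurable_sum => // k _; have mX1 := mX k; have mX2 := mX k.+1; meas.
have iW : mu.-integrable setT W.
  apply/integrableP; split => //.
  by under eq_integral do rewrite gee0_abs ?nneseries_ge0//.
have := integrable_ae measurableT iW; apply: filterS => x /(_ Logic.I) Wx.
apply: (@telescope_cvg _ (2 + fine (W x))) => n.
apply: (@le_trans _ _ (\sum_(0 <= k < n) (2 ^- k + 2 ^+ k * (X k.+1 x - X k x) ^+ 2))).
  apply: ler_sum => k _.
  have h1 : 0 < 2 ^+ k :> R by rewrite exprn_gt0.
  have h2 := normr_ge0 (X k.+1 x - X k x).
  rewrite -(real_normK (num_real (X k.+1 x - X k x))).
  move: h1 h2; set a := 2 ^+ k; set b := `|_| => h1 h2.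
  rewrite -(ler_pM2l h1) mulrDr divff ?gt_eqF//.
  have := sqr_ge0 (a * b - 1); nra.
rewrite big_split/= lerD//.
  have : (\sum_(0 <= k < n) (2 / (2 ^ (k + 1))%:R)%:E <= 2%:E :> \bar R)%E.
    apply: (@le_trans _ _ (\sum_(0 <= k <oo) (2 / (2 ^ (k + 1))%:R)%:E)%E).
      by apply: nneseries_lim_ge.
    by have /cvg_lim -> // := @cvg_geometric_eseries_half R 2 0; rewrite expr0 divr1.
  rewrite sumEFin lee_fin; apply: le_trans; rewrite le_eqVlt; apply/orP; left; apply/eqP.
  by apply: eq_bigr => k _; rewrite addn1 expnS natrM invfM mulrA divff// mul1r natrX.
rewrite -lee_fin -sumEFin fineK//; apply: nneseries_lim_ge => k _ //.
Qed.

Lemma fatou_sqn (Y : nat -> T -> R) (G : T -> R) (M : R) :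
  (forall n, L2 mu (Y n)) -> measurable_fun setT G ->
  {ae mu, forall x, Y n x @[n --> \oo] --> G x} ->
  (\forall n \near \oo, sqn mu (Y n) <= M) -> (sqint mu G <= M%:E)%E.
Proof.
move=> LY mG YG YM; have mY n := L2_meas (LY n).
have mY2 n : measurable_fun setT (fun x => (Y n x ^+ 2)%:E) by have mYn := mY n; meas.
apply: (@le_trans _ _ (\int[mu]_x limn_einf (fun n => (Y n x ^+ 2)%:E))%E).
  rewrite le_eqVlt; apply/orP; left; apply/eqP.
  apply: ge0_ae_eq_integral => //.
  - by meas.
  - rewrite (_ : (fun x => _) = (fun x => - limn_esup (fun n => - (Y n x ^+ 2)%:E))%E); last first.
      apply/funext => x; rewrite -limn_einfN; congr limn_einf.
      by apply/funext => n; rewrite /comp oppeK.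
    apply: (measurableT_comp (@oppe_measurable _ setT)).
    by apply: measurable_fun_limn_esup => n; apply: (measurableT_comp (@oppe_measurable _ setT)).
  - by move=> x _; rewrite lee_fin sqr_ge0.
  - move=> x _; rewrite limn_einf_lim; apply: lime_ge.
      exact: (cvgP _ (@cvg_einfs_sup _ _)).
    apply: nearW => n; apply: le_ereal_inf_tmp => _ [m _ <-].
    by rewrite lee_fin sqr_ge0.
  - apply: filterS YG => x YG _.
    have h : (Y n x ^+ 2)%:E @[n --> \oo] --> (G x ^+ 2)%:E.
      apply: cvg_EFin; first exact: nearW.
      rewrite /comp/= expr2; under eq_fun do rewrite expr2.
      exact: cvgM.
    by have [->] := cvg_limn_einf_sup h.
apply: (le_trans (fatou _ _ _ _)) => //.
  by move=> n x _; rewrite lee_fin sqr_ge0.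
rewrite limn_einf_lim; apply: lime_le; first exact: (cvgP _ (@cvg_einfs_sup _ _)).
apply: nearW => n.
have [N _ hN] := YM.
apply: (@le_trans _ _ (sqint mu (Y (maxn n N)))).
  by apply: ereal_inf_lbound; exists (maxn n N) => //=; rewrite leq_maxl.
by rewrite sqintE// lee_fin hN//= leq_maxr.
Qed.

Lemma exists_fast_subseq (X : nat -> T -> R) :
  (forall e, 0 < e -> exists N, forall m n, (N <= m)%N -> (N <= n)%N ->
    sqn mu (fun x => X m x - X n x) <= e) ->
  exists2 phi : nat -> nat, (forall k, (k <= phi k)%N) &
    (forall k, sqn mu (fun x => X (phi k.+1) x - X (phi k) x) <= (4 ^ k)%:R^-1).
Proof.
move=> cX; have p0 k : 0 < ((4 ^ k)%:R^-1 : R) by rewrite invr_gt0 ltr0n expn_gt0.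
have /choice[N hN] : forall k, exists N, forall m n, (N <= m)%N -> (N <= n)%N ->
    sqn mu (fun x => X m x - X n x) <= (4 ^ k)%:R^-1 by move=> k; exact: cX.
exists (fun k => (k + \max_(j < k.+1) N j)%N) => [k|k]; first exact: leq_addr.
have h (j k' : nat) : (j <= k')%N -> (N j <= k' + \max_(j < k'.+1) N j)%N.
  move=> jk; apply: leq_trans (leq_addl _ _).
  by rewrite -ltnS in jk; exact: (@leq_bigmax _ (fun i : 'I_k'.+1 => N i) (Ordinal jk)).
by apply: hN; apply: h.
Qed.

(** Riesz-Fischer: a fast subsequence converges almost everywhere, and Fatou's
    lemma turns this into norm convergence of the whole sequence. *)
Theorem L2_complete (X : nat -> T -> R) : (forall n, L2 mu (X n)) ->
  (forall e, 0 < e -> exists N, forall m n, (N <= m)%N -> (N <= n)%N ->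
    sqn mu (fun x => X m x - X n x) <= e) ->
  exists2 G, L2 mu G & cvgl2 mu X G.
Proof.
move=> LX cX; have [phi phik fast] := exists_fast_subseq cX.
have mX n := L2_meas (LX n).
have ac := @ae_cvg_fast (fun k => X (phi k)) (fun k => LX _) fast.
pose G x := fine (limn_esup (fun k => (X (phi k) x)%:E)).
have mG : measurable_fun setT G.
  apply: (measurableT_comp (@fine_measurable _ setT measurableT)).
  apply: measurable_fun_limn_esup => k; have mXk := mX (phi k); meas.
have XG : {ae mu, forall x, X (phi k) x @[k --> \oo] --> G x}.
  apply: filterS ac => x cx.
  have h : (X (phi k) x)%:E @[k --> \oo] --> (limn (fun k => X (phi k) x))%:E.
    by apply: cvg_EFin; [exact: nearW|exact: cx].
  by rewrite /G (cvg_limn_einf_sup h).2/=.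
have key n e : (forall m, (n <= m)%N -> sqn mu (fun x => X m x - X n x) <= e) ->
    (sqint mu (fun x => G x - X n x)%R <= e%:E)%E.
  move=> h; apply: (@fatou_sqn (fun k x => X (phi k) x - X n x)).
  - by move=> k; exact: L2B.
  - by have mXn := mX n; meas.
  - by apply: filterS XG => x xG; apply: cvgB => //; exact: cvg_cst.
  - by exists n => // k /= nk; apply: h; exact: leq_trans (phik k).
have LG : L2 mu G.
  have [N hN] := cX 1 ltr01.
  have L1 : L2 mu (fun x => G x - X N x).
    split; first by have mXN := mX N; meas.
    by apply: (le_lt_trans (key N 1 _)); [move=> m Nm; exact: hN|rewrite ltry].
  by have := L2D L1 (LX N); under eq_fun do rewrite subrK.
exists G => //; apply/cvgr0Pnorm_le => e e0.
have [N hN] := cX e e0; exists N => // n /= Nn.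
rewrite ger0_norm ?sqn_ge0// sqn_subC -lee_fin -sqintE; last exact: L2B.
by apply: key => m nm; apply: hN => //; exact: leq_trans nm.
Qed.

End completeness.

(** * The Hartley transform in the first variable, on truncated functions *)

(** The squares |F n - g|^2 are dominated by 4 g^2. *)
Lemma cvgl2_dominated {d} {T : measurableType d} {R : realType}
    (mu : {measure set T -> \bar R}) (F : nat -> T -> R) (g : T -> R) :
  L2 mu g -> (forall n, measurable_fun setT (F n)) ->
  (forall n x, `|F n x| <= `|g x|) ->
  (forall x, F n x @[n --> \oo] --> g x) -> cvgl2 mu F g.
Proof.
move=> Lg mF Fg cF; have mg := L2_meas Lg.
have LF n : L2 mu (F n) by exact: L2_le (Lg) _.
have mD n : measurable_fun setT (fun x => ((F n x - g x) ^+ 2)%:E).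
  by have mFn := mF n; meas.
have := @dominated_convergence _ _ _ mu setT measurableT
  (fun n x => ((F n x - g x) ^+ 2)%:E) (fun=> 0%E) (fun x => (4 * (g x ^+ 2))%:E).
move=> /(_ mD) []//.
- apply: aeW => x _; apply: cvg_EFin; first exact: nearW.
  rewrite /comp/= -[X in _ --> X](mul0r 0); under eq_fun do rewrite expr2.
  have h : F n x - g x @[n --> \oo] --> (0 : R).
    by rewrite -(subrr (g x)); apply: cvgB => //; exact: cvg_cst.
  exact: cvgM.
- by under eq_fun do rewrite EFinM; apply: integrableZl => //; exact: L2_sqr_integrable.
- apply: aeW => x n _; rewrite abse_EFin lee_fin ger0_norm ?sqr_ge0//.
  rewrite -(real_normK (num_real (F n x - g x))) -(real_normK (num_real (g x))).
  have h1 : `|F n x - g x| <= 2 * `|g x|.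
    by rewrite (le_trans (ler_normB _ _))//; have := Fg n x; lra.
  have h2 := normr_ge0 (F n x - g x); nra.
by move=> _ _; rewrite integral0 => /fine_cvg.
Qed.

Section plane.
Context {R : realType}.
Notation mu := (@lebesgue_measure R).
Notation mu2 := (leb2 R).
Local Notation RR := (measurableTypeR R).
Implicit Types g h : RR * RR -> R.

Lemma measurable_section_fst g (y : RR) : measurable_fun setT g ->
  measurable_fun setT (fun x : RR => g (x, y)).
Proof. by move=> mg; meas. Qed.

Lemma sqint_sections g : measurable_fun setT g ->
  sqint mu2 g = (\int[mu]_y sqint mu (fun x => g (x, y)))%E.
Proof.
move=> mg; rewrite /sqint; apply: (@fubini_tonelli2 _ _ RR RR R mu mu (fun p => (g p ^+ 2)%:E)).
  by meas.
by move=> p; rewrite lee_fin sqr_ge0.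
Qed.

Lemma measurable_sqint_section g : measurable_fun setT g ->
  measurable_fun setT (fun y : RR => sqint mu (fun x => g (x, y))).
Proof.
move=> mg; apply: (@measurable_fun_fubini_tonelli_G _ _ RR RR R mu (fun p => (g p ^+ 2)%:E)).
  by meas.
by move=> p; rewrite lee_fin sqr_ge0.
Qed.

Lemma ae_L2_section g : L2 mu2 g ->
  {ae mu, forall y, L2 mu (fun x => g (x, y))}.
Proof.
move=> [mg ig].
have i1 : mu.-integrable setT (fun y : RR => sqint mu (fun x => g (x, y))).
  apply/integrableP; split; first exact: measurable_sqint_section.
  under eq_integral do rewrite gee0_abs ?sqint_ge0//.
  by rewrite -sqint_sections.
have := integrable_ae measurableT i1; apply: filterS => y /(_ Logic.I) h.
split; first exact: measurable_section_fst.
by rewrite -ge0_fin_numE// sqint_ge0.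
Qed.

Lemma sqint_ae_section0 g : measurable_fun setT g ->
  {ae mu, forall y, forall x, g (x, y) = 0} -> L2 mu2 g /\ sqn mu2 g = 0.
Proof.
move=> mg g0; have E : sqint mu2 g = 0%E.
  rewrite sqint_sections// (@ae_eq_integral _ _ _ mu setT (cst 0%E))//.
  - by rewrite integral0.
  - exact: measurable_sqint_section.
  - apply: filterS g0 => y g0 _; rewrite /sqint.
    by under eq_integral do rewrite g0 expr0n/=; rewrite integral0.
have Lg : L2 mu2 g by split=> //; rewrite E.
by split=> //; apply: EFin_inj; rewrite -sqintE.
Qed.

Definition xbounded g := exists n : nat, forall p, n%:R < `|p.1| -> g p = 0.

Lemma L2_bounded_integrable (f : RR -> R) (n : nat) : L2 mu f ->
  (forall x, n%:R < `|x| -> f x = 0) -> mu.-integrable setT (EFin \o f).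
Proof.
move=> Lf f0; have Li : L2 mu (indic_cc (- n%:R) n%:R).
  by apply: L2_indic; [exact: measurable_itv|exact: itv_measure_fin].
apply: eq_integrable (L2_mul_integrable Lf Li) => //.
move=> x _ /=; rewrite indic_ccE -ler_norml; have [_|h] := leP `|x| n%:R; first by rewrite mulr1.
by rewrite mulr0 f0.
Qed.

Lemma ae_integrable_section g : L2 mu2 g -> xbounded g ->
  {ae mu, forall y, mu.-integrable setT (EFin \o (fun x : RR => g (x, y)))}.
Proof.
move=> Lg [n gn]; apply: filterS (ae_L2_section Lg) => y Ly.
by apply: (L2_bounded_integrable Ly) => x; apply: (gn (x, y)).
Qed.

Definition xhart g (p : RR * RR) : R := hart (fun x => g (x, p.2)) p.1.

Lemma measurable_xhart g : measurable_fun setT g -> measurable_fun setT (xhart g).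
Proof.
move=> mg; have mc := @measurable_cas R.
apply: (@measurable_Rintegral_fst _ _ RR (RR * RR)%type R mu
  (fun q : RR * (RR * RR) => g (q.1, q.2.2) * cas (q.1 * q.2.1))).
by meas.
Qed.

Lemma xhart_contraction g : L2 mu2 g -> xbounded g ->
  (sqint mu2 (xhart g) <= sqint mu2 g)%E.
Proof.
move=> Lg gb; have [mg _] := Lg; have mh := measurable_xhart mg.
rewrite !sqint_sections//; apply: ae_ge0_le_integral => //.
- by move=> y _; exact: sqint_ge0.
- exact: measurable_sqint_section.
- by move=> y _; exact: sqint_ge0.
- exact: measurable_sqint_section.
- by apply: filterS (ae_integrable_section Lg gb) => y iy _; exact: (hart_contraction iy).
Qed.

Lemma L2_xhart g : L2 mu2 g -> xbounded g -> L2 mu2 (xhart g).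
Proof.
move=> Lg gb; apply: L2_le_sqint (Lg) (xhart_contraction Lg gb).
by apply: measurable_xhart; exact: L2_meas Lg.
Qed.

Lemma sqn_xhart_le g : L2 mu2 g -> xbounded g -> sqn mu2 (xhart g) <= sqn mu2 g.
Proof.
move=> Lg gb; rewrite -lee_fin -!sqintE//; first exact: xhart_contraction.
exact: L2_xhart.
Qed.

Lemma hartD (f h : RR -> R) xi : mu.-integrable setT (EFin \o f) ->
  mu.-integrable setT (EFin \o h) ->
  hart (fun x => f x + h x) xi = hart f xi + hart h xi.
Proof.
move=> i_f ih; have mc := @measurable_cas R.
have mc2 : measurable_fun setT (fun x : RR => cas (x * xi) : R) by meas.
rewrite /hart -RintegralD//.
- by apply: eq_Rintegral => x _; rewrite mulrDl.
- exact: (integrable_mul_bounded i_f mc2 (fun x => cas_bound _)).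
- exact: (integrable_mul_bounded ih mc2 (fun x => cas_bound _)).
Qed.

Lemma hartZ k (f : RR -> R) xi : mu.-integrable setT (EFin \o f) ->
  hart (fun x => k * f x) xi = k * hart f xi.
Proof.
move=> i_f; have mc := @measurable_cas R.
have mc2 : measurable_fun setT (fun x : RR => cas (x * xi) : R) by meas.
rewrite /hart -RintegralZl//.
- by apply: eq_Rintegral => x _; rewrite mulrA.
- exact: (integrable_mul_bounded i_f mc2 (fun x => cas_bound _)).
Qed.

Lemma xboundedD g h : xbounded g -> xbounded h -> xbounded (fun p => g p + h p).
Proof.
move=> [n gn] [m hm]; exists (maxn n m) => p pnm.
by rewrite gn ?hm ?addr0//; apply: le_lt_trans pnm; rewrite ler_nat ?leq_maxl ?leq_maxr.
Qed.

Lemma xboundedZ k g : xbounded g -> xbounded (fun p => k * g p).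
Proof. by move=> [n gn]; exists n => p pn; rewrite gn// mulr0. Qed.

(** Linearity holds on the sections that are integrable, that is on almost all
    of them. *)
Lemma xhartDZ k g h : L2 mu2 g -> xbounded g -> L2 mu2 h -> xbounded h ->
  let D p := xhart (fun p => g p + k * h p) p - (xhart g p + k * xhart h p) in
  L2 mu2 D /\ sqn mu2 D = 0.
Proof.
move=> Lg gb Lh hb D; have [mg _] := Lg; have [mh _] := Lh.
have m1 := measurable_xhart mg; have m2 := measurable_xhart mh.
have mgh : measurable_fun setT (fun p => g p + k * h p) by meas.
have m3 := measurable_xhart mgh.
apply: sqint_ae_section0; first by rewrite /D; meas.
apply: filterS2 (ae_integrable_section Lg gb) (ae_integrable_section Lh hb) => y ig ih xi.
rewrite /D /xhart/= hartD//; last exact: integrable_scalel.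
by rewrite hartZ// subrr.
Qed.

(** Fubini on almost every section, the kernel being symmetric. *)
Lemma xhart_sym g h : L2 mu2 g -> xbounded g -> L2 mu2 h -> xbounded h ->
  ip mu2 (xhart g) h = ip mu2 g (xhart h).
Proof.
move=> Lg gb Lh hb; have [mg _] := Lg; have [mh _] := Lh.
have L1 := L2_xhart Lg gb; have L2' := L2_xhart Lh hb.
have i1 := L2_mul_integrable L1 Lh; have i2 := L2_mul_integrable Lg L2'.
have mc := @measurable_casM R.
rewrite /ip /Rintegral; congr fine.
rewrite -(@integral21_prod_meas1 _ _ RR RR R mu mu _ i1) -(@integral21_prod_meas1 _ _ RR RR R mu mu _ i2).
apply: ae_eq_integral => //.
- exact: (@measurable_fubini_G _ _ RR RR R mu mu _ i1).
- exact: (@measurable_fubini_G _ _ RR RR R mu mu _ i2).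
apply: filterS2 (ae_integrable_section Lg gb) (ae_integrable_section Lh hb) => y ig ih _.
rewrite /fubini_G/=.
have mg1 : measurable_fun setT (fun x : RR => g (x, y)) by meas.
have mh1 : measurable_fun setT (fun x : RR => h (x, y)) by meas.
have mhg := measurable_hart mg1; have mhh := measurable_hart mh1.
have j1 := integrable_mul_bounded ih mhg (fun x => hart_bounded x ig).
have j2 := integrable_mul_bounded ig mhh (fun x => hart_bounded x ih).
have := @Rintegral_fubini_bilinear R (fun x => h (x, y)) (fun x => g (x, y)) (fun p => cas (p.2 * p.1)) 2 ih ig.
move=> /(_ _ (fun p => cas_bound _)); have mc' : measurable_fun setT (fun p : RR * RR => cas (p.2 * p.1) : R).
  by have mc1 := @measurable_cas R; meas.
move=> /(_ mc')/= E.
transitivity (\int[mu]_x (h (x, y) * hart (fun x => g (x, y)) x))%:E.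
  rewrite /Rintegral fineK; last exact: integrable_fin_num.
  by apply: eq_integral => x _; rewrite mulrC.
rewrite /hart E /Rintegral fineK.
  apply: eq_integral => x _; congr (_ * _)%:E; apply: eq_Rintegral => t _.
  by rewrite mulrC [in RHS]mulrC (mulrC t).
rewrite (_ : (fun x => _) = (fun x => (g (x, y) * hart (fun x => h (x, y)) x)%:E)).
  exact: integrable_fin_num.
apply/funext => x; congr (_ * _)%:E; apply: eq_Rintegral => t _.
by rewrite (mulrC x).
Qed.

End plane.

(** * Rectangles are total in L^2 of the plane *)

(** The measurable sets on which the integral of [w] vanishes form a Dynkin
    system. *)
Lemma dynkin_integral0 {d} {T : measurableType d} {R : realType}
    (mu : {measure set T -> \bar R}) (G : set (set T)) (w : T -> \bar R) :
  (@measurable d T) = <<s G >> -> setI_closed G -> mu.-integrable setT w ->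
  (\int[mu]_x w x = 0)%E -> (forall X, G X -> \int[mu]_(x in X) w x = 0)%E ->
  forall E, measurable E -> (\int[mu]_(x in E) w x = 0)%E.
Proof.
move=> mG GI iw w0 Gw E mE.
apply: (@dynkin_induction _ T G (fun E => \int[mu]_(x in E) w x = 0)%E mG GI) => //.
- move=> S mS S0; have mSC : measurable (~` S) by exact: measurableC.
  have mw := measurable_int _ iw.
  move: w0; rewrite -(setUv S) integral_setU//.
  + by rewrite S0 add0e.
  + by rewrite setUv.
  + exact/disj_setPCl.
- move=> F mF tF F0; rewrite integral_bigcup//.
    by rewrite eseries0.
  by apply: integrableS iw => //; exact: bigcup_measurable.
- by rewrite -mG.
Qed.

Section rectangles.
Context {R : realType}.
Notation mu := (@lebesgue_measure R).
Notation mu2 := (leb2 R).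
Local Notation RR := (measurableTypeR R).

Definition rect (a b : R) (J : set RR) (p : RR * RR) : R :=
  indic_cc a b p.1 * \1_J p.2.

Lemma measurable_rect a b (J : set RR) : measurable J -> measurable_fun setT (rect a b J).
Proof.
move=> mJ; have mi := @measurable_indic_cc R a b.
have mj : measurable_fun setT (\1_J : RR -> R) by exact: measurable_indic.
by rewrite /rect; meas.
Qed.

Lemma rect_sqr a b J p : rect a b J p ^+ 2 = rect a b J p.
Proof.
rewrite /rect indic_ccE indicE; case: (_ <= _ <= _); case: (_ \in _);
by rewrite ?mulr1 ?mulr0 ?mul0r ?expr1n ?expr0n.
Qed.

Lemma sqint_rect a b (J : set RR) : a <= b -> measurable J ->
  sqint mu2 (rect a b J) = ((b - a)%:E * mu J)%E.
Proof.
move=> ab mJ; rewrite sqint_sections; last exact: measurable_rect.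
have mi := @measurable_indic_cc R a b.
have mj : measurable_fun setT (\1_J : RR -> R) by exact: measurable_indic.
transitivity (\int[mu]_y ((b - a)%:E * (\1_J y)%:E))%E.
  apply: eq_integral => y _; rewrite /sqint.
  under eq_integral do rewrite rect_sqr /rect/= EFinM.
  rewrite ge0_integralZr//; last 2 first.
  - by meas.
  - by move=> x _; rewrite indic_ccE lee_fin.
  by rewrite integral_indic_cc.
rewrite ge0_integralZl//; last 2 first.
- by meas.
- by rewrite lee_fin subr_ge0.
by rewrite integral_indic// setIT.
Qed.

Lemma rect0 a b J : b < a -> rect a b J = fun=> 0.
Proof.
move=> ba; apply/funext => p; rewrite /rect indic_ccE (_ : (a <= p.1 <= b) = false) ?mul0r//.
by apply/negbTE/negP => /andP[h1 h2]; have := le_lt_trans (le_trans h1 h2) ba; rewrite ltxx.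
Qed.

Lemma L2_rect a b (J : set RR) : measurable J -> (mu J < +oo)%E -> L2 mu2 (rect a b J).
Proof.
move=> mJ Joo; split; first exact: measurable_rect.
have [ab|ba] := leP a b.
  by rewrite sqint_rect// lte_mul_pinfty// ?lee_fin ?subr_ge0.
rewrite rect0// /sqint; under eq_integral do rewrite expr0n.
by rewrite integral0 ltry.
Qed.

Lemma xbounded_rect a b J : xbounded (rect a b J).
Proof.
have [n hn] : exists n : nat, `|a| + `|b| <= n%:R.
  by exists (Num.truncn (`|a| + `|b|)).+1; rewrite ltW// truncnS_gt.
exists n => p pn; rewrite /rect indic_ccE (_ : (a <= p.1 <= b) = false) ?mul0r//.
apply/negbTE/negP => /andP[h1 h2]; have h3 := le_lt_trans hn pn.
move: h3; apply/negP; rewrite -leNgt.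
have := ler_norm b; have := ler_norm (- a); rewrite normrN => h4 h5.
have h6 := normr_ge0 a; have h7 := normr_ge0 b.
by rewrite ler_norml; apply/andP; split; lra.
Qed.

Definition box (n : nat) (p : RR * RR) : R := rect (- n%:R) n%:R `[- n%:R, n%:R] p.

Lemma L2_box n : L2 mu2 (box n).
Proof. by apply: L2_rect; [exact: measurable_itv|exact: itv_measure_fin]. Qed.

(** Inside a box, the integral of [v] vanishes over A x B for A an interval, then
    for all measurable A and B, then over all measurable sets of the plane: two
    applications of [dynkin_integral0], on the line and on the plane. *)
Lemma rect_total (v : RR * RR -> R) : L2 mu2 v ->
  (forall a b (J : set RR) (n : nat), measurable J -> (forall y : R, J y -> `|y| <= n%:R) -> ip mu2 v (rect a b J) = 0) ->
  sqn mu2 v = 0.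
Proof.
move=> Lv H; have [mv _] := Lv.
have iw n : mu2.-integrable setT (fun p => (v p * box n p)%:E).
  by apply: L2_mul_integrable => //; exact: L2_box.
have mI (n : nat) : measurable (`[- n%:R, n%:R] : set RR) by exact: measurable_itv.
pose g n (A B : set RR) (p : RR * RR) : R := v p * box n p * (\1_A p.1 * \1_B p.2).
have ig n A B : measurable A -> measurable B -> mu2.-integrable setT (fun p => (g n A B p)%:E).
  move=> mA mB; have mjA : measurable_fun setT (\1_A : RR -> R) by exact: measurable_indic.
  have mjB : measurable_fun setT (\1_B : RR -> R) by exact: measurable_indic.
  apply: (integrable_mul_bounded (M := 1) (iw n)); first by meas.
  by move=> p; rewrite !indicE; do 2 case: (_ \in _); rewrite ?mulr1 ?mulr0 ?normr0 ?normr1.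
have gF n A B : measurable A -> measurable B ->
    (\int[mu]_(x in A) fubini_F mu (fun p => (g n setT B p)%:E) x = \int[mu2]_p (g n A B p)%:E)%E.
  move=> mA mB; rewrite -(@integral12_prod_meas1 _ _ RR RR R mu mu _ (ig n A B mA mB)).
  rewrite integral_mkcond; apply: eq_integral => x _; rewrite patchE /fubini_F.
  case: ifPn => xA.
    by apply: eq_integral => y _; rewrite /g/= indicT !indicE xA.
  symmetry; apply: integral0_eq => y _; rewrite /g/= indicE (negbTE xA).
  by rewrite mul0r mulr0.
(* a rectangle cut by the box is again a rectangle *)
have g_itv n a b B : measurable B ->
    (\int[mu2]_p (g n `[a, b]%classic B p)%:E = 0)%E.
  move=> mB; have hB (y : R) : (B `&` `[- n%:R, n%:R]) y -> `|y| <= n%:R.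
    by move=> [_]; rewrite /= in_itv/= ler_norml.
  have := H (Num.max a (- n%:R)) (Num.min b n%:R) (B `&` `[- n%:R, n%:R]) n (measurableI _ _ mB (mI n)) hB.
  rewrite /ip /Rintegral => h.
  rewrite -[LHS]fineK; last by apply: integrable_fin_num => //; apply: ig => //; exact: measurable_itv.
  congr (_%:E); rewrite -h; congr fine; apply: eq_integral => p _; congr (_%:E).
  rewrite /g /box /rect -mulrA; congr (_ * _).
  rewrite !indicE !indic_ccE in_setI !mem_setE !in_itv/= ge_max le_min.
  case: (- n%:R <= p.1); case: (p.1 <= n%:R); case: (a <= p.1); case: (p.1 <= b);
  case: (- n%:R <= p.2 <= n%:R); case: (p.2 \in B); by rewrite /= ?mulr1 ?mul1r ?mulr0 ?mul0r.
have key n (A B : set RR) : measurable A -> measurable B ->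
    (\int[mu2]_(p in A `*` B) (v p * box n p)%:E = 0)%E.
  move=> mA mB; transitivity (\int[mu2]_p (g n A B p)%:E)%E.
    rewrite integral_mkcond; apply: eq_integral => p _; rewrite patchE /g !indicE in_setX.
    by case: (p.1 \in A); case: (p.2 \in B); rewrite /= ?mulr1 ?mulr0.
  rewrite -gF//.
  have iF := @integrable_fubini_F _ _ RR RR R mu mu _ (ig n setT B measurableT mB).
  apply: (@dynkin_integral0 _ RR R mu (R.-ocitv.-measurable) _ erefl) => //.
  - by move=> S1 S2 m1 m2; exact: measurableI.
  - rewrite gF// -[RHS](g_itv n (- n%:R) n%:R B mB); apply: eq_integral => p _; congr (_%:E).
    rewrite /g /box /rect indicT !indicE !indic_ccE !mem_setE !in_itv/=.
    by case: (_ <= p.1 <= _); rewrite ?mul0r ?mulr0 ?mul0r ?mul1r.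
  - move=> _ [[a b] _ <-] /=.
    rewrite integral_itv_obnd_cbnd; last exact: measurable_funTS (measurable_int _ iF).
    by rewrite gF ?g_itv.
have all0 n : ae_eq mu2 setT (fun p => (v p * box n p)%:E) (cst 0%E).
  apply: integral_ae_eq => //; move=> E _ mE; rewrite integral0.
  apply: (@dynkin_integral0 _ _ R mu2 [set A `*` B | A in measurable & B in measurable] _ _ _ _ _ _ E mE).
  - exact: measurable_prod_measurableType.
  - move=> _ _ [A mA [B mB <-]] [A' mA' [B' mB' <-]]; rewrite -setXI.
    by exists (A `&` A'); [exact: measurableI|exists (B `&` B'); [exact: measurableI|]].
  - exact: iw.
  - by rewrite -setXTT; exact: key.
  - by move=> _ [A mA [B mB <-]]; exact: key.
have /ae_foralln v0 := all0.
apply: (ae_sqn0 mv _).2; apply: filterS v0 => p v0.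
pose n := (Num.truncn (`|p.1| + `|p.2|)).+1.
have hn : `|p.1| + `|p.2| <= n%:R by rewrite ltW// truncnS_gt.
have := v0 n Logic.I => /=; rewrite /box /rect indic_ccE indicE mem_setE in_itv/= -!ler_norml.
rewrite (_ : `|p.1| <= n%:R); last by rewrite (le_trans _ hn)// lerDl.
rewrite (_ : `|p.2| <= n%:R); last by rewrite (le_trans _ hn)// lerDr.
by rewrite !mulr1 => -[].
Qed.

End rectangles.

(** * The Hartley transform on L^2 of the plane *)

Section almost_everywhere_congruence.
Context {d : measure_display} {T : measurableType d} {R : realType}.
Context (mu : {measure set T -> \bar R}).
Implicit Types f g h : T -> R.

Lemma ip_congrl f f' h : L2 mu f -> L2 mu f' -> L2 mu h ->
  sqn mu (fun x => f x - f' x) = 0 -> ip mu f h = ip mu f' h.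
Proof.
move=> Lf Lf' Lh D0; apply/eqP; rewrite -subr_eq0 -ipBl//.
by rewrite sqn0_ip0//; exact: L2B.
Qed.

Lemma sqn_congr f f' : L2 mu f -> L2 mu f' ->
  sqn mu (fun x => f x - f' x) = 0 -> sqn mu f = sqn mu f'.
Proof.
by move=> Lf Lf' D0; rewrite /sqn (ip_congrl Lf Lf' Lf D0) ipC (ip_congrl Lf Lf' Lf' D0).
Qed.

Lemma sqn_sub_trans f g h : L2 mu f -> L2 mu g -> L2 mu h ->
  sqn mu (fun x => f x - g x) = 0 -> sqn mu (fun x => g x - h x) = 0 ->
  sqn mu (fun x => f x - h x) = 0.
Proof.
move=> Lf Lg Lh D1 D2; apply/eqP; rewrite eq_le sqn_ge0 andbT.
by rewrite (le_trans (sqn_tri Lf Lg Lh))// D1 D2 mulr0 addr0.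
Qed.

Lemma sqn_sub_sub f f' g g' : L2 mu f -> L2 mu f' -> L2 mu g -> L2 mu g' ->
  sqn mu (fun x => f x - f' x) = 0 -> sqn mu (fun x => g x - g' x) = 0 ->
  sqn mu (fun x => (f x - g x) - (f' x - g' x)) = 0.
Proof.
move=> Lf Lf' Lg Lg' D1 D2; apply/eqP; rewrite eq_le sqn_ge0 andbT.
rewrite (_ : (fun x => _) = (fun x => (f x - f' x) + (g' x - g x))); last first.
  by apply/funext => x; ring.
by rewrite (le_trans (sqn_addle (L2B Lf Lf') (L2B Lg' Lg)))// D1 sqn_subC D2 mulr0 addr0.
Qed.

Lemma sqn_subxx f : sqn mu (fun x => f x - f x) = 0.
Proof.
rewrite /sqn /ip (_ : (fun x => _) = fun=> 0) ?/Rintegral ?integral0//.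
by apply/funext => x; rewrite subrr mulr0.
Qed.

End almost_everywhere_congruence.

Section hartley.
Context {R : realType}.
Notation mu := (@lebesgue_measure R).
Notation mu2 := (leb2 R).
Local Notation RR := (measurableTypeR R).
Implicit Types g h G H : RR * RR -> R.

Definition xcut (n : nat) g (p : RR * RR) : R := if `|p.1| <= n%:R then g p else 0.

(** A relation rather than an operator, since the L^2 limit of the transforms of
    the truncations is only determined up to null sets. *)
Definition hartley g G : Prop :=
  [/\ L2 mu2 g, L2 mu2 G & cvgl2 mu2 (fun n => xhart (xcut n g)) G].

Lemma measurable_xcut n g : measurable_fun setT g -> measurable_fun setT (xcut n g).
Proof. by move=> mg; apply: measurable_fun_ifT; meas. Qed.

Lemma xcut_le n g p : `|xcut n g p| <= `|g p|.
Proof. by rewrite /xcut; case: ifP => // _; rewrite normr0. Qed.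

Lemma L2_xcut n g : L2 mu2 g -> L2 mu2 (xcut n g).
Proof.
by move=> Lg; apply: L2_le (Lg) (xcut_le n g); apply: measurable_xcut; exact: L2_meas Lg.
Qed.

Lemma xbounded_xcut n g : xbounded (xcut n g).
Proof. by exists n => p pn; rewrite /xcut leNgt pn. Qed.

Lemma cvgl2_xcut g : L2 mu2 g -> cvgl2 mu2 (fun n => xcut n g) g.
Proof.
move=> Lg; apply: cvgl2_dominated => //.
- by move=> n; apply: measurable_xcut; exact: L2_meas Lg.
- by move=> n p; exact: xcut_le.
- move=> p; apply: cvg_near_cst.
  exists (Num.truncn `|p.1|).+1 => // n /= pn; rewrite /xcut ifT//.
  by rewrite (le_trans (ltW (truncnS_gt _)))// ler_nat.
Qed.

Lemma sqn_xhartB_le g h : L2 mu2 g -> xbounded g -> L2 mu2 h -> xbounded h ->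
  sqn mu2 (fun p => xhart g p - xhart h p) <= sqn mu2 (fun p => g p - h p).
Proof.
move=> Lg gb Lh hb; have := @xhartDZ R (-1) g h Lg gb Lh hb.
rewrite (_ : (fun p => g p + -1 * h p) = (fun p => g p - h p)); last first.
  by apply/funext => p; rewrite mulN1r.
rewrite (_ : (fun p => _ - (_ + -1 * _)) = (fun p => xhart (fun p => g p - h p) p - (xhart g p - xhart h p))); last first.
  by apply/funext => p; rewrite mulN1r.
move=> [_ D0]; have Lgh := L2B Lg Lh.
have gh : xbounded (fun p => g p - h p).
  rewrite (_ : (fun p => _) = (fun p => g p + -1 * h p)); last by apply/funext => p; rewrite mulN1r.
  by apply: xboundedD => //; exact: xboundedZ.
rewrite -(sqn_congr (L2_xhart Lgh gh) (L2B (L2_xhart Lg gb) (L2_xhart Lh hb)) D0).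
exact: sqn_xhart_le.
Qed.

(** The transforms of the truncations form a Cauchy sequence, as the transform is
    a contraction. *)
Lemma ex_hartley g : L2 mu2 g -> exists G, hartley g G.
Proof.
move=> Lg; have Lc n := L2_xcut n Lg; have bc n := xbounded_xcut n g.
have [||G LG cG] := @L2_complete _ _ R mu2 (fun n => xhart (xcut n g)).
- by move=> n; exact: L2_xhart.
- move=> e e0; have /cvgr0Pnorm_le/(_ (e / 4)) := cvgl2_xcut Lg.
  move=> /(_ _)[|N _ hN]; first by rewrite divr_gt0.
  exists N => m n Nm Nn; rewrite (le_trans (sqn_xhartB_le (Lc m) (bc m) (Lc n) (bc n)))//.
  rewrite (le_trans (sqn_tri (Lc m) Lg (Lc n)))//.
  have := hN m Nm; have := hN n Nn => /=.
  by rewrite !ger0_norm ?sqn_ge0// (sqn_subC _ g (xcut n g)); lra.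
- by exists G.
Qed.

Lemma hartley_L2l g G : hartley g G -> L2 mu2 g. Proof. by case. Qed.
Lemma hartley_L2r g G : hartley g G -> L2 mu2 G. Proof. by case. Qed.

Lemma sqn_xcut_le n g : L2 mu2 g -> sqn mu2 (xcut n g) <= sqn mu2 g.
Proof.
move=> Lg; have Lc := L2_xcut n Lg; apply: le_Rintegral => //.
- exact: L2_mul_integrable.
- exact: L2_mul_integrable.
- by move=> p _; rewrite /xcut; case: ifP => // _; rewrite mulr0 -expr2 sqr_ge0.
Qed.

Lemma hartley_nn_le g G : hartley g G -> sqn mu2 G <= sqn mu2 g.
Proof.
move=> [Lg LG cG]; apply: (cvgl2_nn_le _ LG cG) => n.
  by apply: L2_xhart; [exact: L2_xcut|exact: xbounded_xcut].
apply: le_trans (sqn_xcut_le n Lg); apply: sqn_xhart_le; [exact: L2_xcut|exact: xbounded_xcut].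
Qed.

Lemma hartley_linear k g h G H : hartley g G -> hartley h H ->
  hartley (fun p => g p + k * h p) (fun p => G p + k * H p).
Proof.
move=> [Lg LG cG] [Lh LH cH].
have Lkh := L2Z k Lh; have LkH := L2Z k LH.
have Lx n f (Lf : L2 mu2 f) : L2 mu2 (xhart (xcut n f)).
  by apply: L2_xhart; [exact: L2_xcut|exact: xbounded_xcut].
split; [exact: L2D|exact: L2D|].
apply: (@cvgl2_near _ _ _ _ (fun n p => xhart (xcut n g) p + k * xhart (xcut n h) p)).
- move=> n; rewrite sqn_subC.
  have := @xhartDZ R k _ _ (L2_xcut n Lg) (xbounded_xcut n g) (L2_xcut n Lh) (xbounded_xcut n h).
  rewrite (_ : (fun p => xcut n g p + k * xcut n h p) = xcut n (fun p => g p + k * h p)).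
    by case.
  by apply/funext => p; rewrite /xcut; case: ifP; rewrite ?mulr0 ?addr0.
- by move=> n; apply: L2D; [exact: Lx|apply: L2Z; exact: Lx].
- by move=> n; apply: Lx; exact: L2D.
- exact: L2D.
apply: cvgl2D => //; try by move=> n; exact: Lx.
- by move=> n; apply: L2Z; exact: Lx.
- by apply: cvgl2Z => // n; exact: Lx.
Qed.

Lemma hartleyB g h G H : hartley g G -> hartley h H ->
  hartley (fun p => g p - h p) (fun p => G p - H p).
Proof.
move=> hg hh; have := hartley_linear (-1) hg hh.
by congr hartley; apply/funext => p; rewrite mulN1r.
Qed.

Lemma hartley_sym g h G H : hartley g G -> hartley h H -> ip mu2 G h = ip mu2 g H.
Proof.
move=> [Lg LG cG] [Lh LH cH].
have Lx n f (Lf : L2 mu2 f) : L2 mu2 (xhart (xcut n f)).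
  by apply: L2_xhart; [exact: L2_xcut|exact: xbounded_xcut].
have E m : ip mu2 G (xcut m h) = ip mu2 g (xhart (xcut m h)).
  have h1 := @cvgl2_ip _ _ R mu2 _ G (xcut m h) (fun n => Lx n g Lg) LG (L2_xcut m Lh) cG.
  have h2 := @cvgl2_ip _ _ R mu2 _ g (xhart (xcut m h)) (fun n => L2_xcut n Lg) Lg (Lx m h Lh) (cvgl2_xcut Lg).
  have E1 : (fun n => ip mu2 (xhart (xcut n g)) (xcut m h)) =
            (fun n => ip mu2 (xcut n g) (xhart (xcut m h))).
    apply/funext => n.
    by rewrite xhart_sym//; [exact: L2_xcut|exact: xbounded_xcut|exact: L2_xcut|exact: xbounded_xcut].
  by rewrite E1 in h1; rewrite -(cvg_lim _ h1)// -(cvg_lim _ h2).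
have h1 := @cvgl2_ip _ _ R mu2 _ h G (fun n => L2_xcut n Lh) Lh LG (cvgl2_xcut Lh).
have h2 := @cvgl2_ip _ _ R mu2 _ H g (fun n => Lx n h Lh) LH Lg cH.
have E2 : (fun n => ip mu2 (xcut n h) G) = (fun n => ip mu2 (xhart (xcut n h)) g).
  by apply/funext => n; rewrite ipC E ipC.
by rewrite E2 in h1; rewrite ipC [RHS]ipC -(cvg_lim _ h1)// -(cvg_lim _ h2).
Qed.

Lemma hartley_xbounded g : L2 mu2 g -> xbounded g -> hartley g (xhart g).
Proof.
move=> Lg gb; split => //; first exact: L2_xhart.
have [n gn] := gb; rewrite /cvgl2; apply: cvg_near_cst.
exists n => // m /= nm; rewrite (_ : xcut m g = g) ?sqn_subxx//.
apply/funext => p; rewrite /xcut; have [//|h] := leP `|p.1| m%:R.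
by rewrite gn// (le_lt_trans _ h)// ler_nat.
Qed.

Lemma hartley_uniq g G G' : hartley g G -> hartley g G' ->
  sqn mu2 (fun p => G p - G' p) = 0.
Proof.
move=> [Lg LG cG] [_ LG' cG']; apply: (cvgl2_unique _ LG LG' cG cG') => n.
by apply: L2_xhart; [exact: L2_xcut|exact: xbounded_xcut].
Qed.

Lemma hartley_congr g g' G G' : hartley g G -> L2 mu2 g' -> L2 mu2 G' ->
  sqn mu2 (fun p => g p - g' p) = 0 -> sqn mu2 (fun p => G p - G' p) = 0 ->
  hartley g' G'.
Proof.
move=> hg Lg' LG' D1 D2; have [G'' hg'] := ex_hartley Lg'.
have LG := hartley_L2r hg; have LG'' := hartley_L2r hg'.
have D3 : sqn mu2 (fun p => G p - G'' p) = 0.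
  by apply/eqP; rewrite eq_le sqn_ge0 andbT -D1; exact: hartley_nn_le (hartleyB hg hg').
have D4 : sqn mu2 (fun p => G' p - G'' p) = 0.
  by apply: (sqn_sub_trans LG' LG LG'') => //; rewrite sqn_subC.
have [_ _ cG''] := hg'; split => //.
have Lx n : L2 mu2 (xhart (xcut n g')).
  by apply: L2_xhart; [exact: L2_xcut|exact: xbounded_xcut].
apply: (@sqn_cvg0_le _ _ (fun n => 2 * sqn mu2 (fun p => xhart (xcut n g') p - G'' p))).
- by move=> n; exact: sqn_ge0.
- by move=> n; rewrite (le_trans (sqn_tri (Lx n) LG'' LG'))// (sqn_subC _ G'') D4 mulr0 addr0.
- by rewrite -[X in _ --> X](mulr0 2); apply: cvgM => //; exact: cvg_cst.
Qed.

(** The isometry on the line for indicators of intervals, section by section. *)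
Lemma sqn_xhart_rect a b (J : set RR) : a <= b -> measurable J -> (mu J < +oo)%E ->
  sqn mu2 (xhart (rect a b J)) = sqn mu2 (rect a b J).
Proof.
move=> ab mJ Joo; have Lr := L2_rect a b mJ Joo; have br := xbounded_rect a b J.
apply: EFin_inj; rewrite -!sqintE//; last exact: L2_xhart.
rewrite sqint_rect// sqint_sections; last by apply: measurable_xhart; exact: measurable_rect.
have mh := measurable_hart (@measurable_indic_cc R a b).
have mj : measurable_fun setT (\1_J : RR -> R) by exact: measurable_indic.
transitivity (\int[mu]_y ((b - a)%:E * (\1_J y)%:E))%E.
  apply: eq_integral => y _; rewrite /sqint /xhart/= -(hart_indic_cc ab).
  rewrite muleC -ge0_integralZl//; last 2 first.
  - by meas.
  - by move=> t _; rewrite lee_fin sqr_ge0.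
  apply: eq_integral => t _; rewrite -EFinM; congr (_%:E).
  rewrite (_ : (fun x => rect a b J (x, y)) = (fun x => \1_J y * indic_cc a b x)); last first.
    by apply/funext => x; rewrite /rect mulrC.
  rewrite hartZ; last exact: integrable_indic_cc.
  by rewrite exprMn indicE; case: (_ \in _); rewrite ?expr1n ?expr0n.
rewrite ge0_integralZl//; last 2 first.
- by meas.
- by rewrite lee_fin subr_ge0.
by rewrite integral_indic// setIT.
Qed.

(** For the indicator [chi] of a rectangle with transform X and double transform
    X2, symmetry and isometry give |X2 - chi|^2 <= 0. By symmetry again, the double
    transform of [g] minus [g] is orthogonal to every rectangle. *)
Theorem hartley_inv g G : hartley g G -> hartley G g.
Proof.
move=> hg; have Lg := hartley_L2l hg; have LG := hartley_L2r hg.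
have [G2 hG] := ex_hartley LG; have LG2 := hartley_L2r hG.
apply: (hartley_congr hG) => //; first exact: sqn_subxx.
apply: rect_total; first exact: L2B.
move=> a b J n mJ Jn.
have Joo := bounded_measure_fin mJ Jn.
have [ab|ba] := leP a b; last first.
  by rewrite rect0// /ip; under eq_Rintegral do rewrite mulr0; rewrite /Rintegral integral0.
have Lr := L2_rect a b mJ Joo; have br := xbounded_rect a b J.
have hr := hartley_xbounded Lr br; set chi := rect a b J in hr Lr br *.
have LX := hartley_L2r hr; have [X2 hX] := ex_hartley LX; have LX2 := hartley_L2r hX.
(* <X2, chi> = |X|^2 = |chi|^2, while |X2|^2 <= |X|^2 *)
have D : sqn mu2 (fun p => X2 p - chi p) = 0.
  apply/eqP; rewrite eq_le sqn_ge0 andbT sqnB//.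
  rewrite (hartley_sym hX hr).
  have := hartley_nn_le hX; rewrite -/(sqn mu2 (xhart chi)).
  by have := sqn_xhart_rect ab mJ Joo; rewrite -/chi; lra.
rewrite ipBl// (hartley_sym hG hr) (hartley_sym hg hX).
rewrite -ipBr// ipC sqn0_ip0//; exact: L2B.
Qed.

Lemma hartley_sqn g G : hartley g G -> sqn mu2 G = sqn mu2 g.
Proof.
move=> hg; apply/eqP; rewrite eq_le (hartley_nn_le hg).
exact: hartley_nn_le (hartley_inv hg).
Qed.

Lemma hartley_ip g h G H : hartley g G -> hartley h H -> ip mu2 G H = ip mu2 g h.
Proof. by move=> hg hh; rewrite (hartley_sym hg (hartley_inv hh)). Qed.

Lemma hartley_closed (g_ G_ : nat -> RR * RR -> R) g G :
  (forall n, hartley (g_ n) (G_ n)) -> L2 mu2 g -> L2 mu2 G ->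
  cvgl2 mu2 g_ g -> cvgl2 mu2 G_ G -> hartley g G.
Proof.
move=> hn Lg LG cg cG; have [G' hg] := ex_hartley Lg.
apply: (hartley_congr hg) => //; first exact: sqn_subxx.
have LGn n := hartley_L2r (hn n); have LG' := hartley_L2r hg.
apply: (cvgl2_unique LGn LG' LG) => //.
apply: (sqn_cvg0_le _ _ cg) => n; first exact: sqn_ge0.
exact: hartley_nn_le (hartleyB (hn n) hg).
Qed.

End hartley.

(** * Weighted substitutions *)

Section weighted_composition.
Context {R : realType}.
Notation mu := (@lebesgue_measure R).
Notation mu2 := (leb2 R).
Local Notation RR := (measurableTypeR R).
Implicit Types (g h : RR * RR -> R) (c : RR * RR -> R) (phi : RR * RR -> RR * RR).

Definition wcomp c phi g (p : RR * RR) : R := c p * g (phi p).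

(** The Jacobian inequality that makes g |-> c (g o phi) a contraction of L^2 of
    the plane. *)
Definition contr c phi : Prop :=
  [/\ measurable_fun setT c, measurable_fun setT phi &
    forall F : RR * RR -> \bar R, measurable_fun setT F -> (forall p, 0 <= F p)%E ->
      (\int[mu2]_p (F (phi p) * (c p ^+ 2)%:E) <= \int[mu2]_p F p)%E].

Lemma measurable_wcomp c phi g : contr c phi -> measurable_fun setT g ->
  measurable_fun setT (wcomp c phi g).
Proof. by move=> [mc mp _] mg; rewrite /wcomp; meas. Qed.

Lemma sqint_wcomp_le c phi g : contr c phi -> measurable_fun setT g ->
  (sqint mu2 (wcomp c phi g) <= sqint mu2 g)%E.
Proof.
move=> [mc mp H] mg; apply: le_trans (H (fun p => (g p ^+ 2)%:E) _ _).
- rewrite le_eqVlt; apply/orP; left; apply/eqP/eq_integral => p _.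
  by rewrite /wcomp exprMn mulrC EFinM.
- by meas.
- by move=> p; rewrite lee_fin sqr_ge0.
Qed.

Lemma L2_wcomp c phi g : contr c phi -> L2 mu2 g -> L2 mu2 (wcomp c phi g).
Proof.
move=> H Lg; have mg := L2_meas Lg; apply: L2_le_sqint (Lg) _; first exact: measurable_wcomp.
exact: sqint_wcomp_le.
Qed.

Lemma sqn_wcomp_le c phi g : contr c phi -> L2 mu2 g -> sqn mu2 (wcomp c phi g) <= sqn mu2 g.
Proof.
move=> H Lg; rewrite -lee_fin -!sqintE//; last exact: L2_wcomp.
exact: sqint_wcomp_le (L2_meas Lg).
Qed.

Lemma sqn_wcompB_le c phi g h : contr c phi -> L2 mu2 g -> L2 mu2 h ->
  sqn mu2 (fun p => wcomp c phi g p - wcomp c phi h p) <= sqn mu2 (fun p => g p - h p).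
Proof.
move=> H Lg Lh; rewrite -(_ : wcomp c phi (fun p => g p - h p) = (fun p => _)).
  by apply: sqn_wcomp_le => //; exact: L2B.
by apply/funext => p; rewrite /wcomp mulrBr.
Qed.

Lemma cvgl2_wcomp c phi (F : nat -> RR * RR -> R) g : contr c phi ->
  (forall n, L2 mu2 (F n)) -> L2 mu2 g ->
  cvgl2 mu2 F g -> cvgl2 mu2 (fun n => wcomp c phi (F n)) (wcomp c phi g).
Proof.
move=> H LF Lg; apply: sqn_cvg0_le => n; first exact: sqn_ge0.
exact: sqn_wcompB_le.
Qed.

Lemma wcomp_congr c phi g h : contr c phi -> L2 mu2 g -> L2 mu2 h ->
  sqn mu2 (fun p => g p - h p) = 0 ->
  sqn mu2 (fun p => wcomp c phi g p - wcomp c phi h p) = 0.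
Proof.
move=> H Lg Lh D0; apply/eqP; rewrite eq_le sqn_ge0 andbT -D0; exact: sqn_wcompB_le.
Qed.

Lemma contr_yfibre (c theta : RR -> R) :
  measurable_fun setT c -> measurable_fun setT (theta : RR -> RR) ->
  (forall F : RR -> \bar R, measurable_fun setT F -> (forall y, 0 <= F y)%E ->
     (\int[mu]_y (F (theta y) * (c y ^+ 2)%:E) <= \int[mu]_y F y)%E) ->
  contr (fun p => c p.2) (fun p => (p.1, theta p.2)).
Proof.
move=> mc mt H; split; [by meas|by meas|move=> F mF F0].
rewrite (@fubini_tonelli1 _ _ RR RR R mu mu F mF F0).
rewrite (@fubini_tonelli1 _ _ RR RR R mu mu
  (fun p => F (p.1, theta p.2) * (c p.2 ^+ 2)%:E)%E); last 2 first.
- by meas.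
- by move=> p; rewrite mule_ge0// lee_fin sqr_ge0.
apply: ge0_le_integral => //.
- by move=> x _; apply: integral_ge0 => y _; rewrite mule_ge0// lee_fin sqr_ge0.
- apply: (@measurable_fun_fubini_tonelli_F _ _ RR RR R mu
    (fun p => F (p.1, theta p.2) * (c p.2 ^+ 2)%:E)%E); first by meas.
  by move=> p; rewrite mule_ge0// lee_fin sqr_ge0.
- exact: (@measurable_fun_fubini_tonelli_F _ _ RR RR R mu F).
- by move=> x _; apply: (H (fun y => F (x, y))) => //; meas.
Qed.

Lemma contr_swap : contr (fun=> 1) (fun p => (p.2, p.1)).
Proof.
split; [by meas|by meas|move=> F mF F0].
under eq_integral do rewrite expr1n mule1.
rewrite (@fubini_tonelli1 _ _ RR RR R mu mu (fun p => F (p.2, p.1))); last 2 first.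
- by meas.
- by [].
by rewrite (@fubini_tonelli2 _ _ RR RR R mu mu F).
Qed.

Lemma contr_xfibre c (phi : RR * RR -> R) :
  measurable_fun setT c -> measurable_fun setT (phi : RR * RR -> RR) ->
  (forall (y : RR) (F : RR -> \bar R), measurable_fun setT F -> (forall x, 0 <= F x)%E ->
     (\int[mu]_x (F (phi (x, y)) * (c (x, y) ^+ 2)%:E) <= \int[mu]_x F x)%E) ->
  contr c (fun p => (phi p, p.2)).
Proof.
move=> mc mt H; split; [by meas|by meas|move=> F mF F0].
rewrite (@fubini_tonelli2 _ _ RR RR R mu mu F mF F0).
rewrite (@fubini_tonelli2 _ _ RR RR R mu mu
  (fun p => F (phi p, p.2) * (c p ^+ 2)%:E)%E); last 2 first.
- by meas.
- by move=> p; rewrite mule_ge0// lee_fin sqr_ge0.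
apply: ge0_le_integral => //.
- by move=> x _; apply: integral_ge0 => y _; rewrite mule_ge0// lee_fin sqr_ge0.
- apply: (@measurable_fun_fubini_tonelli_G _ _ RR RR R mu
    (fun p => F (phi p, p.2) * (c p ^+ 2)%:E)%E); first by meas.
  by move=> p; rewrite mule_ge0// lee_fin sqr_ge0.
- exact: (@measurable_fun_fubini_tonelli_G _ _ RR RR R mu F).
- by move=> y _; apply: (H y (fun x => F (x, y))) => //; meas.
Qed.

Lemma hartley_wcomp c phi c' phi' : contr c phi -> contr c' phi' ->
  (forall g, L2 mu2 g -> xbounded g -> xbounded (wcomp c phi g)) ->
  (forall g, measurable_fun setT g -> xhart (wcomp c phi g) = wcomp c' phi' (xhart g)) ->
  forall g G, hartley g G -> hartley (wcomp c phi g) (wcomp c' phi' G).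
Proof.
move=> H H' xb E g G [Lg LG cG].
have Lc n := L2_xcut n Lg; have bc n := xbounded_xcut n g.
have Lx n : L2 mu2 (xhart (xcut n g)) by exact: L2_xhart.
apply: (@hartley_closed _ (fun n => wcomp c phi (xcut n g))
                          (fun n => wcomp c' phi' (xhart (xcut n g)))).
- move=> n; rewrite -E; last exact: L2_meas (Lc n).
  by apply: hartley_xbounded; [exact: L2_wcomp|exact: xb].
- exact: L2_wcomp.
- exact: L2_wcomp.
- by apply: cvgl2_wcomp => //; exact: cvgl2_xcut.
- exact: cvgl2_wcomp.
Qed.

(** The nonnegative factor c(y) leaves the integral along each section,
    integrable or not. *)
Lemma hartley_yfibre (c theta : RR -> R) : (forall y, 0 <= c y) ->
  contr (fun p => c p.2) (fun p => (p.1, theta p.2)) ->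
  forall g G, hartley g G ->
  hartley (fun p => c p.2 * g (p.1, theta p.2)) (fun p => c p.2 * G (p.1, theta p.2)).
Proof.
move=> c0 H; apply: (hartley_wcomp H H) => g.
  by move=> _ [n gn]; exists n => p pn; rewrite /wcomp gn ?mulr0.
move=> mg; apply/funext => p; rewrite /xhart /hart /wcomp/=.
have mc := @measurable_cas R.
rewrite -ge0_RintegralZl//; last by meas.
by apply: eq_Rintegral => x _; rewrite mulrA.
Qed.

Lemma contr_xopp : contr (fun=> 1) (fun p => (- p.1, p.2)).
Proof.
apply: contr_xfibre; [by meas|by meas|move=> y F mF F0].
by under eq_integral do rewrite expr1n mule1; rewrite ge0_integral_opp.
Qed.

Lemma contr_yopp : contr (fun=> 1) (fun p => (p.1, - p.2)).
Proof.
apply: (@contr_yfibre (fun=> 1) -%R); [by meas|by meas|move=> F mF F0].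
by under eq_integral do rewrite expr1n mule1; rewrite ge0_integral_opp.
Qed.

Lemma hartley_xopp g G : hartley g G ->
  hartley (fun p => g (- p.1, p.2)) (fun p => G (- p.1, p.2)).
Proof.
move=> hg; have E f : wcomp (fun=> 1) (fun p => (- p.1, p.2)) f = (fun p => f (- p.1, p.2)).
  by apply/funext => p; rewrite /wcomp mul1r.
rewrite -!E; move: hg; apply: (hartley_wcomp contr_xopp contr_xopp) => {G}g.
  by move=> _ [n gn]; exists n => p pn; rewrite E gn//= normrN.
move=> mg; apply/funext => p; rewrite !E /xhart /hart/=.
have mc := @measurable_cas R.
rewrite -Rintegral_opp; last by meas.
by apply: eq_Rintegral => x _; rewrite opprK mulNr mulrN.
Qed.

Lemma contr_dilation (w : RR -> R) : measurable_fun setT w -> (forall y, 0 < w y) ->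
  contr (fun p => Num.sqrt (w p.2)) (fun p => (w p.2 * p.1, p.2)).
Proof.
move=> mw w0; apply: contr_xfibre; [by meas|by meas|move=> y F mF F0 /=].
have w1 := ltW (w0 y); rewrite sqr_sqrtr//= ge0_integralZr//; last by meas.
by rewrite ge0_integral_scale// muleAC -EFinM mulVf ?gt_eqF// mul1e.
Qed.

(** Dilation by w(y) in the first variable becomes dilation by m(y) = 1 / w(y).
    The truncations [gn] bound both |x| and |m(y) x|, so that their dilates also
    have bounded support. *)
Lemma hartley_dilation (w m : RR -> R) : measurable_fun setT w -> measurable_fun setT m ->
  (forall y, 0 < w y) -> (forall y, w y * m y = 1) ->
  forall g G, hartley g G ->
  hartley (fun p => Num.sqrt (w p.2) * g (w p.2 * p.1, p.2))
          (fun p => Num.sqrt (m p.2) * G (m p.2 * p.1, p.2)).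
Proof.
move=> mw mm w0 wm g G hg; have Lg := hartley_L2l hg; have mg := L2_meas Lg.
have m0 y : 0 < m y by rewrite -(pmulr_rgt0 (m y) (w0 y)) wm ltr01.
have cw := contr_dilation mw w0; have cm := contr_dilation mm m0.
pose gn n (p : RR * RR) := if (`|p.1| <= n%:R) && (`|m p.2 * p.1| <= n%:R) then g p else 0.
have mgn n : measurable_fun setT (gn n).
  by rewrite /gn; meas.
have gnle n p : `|gn n p| <= `|g p| by rewrite /gn; case: ifP => // _; rewrite normr0.
have Lgn n : L2 mu2 (gn n) by exact: L2_le (Lg) (gnle n).
have bgn n : xbounded (gn n) by exists n => p pn; rewrite /gn leNgt pn.
have cgn : cvgl2 mu2 gn g.
  apply: cvgl2_dominated => // p; apply: cvg_near_cst.
  exists (maxn (Num.truncn `|p.1|).+1 (Num.truncn `|m p.2 * p.1|).+1) => // n /= pn.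
  move: pn; rewrite geq_max => /andP[n1 n2]; rewrite /gn ifT//; apply/andP; split.
    by rewrite (le_trans (ltW (truncnS_gt _)))// ler_nat.
  by rewrite (le_trans (ltW (truncnS_gt _)))// ler_nat.
have cGn : cvgl2 mu2 (fun n => xhart (gn n)) G.
  apply: (sqn_cvg0_le _ _ cgn) => n; first exact: sqn_ge0.
  exact: hartley_nn_le (hartleyB (hartley_xbounded (Lgn n) (bgn n)) hg).
apply: (@hartley_closed _ (fun n => wcomp (fun p => Num.sqrt (w p.2)) (fun p => (w p.2 * p.1, p.2)) (gn n))
  (fun n => wcomp (fun p => Num.sqrt (m p.2)) (fun p => (m p.2 * p.1, p.2)) (xhart (gn n)))).
- move=> n; rewrite (_ : wcomp _ _ (xhart (gn n)) = xhart (wcomp (fun p => Num.sqrt (w p.2))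
    (fun p => (w p.2 * p.1, p.2)) (gn n))).
    apply: hartley_xbounded; first exact: L2_wcomp.
    exists n => p pn; rewrite /wcomp /gn/=.
    by rewrite mulrA (mulrC (m _)) wm mul1r (leNgt `|p.1|) pn andbF mulr0.
  apply/funext => p; rewrite /wcomp /xhart /hart/=.
  have mc := @measurable_cas R; have mgn' := mgn n.
  pose F x := gn n (x, p.2) * cas (x * (m p.2 * p.1)).
  have mF : measurable_fun setT F by rewrite /F; meas.
  transitivity (\int[mu]_x (Num.sqrt (w p.2) * F (w p.2 * x))); last first.
    apply: eq_Rintegral => x _; rewrite -[RHS]mulrA /F; congr (_ * (_ * cas _)).
    by rewrite mulrACA wm mul1r.
  rewrite ge0_RintegralZl//; last by meas.
  rewrite Rintegral_scale// mulrA; congr (_ * _).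
  have -> : (w p.2)^-1 = m p.2.
    by apply: (mulfI (lt0r_neq0 (w0 p.2))); rewrite wm divff ?gt_eqF.
  rewrite -{2}(sqr_sqrtr (ltW (m0 p.2))) expr2 mulrA -sqrtrM ?ltW//.
  by rewrite wm sqrtr1 mul1r.
- exact: (L2_wcomp cw).
- exact: (L2_wcomp cm (hartley_L2r hg)).
- exact: (cvgl2_wcomp cw).
- apply: (cvgl2_wcomp cm) => //; last exact: hartley_L2r hg.
  by move=> n; exact: L2_xhart.
Qed.

End weighted_composition.

(** * The complex Fourier transform from the even and odd parts of the Hartley transform *)

Section bounded_operators.
Context {R : realType}.
Notation mu := (@lebesgue_measure R).
Notation mu2 := (leb2 R).
Local Notation RR := (measurableTypeR R).
Local Notation fn := (RR * RR -> R).
Implicit Types (f g h : fn) (Phi Psi : fn -> fn).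

(** Stated on differences, the bound gives continuity without asking for
    additivity. *)
Definition bounded_op Phi : Prop := exists2 C : R, 0 <= C & forall f g,
  L2 mu2 f -> L2 mu2 g ->
  L2 mu2 (Phi f) /\ sqn mu2 (fun p => Phi f p - Phi g p) <= C * sqn mu2 (fun p => f p - g p).

Lemma bounded_L2 Phi f : bounded_op Phi -> L2 mu2 f -> L2 mu2 (Phi f).
Proof. by move=> [C _ H] Lf; have [] := H f f Lf Lf. Qed.

Lemma bounded_cvgl2 Phi (F : nat -> fn) f : bounded_op Phi ->
  (forall n, L2 mu2 (F n)) -> L2 mu2 f -> cvgl2 mu2 F f -> cvgl2 mu2 (fun n => Phi (F n)) (Phi f).
Proof.
move=> [C C0 H] LF Lf Ff.
apply: (@sqn_cvg0_le _ _ (fun n => C * sqn mu2 (fun p => F n p - f p))).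
- by move=> n; exact: sqn_ge0.
- by move=> n; have [] := H (F n) f (LF n) Lf.
- by rewrite -[X in _ --> X](mulr0 C); apply: cvgM => //; exact: cvg_cst.
Qed.

Lemma bounded_congr Phi f g : bounded_op Phi -> L2 mu2 f -> L2 mu2 g ->
  sqn mu2 (fun p => f p - g p) = 0 -> sqn mu2 (fun p => Phi f p - Phi g p) = 0.
Proof.
move=> [C C0 H] Lf Lg D0; have [_] := H f g Lf Lg.
by rewrite D0 mulr0 => h; apply/eqP; rewrite eq_le h sqn_ge0.
Qed.

Lemma bounded_wcomp c phi : contr c phi -> bounded_op (wcomp c phi).
Proof.
move=> H; exists 1 => // f g Lf Lg; split; first exact: L2_wcomp.
by rewrite mul1r; exact: sqn_wcompB_le.
Qed.

Lemma bounded_id : bounded_op id.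
Proof. by exists 1 => // f g Lf Lg; rewrite mul1r. Qed.

Lemma bounded_comp Phi Psi : bounded_op Phi -> bounded_op Psi ->
  bounded_op (fun f => Phi (Psi f)).
Proof.
move=> [C C0 H] [D D0 K]; exists (C * D); first exact: mulr_ge0.
move=> f g Lf Lg; have [Pf hP] := K f g Lf Lg; have [Pg _] := K g f Lg Lf.
have [h1 h2] := H _ _ Pf Pg; split=> //.
by rewrite (le_trans h2)// -mulrA ler_wpM2l.
Qed.

Lemma bounded_lin (k l : R) Phi Psi : bounded_op Phi -> bounded_op Psi ->
  bounded_op (fun f p => k * Phi f p + l * Psi f p).
Proof.
move=> [C C0 H] [D D0 K].
have k2 : 0 <= 2 * k ^+ 2 by apply: mulr_ge0 => //; exact: sqr_ge0.
have l2 : 0 <= 2 * l ^+ 2 by apply: mulr_ge0 => //; exact: sqr_ge0.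
exists (2 * k ^+ 2 * C + 2 * l ^+ 2 * D); first by apply: addr_ge0; exact: mulr_ge0.
move=> f g Lf Lg; have [Pf hP] := H f g Lf Lg; have [Qf hQ] := K f g Lf Lg.
have [Pg _] := H g f Lg Lf; have [Qg _] := K g f Lg Lf.
split; first by apply: L2D; exact: L2Z.
rewrite (_ : (fun p => _) = (fun p => k * (Phi f p - Phi g p) + l * (Psi f p - Psi g p))); last first.
  by apply/funext => p; ring.
rewrite (le_trans (sqn_addle (L2Z k (L2B Pf Pg)) (L2Z l (L2B Qf Qg))))//.
rewrite !sqnZ; [|exact: L2B|exact: L2B].
have h1 := ler_wpM2l k2 hP; have h2 := ler_wpM2l l2 hQ.
by apply: le_trans (le_trans (lerD h1 h2) _); rewrite le_eqVlt; apply/orP; left; apply/eqP; ring.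
Qed.

Definition hartley_op Phi : Prop :=
  bounded_op Phi /\ forall g G, hartley g G -> hartley (Phi g) (Phi G).

Lemma hartley_op_id : hartley_op id.
Proof. by split=> //; exact: bounded_id. Qed.

Lemma hartley0 : hartley (fun=> 0 : R) (fun=> 0).
Proof.
have [G h] := ex_hartley (L20 mu2); have := hartleyB h h.
by congr hartley; apply/funext => p; rewrite subrr.
Qed.

Lemma hartleyDZ (k l : R) f F g G : hartley f F -> hartley g G ->
  hartley (fun p => k * f p + l * g p) (fun p => k * F p + l * G p).
Proof.
move=> hf hg; have := hartley_linear l (hartley_linear k hartley0 hf) hg.
by congr hartley; apply/funext => p; rewrite add0r.
Qed.

Lemma hartley_op_lin (k l : R) Phi Psi : hartley_op Phi -> hartley_op Psi ->
  hartley_op (fun f p => k * Phi f p + l * Psi f p).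
Proof.
move=> [b1 h1] [b2 h2]; split; first exact: bounded_lin.
by move=> g G hg; apply: hartleyDZ; [exact: h1|exact: h2].
Qed.

Definition xev f (p : RR * RR) := 2^-1 * f p + 2^-1 * f (- p.1, p.2).
Definition xod f (p : RR * RR) := 2^-1 * f p + - 2^-1 * f (- p.1, p.2).
Definition yev f (p : RR * RR) := 2^-1 * f p + 2^-1 * f (p.1, - p.2).
Definition yod f (p : RR * RR) := 2^-1 * f p + - 2^-1 * f (p.1, - p.2).

Lemma bounded_xopp : bounded_op (fun f p => f (- p.1, p.2)).
Proof.
have := bounded_wcomp (@contr_xopp R); congr bounded_op.
by apply/funext => f; apply/funext => p; rewrite /wcomp mul1r.
Qed.

Lemma hartley_op_xopp : hartley_op (fun f p => f (- p.1, p.2)).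
Proof. by split; [exact: bounded_xopp|exact: hartley_xopp]. Qed.

Lemma hartley_op_yfibre (c theta : RR -> R) : (forall y, 0 <= c y) ->
  contr (fun p => c p.2) (fun p => (p.1, theta p.2)) ->
  hartley_op (fun f p => c p.2 * f (p.1, theta p.2)).
Proof. by move=> c0 H; split; [exact: bounded_wcomp H|exact: hartley_yfibre]. Qed.

Lemma hartley_op_yopp : hartley_op (fun f p => f (p.1, - p.2)).
Proof.
have := @hartley_op_yfibre (fun=> 1) -%R (fun=> ler01) (@contr_yopp R).
by congr hartley_op; apply/funext => f; apply/funext => p; rewrite mul1r.
Qed.

Lemma hartley_op_xev : hartley_op xev.
Proof. exact: hartley_op_lin hartley_op_id hartley_op_xopp. Qed.
Lemma hartley_op_xod : hartley_op xod.
Proof. exact: hartley_op_lin hartley_op_id hartley_op_xopp. Qed.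
Lemma hartley_op_yev : hartley_op yev.
Proof. exact: hartley_op_lin hartley_op_id hartley_op_yopp. Qed.
Lemma hartley_op_yod : hartley_op yod.
Proof. exact: hartley_op_lin hartley_op_id hartley_op_yopp. Qed.

Lemma ip_xopp f g : L2 mu2 f -> L2 mu2 g ->
  ip mu2 (fun p => f (- p.1, p.2)) (fun p => g (- p.1, p.2)) = ip mu2 f g.
Proof.
have L h : L2 mu2 h -> L2 mu2 (fun p => h (- p.1, p.2)) by exact: (bounded_L2 bounded_xopp).
have le h : L2 mu2 h -> sqn mu2 (fun p => h (- p.1, p.2)) <= sqn mu2 h.
  move=> Lh; have := sqn_wcomp_le (@contr_xopp R) Lh.
  by congr (sqn _ _ <= _); apply/funext => p; rewrite /wcomp mul1r.
have E h : L2 mu2 h -> sqn mu2 (fun p => h (- p.1, p.2)) = sqn mu2 h.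
  move=> Lh; apply/eqP; rewrite eq_le le//= (le_trans _ (le _ (L h Lh)))//.
  by rewrite (_ : (fun p => _) = h)//; apply/funext => -[x y]/=; rewrite opprK.
move=> Lf Lg; have := E _ (L2D Lf Lg); rewrite (sqnD Lf Lg) (sqnD (L _ Lf) (L _ Lg)) !E//.
lra.
Qed.

Lemma ip_xev_xod f g : L2 mu2 f -> L2 mu2 g -> ip mu2 (xev f) (xod g) = 0.
Proof.
move=> Lf Lg; have L h : L2 mu2 h -> L2 mu2 (fun p => h (- p.1, p.2)) by exact: (bounded_L2 bounded_xopp).
have Le := bounded_L2 hartley_op_xev.1 Lf; have Lo := bounded_L2 hartley_op_xod.1 Lg.
have := ip_xopp Le Lo.
rewrite (_ : (fun p => xev f (- p.1, p.2)) = xev f); last first.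
  by apply/funext => -[x y]; rewrite /xev/= opprK addrC.
rewrite (_ : (fun p => xod g (- p.1, p.2)) = (fun p => - xod g p)); last first.
  by apply/funext => -[x y]; rewrite /xod/= opprK; ring.
by rewrite ipNr//; lra.
Qed.

Lemma xevDod f p : xev f p + xod f p = f p.
Proof. by rewrite /xev /xod; lra. Qed.

Lemma ip_xev_xev_xod_xod f g : L2 mu2 f -> L2 mu2 g ->
  ip mu2 (xev f) (xev g) + ip mu2 (xod f) (xod g) = ip mu2 f g.
Proof.
move=> Lf Lg.
have Lef := bounded_L2 hartley_op_xev.1 Lf; have Lof := bounded_L2 hartley_op_xod.1 Lf.
have Leg := bounded_L2 hartley_op_xev.1 Lg; have Log := bounded_L2 hartley_op_xod.1 Lg.
transitivity (ip mu2 (fun p => xev f p + xod f p) (fun p => xev g p + xod g p)).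
  2: by congr ip; apply/funext => p; rewrite xevDod.
rewrite (ipDl Lef Lof (L2D Leg Log)) !(ipDr Leg Log)// ip_xev_xod// (ipC _ (xod f) (xev g)) ip_xev_xod//; lra.
Qed.

(** The Fourier transform in the first variable of [gr + i gi]: the even part in
    xi of the Hartley transform is the cosine transform, the odd part the sine
    transform. *)
Definition fourier1 (gr gi Gr Gi : fn) : Prop := [/\ L2 mu2 Gr, L2 mu2 Gi &
  exists a b, [/\ hartley gr a, hartley gi b,
    sqn mu2 (fun p => Gr p - (xev a p + xod b p)) = 0 &
    sqn mu2 (fun p => Gi p - (xev b p - xod a p)) = 0]].

(** The transforms of [kr] and [ki] have to be xev Fr - xod Fi and
    xev Fi + xod Fr; the involution gives [kr] and [ki]. *)
Lemma ex_fourier1_inv Fr Fi : L2 mu2 Fr -> L2 mu2 Fi ->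
  exists kr ki, [/\ L2 mu2 kr, L2 mu2 ki & fourier1 kr ki Fr Fi].
Proof.
move=> Lr Li; have [A /hartley_inv hA] := ex_hartley Lr; have [B /hartley_inv hB] := ex_hartley Li.
have hk : hartley (fun p => xev A p - xod B p) (fun p => xev Fr p - xod Fi p).
  by apply: hartleyB; [exact: hartley_op_xev.2|exact: hartley_op_xod.2].
have hl : hartley (fun p => xev B p + 1 * xod A p) (fun p => xev Fi p + 1 * xod Fr p).
  by apply: hartley_linear; [exact: hartley_op_xev.2|exact: hartley_op_xod.2].
exists (fun p => xev A p - xod B p), (fun p => xev B p + 1 * xod A p).
split; [exact: hartley_L2l hk|exact: hartley_L2l hl|].
split=> //; exists (fun p => xev Fr p - xod Fi p), (fun p => xev Fi p + 1 * xod Fr p).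
split=> //.
- rewrite -(sqn_subxx mu2 Fr); congr sqn; apply/funext => -[x y].
  by rewrite /xev /xod/= !opprK; lra.
- rewrite -(sqn_subxx mu2 Fi); congr sqn; apply/funext => -[x y].
  by rewrite /xev /xod/= !opprK; lra.
Qed.

(** Parseval's identity against a real function [w], whose Fourier transform is
    xev c - i xod c. *)
Lemma fourier1_parseval_real kr ki Fr Fi w c : fourier1 kr ki Fr Fi -> hartley w c ->
  ip mu2 Fr (xev c) - ip mu2 Fi (xod c) = ip mu2 kr w /\
  ip mu2 Fi (xev c) + ip mu2 Fr (xod c) = ip mu2 ki w.
Proof.
move=> [Lr Li [a [b [ha hb Er Ei]]]] hc.
have La := hartley_L2r ha; have Lb := hartley_L2r hb; have Lc := hartley_L2r hc.
have Le f : L2 mu2 f -> L2 mu2 (xev f) by exact: (bounded_L2 hartley_op_xev.1).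
have Lo f : L2 mu2 f -> L2 mu2 (xod f) by exact: (bounded_L2 hartley_op_xod.1).
have LR := L2D (Le _ La) (Lo _ Lb); have LI := L2B (Le _ Lb) (Lo _ La).
have Lec := Le _ Lc; have Loc := Lo _ Lc.
rewrite (ip_congrl Lr LR Lec Er) (ip_congrl Lr LR Loc Er).
rewrite (ip_congrl Li LI Lec Ei) (ip_congrl Li LI Loc Ei).
rewrite -(hartley_ip ha hc) -(hartley_ip hb hc) -(ip_xev_xev_xod_xod La Lc) -(ip_xev_xev_xod_xod Lb Lc).
have Lea := Le _ La; have Loa := Lo _ La; have Leb := Le _ Lb; have Lob := Lo _ Lb.
rewrite !(ipDl Lea Lob)// !(ipBl Leb Loa)//.
rewrite !(ipC _ (xod _) (xev _)) !ip_xev_xod//.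
by split; lra.
Qed.

End bounded_operators.

(** * Logarithmic charts *)

Section logarithmic_chart.
Context {d : measure_display} {T : measurableType d} {R : realType}.
Context (mu : {measure set T -> \bar R}) (D : set T) (w : T -> R) (e l : T -> T).

(** The maps [e] and [l] carry [mu] to the measure [w mu] on [D] and back. The two
    instances are the exponential from the line to R_+ and the exponential of the
    second variable from the plane to Aff. *)
Definition log_chart : Prop := [/\ measurable D, measurable_fun setT e,
  measurable_fun setT l & [/\ forall y, D (e y), cancel e l,
  forall x, D x -> e (l x) = x, measurable_fun setT (w \_ D) & [/\ forall x, D x -> 0 < w x &
  forall F : T -> \bar R, measurable_fun setT F -> (forall y, 0 <= F y)%E ->
    (\int[mu]_x (F (l x) * ((w \_ D) x)%:E) = \int[mu]_y F y)%E]]].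

Hypothesis chart : log_chart.

Lemma chart_weight_ge0 x : 0 <= (w \_ D) x.
Proof.
case: chart => _ _ _ [_ _ _ _ [w0 _]]; rewrite patchE; case: ifPn => //.
by rewrite inE => /w0/ltW.
Qed.

Lemma chart_measurable (g : T -> R) :
  measurable_fun setT (fun y => g (e y)) <-> measurable_fun D g.
Proof.
case: chart => mD me ml [De el le _ _]; split=> mg.
  apply: (@eq_measurable_fun _ _ _ _ _ (fun x => g (e (l x)))).
    by move=> x; rewrite inE => /le ->.
  have ml' := measurable_funS measurableT (subsetT D) ml.
  exact: (measurableT_comp mg ml').
apply: (@measurable_comp _ _ _ _ _ _ D g setT e) => //.
by move=> _ [y _ <-].
Qed.

Lemma chart_integral (G : T -> R) : measurable_fun setT (fun y => G (e y)) ->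
  (\int[mu]_(x in D) (w x * G x)%:E = \int[mu]_y (G (e y))%:E)%E.
Proof.
case: chart => mD me ml [De el le _ [w0 H]] mG.
rewrite -(integral_transport H chart_weight_ge0 mG) integral_mkcond.
apply: eq_integral => x _; rewrite !patchE; case: ifPn => [|_]; last by rewrite mulr0.
by rewrite inE => /le ->; rewrite mulrC.
Qed.

Lemma chart_Rintegral (G : T -> R) : measurable_fun setT (fun y => G (e y)) ->
  \int[mu]_(x in D) (w x * G x) = \int[mu]_y (G (e y)).
Proof. by move=> mG; rewrite /Rintegral chart_integral. Qed.

Lemma chart_integrable (G : T -> R) : mu.-integrable setT (fun y => (G (e y))%:E) ->
  mu.-integrable D (fun x => (w x * G x)%:E).
Proof.
case: (chart) => mD me ml [De el le mw [w0 H]] iG.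
have mG : measurable_fun setT (fun y => G (e y)).
  by apply/measurable_EFinP; exact: measurable_int iG.
move/integrableP : iG => [_ iG]; apply/integrableP; split.
  apply/measurable_EFinP.
  apply: measurable_funM; last exact/chart_measurable.
  by have := mw; rewrite -measurable_restrictT.
apply: le_lt_trans iG; rewrite le_eqVlt; apply/orP; left; apply/eqP.
have := @chart_integral (fun x => `|G x|); move=> <-; last by meas.
by apply: eq_integral => x; rewrite inE => /w0/ltW w0x; rewrite abse_EFin normrM (ger0_norm w0x).
Qed.

Lemma chart_ae (P : T -> Prop) : {ae mu, forall x, D x -> P x} -> {ae mu, forall y, P (e y)}.
Proof.
case: chart => mD me ml [De el le mw [w0 H]] [N [mN N0 sN]].
have mNe : measurable (e @^-1` N) by rewrite -[X in measurable X]setTI; exact: me.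
have mi : measurable_fun setT (\1_(e @^-1` N) : T -> R) by exact: measurable_indic.
exists (e @^-1` N); split => //; last by move=> y Py; apply: sN => /(_ (De y)).
rewrite -[e @^-1` N]setIT -integral_indic// -H//; last by meas.
rewrite (@ae_eq_integral _ _ _ mu setT (cst 0%E))//; last first.
  exists N; split=> //= x; apply: contra_notP => Nx _.
  rewrite patchE; case: ifPn => [|_]; last by rewrite mule0.
  rewrite inE indicE => /le ex; rewrite memNset ?mul0e//=.
  by rewrite /preimage/= ex.
  by meas.
by rewrite integral0.
Qed.

Lemma chart_ae_inv (P : T -> Prop) : {ae mu, forall y, P y} -> {ae mu, forall x, D x -> P (l x)}.
Proof.
case: chart => mD me ml [De el le mw [w0 H]] [N [mN N0 sN]].
have mNl : measurable (l @^-1` N) by rewrite -[X in measurable X]setTI; exact: ml.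
have mi : measurable_fun setT (\1_N : T -> R) by exact: measurable_indic.
have mF : measurable_fun setT (fun x => ((\1_N (l x) : R)%:E * ((w \_ D) x)%:E)%E).
  by meas.
have E : (\int[mu]_x `|(\1_N (l x) : R)%:E * ((w \_ D) x)%:E| = 0)%E.
  under eq_integral do rewrite gee0_abs ?mule_ge0 ?lee_fin ?chart_weight_ge0//.
  rewrite (H (fun x => (\1_N x)%:E))//; last by meas.
  by rewrite integral_indic// setIT.
have := (@ae_eq_integral_abs _ _ _ mu setT measurableT _ mF).1 E.
apply: filterS => x /(_ Logic.I)/= h Dx; apply: contrapT => Px.
move: h; rewrite patchE mem_set// indicE mem_set; last exact: sN.
by rewrite mul1e => -[wx]; have := w0 _ Dx; rewrite wx ltxx.
Qed.

Implicit Types f g : T -> R[i].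

Definition chart_re f (y : T) : R := complex.Re (f (e y)).
Definition chart_im f (y : T) : R := complex.Im (f (e y)).

Lemma normc_sqr (z : R[i]) : Normc.normc z ^+ 2 = complex.Re z ^+ 2 + complex.Im z ^+ 2.
Proof. by case: z => a b /=; rewrite sqr_sqrtr// addr_ge0// sqr_ge0. Qed.

Lemma chart_sqnorm f : measurable_fun setT (chart_re f) -> measurable_fun setT (chart_im f) ->
  sqnormL2 mu D w f = (sqint mu (chart_re f) + sqint mu (chart_im f))%E.
Proof.
move=> mr mi.
rewrite /sqnormL2 chart_integral; last first.
  rewrite (_ : (fun y => _) = (fun y => chart_re f y ^+ 2 + chart_im f y ^+ 2)); first by meas.
  by apply/funext => y; rewrite normc_sqr.
rewrite /sqint -ge0_integralD//; last 4 first.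
- by move=> y _; rewrite lee_fin sqr_ge0.
- by meas.
- by move=> y _; rewrite lee_fin sqr_ge0.
- by meas.
by apply: eq_integral => y _; rewrite normc_sqr.
Qed.

Lemma chart_inL2 f : inL2 mu D w f <-> L2 mu (chart_re f) /\ L2 mu (chart_im f).
Proof.
split=> [[[mr mi] h]|[[mr hr] [mi hi]]].
  move/chart_measurable : mr => mr; move/chart_measurable : mi => mi.
  move: h; rewrite chart_sqnorm// => h; split; split=> //; apply: le_lt_trans h.
    by rewrite leeDl// sqint_ge0.
  by rewrite leeDr// sqint_ge0.
split; first by split; apply/chart_measurable.
by rewrite chart_sqnorm// lte_add_pinfty.
Qed.

Lemma chart_inner f g : inL2 mu D w f -> inL2 mu D w g ->
  complex.Re (innerL2 mu D w f g) = ip mu (chart_re f) (chart_re g) + ip mu (chart_im f) (chart_im g) /\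
  complex.Im (innerL2 mu D w f g) = ip mu (chart_im f) (chart_re g) - ip mu (chart_re f) (chart_im g).
Proof.
move=> /chart_inL2[Lfr Lfi] /chart_inL2[Lgr Lgi].
have mfr := L2_meas Lfr; have mfi := L2_meas Lfi; have mgr := L2_meas Lgr; have mgi := L2_meas Lgi.
split=> /=.
- rewrite -RintegralD//; [|exact: L2_mul_integrable|exact: L2_mul_integrable].
  rewrite -(@chart_Rintegral (fun x => complex.Re (f x) * complex.Re (g x) + complex.Im (f x) * complex.Im (g x))); last by rewrite -/(chart_re _ _); meas.
  apply: eq_Rintegral => x _; case: (f x) => a b; case: (g x) => a' b' /=.
  by ring.
- rewrite -RintegralB//; [|exact: L2_mul_integrable|exact: L2_mul_integrable].
  rewrite -(@chart_Rintegral (fun x => complex.Im (f x) * complex.Re (g x) - complex.Re (f x) * complex.Im (g x))); last by rewrite -/(chart_re _ _); meas.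
  apply: eq_Rintegral => x _; case: (f x) => a b; case: (g x) => a' b' /=.
  by ring.
Qed.

Lemma chart_cvgL2 (F : nat -> T -> R[i]) f :
  (forall n, inL2 mu D w (F n)) -> inL2 mu D w f ->
  cvgL2 mu D w F f <-> cvgl2 mu (fun n => chart_re (F n)) (chart_re f) /\ cvgl2 mu (fun n => chart_im (F n)) (chart_im f).
Proof.
move=> LF Lf; move/chart_inL2 : (Lf) => [Lr Li].
have LFr n : L2 mu (chart_re (F n)) by have /chart_inL2[] := LF n.
have LFi n : L2 mu (chart_im (F n)) by have /chart_inL2[] := LF n.
have Er n : chart_re (fun x => F n x - f x) = (fun y => chart_re (F n) y - chart_re f y).
  by apply/funext => y; rewrite /chart_re; case: (F n _) => a b; case: (f _).
have Ei n : chart_im (fun x => F n x - f x) = (fun y => chart_im (F n) y - chart_im f y).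
  by apply/funext => y; rewrite /chart_im; case: (F n _) => a b; case: (f _).
have E : (fun n => sqnormL2 mu D w (fun x => F n x - f x)) =
    (fun n => (sqn mu (fun y => chart_re (F n) y - chart_re f y) + sqn mu (fun y => chart_im (F n) y - chart_im f y))%:E).
  apply/funext => n; have L1 := L2B (LFr n) Lr; have L2' := L2B (LFi n) Li.
  rewrite chart_sqnorm ?Er ?Ei; [|exact: L2_meas L1|exact: L2_meas L2'].
  by rewrite !sqintE.
rewrite /cvgL2 E; split=> [h|[h1 h2]].
  have h' : sqn mu (fun y => chart_re (F n) y - chart_re f y) + sqn mu (fun y => chart_im (F n) y - chart_im f y)
      @[n --> \oo] --> (0 : R) by exact: fine_cvg h.
  split.
    apply: (sqn_cvg0_le _ _ h') => n; first exact: sqn_ge0.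
    by rewrite lerDl sqn_ge0.
  apply: (sqn_cvg0_le _ _ h') => n; first exact: sqn_ge0.
  by rewrite lerDr sqn_ge0.
by apply: cvg_EFin; [exact: nearW|rewrite -[X in _ --> X](addr0 0); exact: cvgD].
Qed.

End logarithmic_chart.

(** * The partial Fourier transform on the affine group *)

Lemma sqn_sub_add {d} {T : measurableType d} {R : realType} (mu : {measure set T -> \bar R})
    (f f' g g' : T -> R) : L2 mu f -> L2 mu f' -> L2 mu g -> L2 mu g' ->
  sqn mu (fun x => f x - f' x) = 0 -> sqn mu (fun x => g x - g' x) = 0 ->
  sqn mu (fun x => (f x + g x) - (f' x + g' x)) = 0.
Proof.
move=> Lf Lf' Lg Lg' D1 D2; apply/eqP; rewrite eq_le sqn_ge0 andbT.
rewrite (_ : (fun x => _) = (fun x => (f x - f' x) + (g x - g' x))); last first.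
  by apply/funext => x; ring.
by rewrite (le_trans (sqn_addle (L2B Lf Lf') (L2B Lg Lg')))// D1 D2 mulr0 addr0.
Qed.

Lemma cvgl2_lim_congr {d} {T : measurableType d} {R : realType} (mu : {measure set T -> \bar R})
    (F : nat -> T -> R) (f f' : T -> R) : (forall n, L2 mu (F n)) -> L2 mu f -> L2 mu f' ->
  sqn mu (fun x => f' x - f x) = 0 -> cvgl2 mu F f -> cvgl2 mu F f'.
Proof.
move=> LF Lf Lf' D0 Ff; apply: (@sqn_cvg0_le _ _ (fun n => 2 * sqn mu (fun x => F n x - f x))).
- by move=> n; exact: sqn_ge0.
- by move=> n; rewrite (le_trans (sqn_tri (LF n) Lf Lf'))// (sqn_subC _ f) D0 mulr0 addr0.
- by rewrite -[X in _ --> X](mulr0 2); apply: cvgM => //; exact: cvg_cst.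
Qed.

Section affine_fourier.
Context {R : realType}.
Notation mu := (@lebesgue_measure R).
Notation mu2 := (leb2 R).
Local Notation RR := (measurableTypeR R).
Local Notation fn := (RR * RR -> R).

Definition aff_exp (p : RR * RR) : RR * RR := (p.1, expR p.2).
Definition aff_ln (p : RR * RR) : RR * RR := (p.1, ln p.2).

Lemma restrict_invpos : (fun r : RR => r^-1) \_ (@Rpos R) = @invpos R.
Proof.
apply/funext => r; rewrite patchE; case: ifPn; rewrite ?inE ?notin_setE /Rpos/=.
  by move=> r0; rewrite invposE.
by move=> /negP r0; rewrite /invpos ifF//; exact/negbTE.
Qed.

Lemma chart_pos : log_chart mu (@Rpos R) (fun r : RR => r^-1) (@expR R) (@ln R).
Proof.
have E : @Rpos R = `]0, +oo[%classic by apply/seteqP; split => r /=; rewrite in_itv/= andbT.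
split; [|by meas|by meas|split].
- by rewrite E; exact: measurable_itv.
- exact: expR_gt0.
- exact: expRK.
- by move=> r r0; rewrite lnK// posrE.
- by rewrite restrict_invpos; exact: measurable_invpos.
split; first by move=> r r0; rewrite invr_gt0.
by rewrite restrict_invpos; exact: ge0_integral_ln.
Qed.

Lemma chart_Aff : log_chart mu2 (@Aff R) (fun p => p.2^-1) aff_exp aff_ln.
Proof.
have mi := @measurable_invpos R.
have E : @Aff R = snd @^-1` (@Rpos R) by [].
have Ei : (fun p : RR * RR => p.2^-1) \_ (@Aff R) = (fun p => invpos p.2).
  apply/funext => p; rewrite -restrict_invpos !patchE.
  by rewrite /Aff /Rpos !mem_setE.
split; [|by rewrite /aff_exp; meas|by rewrite /aff_ln; meas|split].
- rewrite E -[X in measurable X]setTI; apply: measurable_snd => //.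
  by case: chart_pos.
- by move=> y; exact: expR_gt0.
- by move=> -[x y]; rewrite /aff_ln /aff_exp/= expRK.
- by move=> -[x y] y0; rewrite /aff_ln /aff_exp/= lnK// posrE.
- by rewrite Ei; meas.
split; first by move=> p p0; rewrite invr_gt0.
move=> F mF F0; rewrite Ei.
rewrite (@fubini_tonelli1 _ _ RR RR R mu mu (fun p => F (aff_ln p) * (invpos p.2)%:E)%E); last 2 first.
- by rewrite /aff_ln; meas.
- by move=> p; rewrite mule_ge0// lee_fin invpos_ge0.
rewrite (@fubini_tonelli1 _ _ RR RR R mu mu F)//.
apply: eq_integral => x _; rewrite /fubini_F/=.
by apply: (@ge0_integral_ln R (fun t => F (x, t))) => //; meas.
Qed.

Lemma hart_even (q : RR -> R) xi : mu.-integrable setT (EFin \o q) ->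
  2^-1 * hart q xi + 2^-1 * hart q (- xi) = \int[mu]_x (q x * cos (2 * pi * (x * xi))).
Proof.
move=> iq; have mc := @measurable_cas R.
have i1 xi' : mu.-integrable setT (EFin \o (fun x => q x * cas (x * xi'))).
  by apply: (integrable_mul_bounded (M := 2)) => //; [meas|move=> x; exact: cas_bound].
rewrite -mulrDr /hart -RintegralD//.
rewrite -RintegralZl//; last first.
  exact: (integrableD measurableT (i1 xi) (i1 (- xi))).
apply: eq_Rintegral => x _; rewrite /cas !mulrN cosN sinN; lra.
Qed.

Lemma hart_odd (q : RR -> R) xi : mu.-integrable setT (EFin \o q) ->
  2^-1 * hart q xi + - 2^-1 * hart q (- xi) = \int[mu]_x (q x * sin (2 * pi * (x * xi))).
Proof.
move=> iq; have mc := @measurable_cas R.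
have i1 xi' : mu.-integrable setT (EFin \o (fun x => q x * cas (x * xi'))).
  by apply: (integrable_mul_bounded (M := 2)) => //; [meas|move=> x; exact: cas_bound].
rewrite mulNr -mulrBr /hart -RintegralB//.
rewrite -RintegralZl//; last first.
  exact: (integrableB measurableT (i1 xi) (i1 (- xi))).
apply: eq_Rintegral => x _; rewrite /cas !mulrN cosN sinN; lra.
Qed.

Definition fourier_cut (g : R * R -> R[i]) (n : nat) (p : R * R) : R[i] :=
  cintegral (leb R) `[- n%:R, n%:R] (fun x => g (x, p.2) * expmi (x * p.1)).

Lemma integral_itv_xcut (F : RR -> R) (n : nat) :
  \int[mu]_(x in `[- n%:R, n%:R]) F x = \int[mu]_x (if `|x| <= n%:R then F x else 0).
Proof.
rewrite /Rintegral integral_mkcond; congr fine; apply: eq_integral => x _.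
by rewrite patchE mem_setE in_itv/= -ler_norml; case: ifP.
Qed.

Lemma fourier_cutE (g : R * R -> R[i]) n p :
  chart_re aff_exp (fourier_cut g n) p = \int[mu]_x
    (xcut n (chart_re aff_exp g) (x, p.2) * cos (2 * pi * (x * p.1)) +
     xcut n (chart_im aff_exp g) (x, p.2) * sin (2 * pi * (x * p.1))) /\
  chart_im aff_exp (fourier_cut g n) p = \int[mu]_x
    (xcut n (chart_im aff_exp g) (x, p.2) * cos (2 * pi * (x * p.1)) -
     xcut n (chart_re aff_exp g) (x, p.2) * sin (2 * pi * (x * p.1))).
Proof.
rewrite /chart_re /chart_im /fourier_cut /cintegral/= !integral_itv_xcut.
split; apply: eq_Rintegral => x _; rewrite /xcut /=; case: ifP => _;
  rewrite /aff_exp/= /expmi; rewrite ?mul0r ?addr0 ?subr0//;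
  case: (g (x, expR p.2)) => a b /=; ring.
Qed.

Lemma measurable_fourier_cut (g : R * R -> R[i]) n :
  measurable_fun setT (chart_re aff_exp g) -> measurable_fun setT (chart_im aff_exp g) ->
  measurable_fun setT (chart_re aff_exp (fourier_cut g n)) /\
  measurable_fun setT (chart_im aff_exp (fourier_cut g n)).
Proof.
move=> /(measurable_xcut n) mr /(measurable_xcut n) mi.
split.
- rewrite (_ : chart_re _ _ = (fun p : RR * RR => \int[mu]_x
    (xcut n (chart_re aff_exp g) (x, p.2) * cos (2 * pi * (x * p.1)) +
     xcut n (chart_im aff_exp g) (x, p.2) * sin (2 * pi * (x * p.1))))); last first.
    by apply/funext => p; have [] := fourier_cutE g n p.
  apply: (@measurable_Rintegral_snd _ _ _ RR R mu (fun q : (RR * RR) * RR =>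
    (xcut n (chart_re aff_exp g) (q.2, q.1.2) * cos (2 * pi * (q.2 * q.1.1)) +
     xcut n (chart_im aff_exp g) (q.2, q.1.2) * sin (2 * pi * (q.2 * q.1.1))))).
  by meas.
- rewrite (_ : chart_im _ _ = (fun p : RR * RR => \int[mu]_x
    (xcut n (chart_im aff_exp g) (x, p.2) * cos (2 * pi * (x * p.1)) -
     xcut n (chart_re aff_exp g) (x, p.2) * sin (2 * pi * (x * p.1))))); last first.
    by apply/funext => p; have [] := fourier_cutE g n p.
  apply: (@measurable_Rintegral_snd _ _ _ RR R mu (fun q : (RR * RR) * RR =>
    (xcut n (chart_im aff_exp g) (q.2, q.1.2) * cos (2 * pi * (q.2 * q.1.1)) -
     xcut n (chart_re aff_exp g) (q.2, q.1.2) * sin (2 * pi * (q.2 * q.1.1))))).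
  by meas.
Qed.

(** On integrable sections the cosine and sine integrals are the even and odd
    parts of the Hartley integral. *)
Lemma fourier_cut_hartley (g : R * R -> R[i]) n : inL2Aff g ->
  let Hr := xhart (xcut n (chart_re aff_exp g)) in let Hi := xhart (xcut n (chart_im aff_exp g)) in
  [/\ inL2Aff (fourier_cut g n),
    sqn mu2 (fun p => chart_re aff_exp (fourier_cut g n) p - (xev Hr p + xod Hi p)) = 0 &
    sqn mu2 (fun p => chart_im aff_exp (fourier_cut g n) p - (xev Hi p - xod Hr p)) = 0].
Proof.
move=> /(chart_inL2 chart_Aff)[Lr Li] Hr Hi.
have [mTr mTi] := measurable_fourier_cut n (L2_meas Lr) (L2_meas Li).
have LHr : L2 mu2 Hr by apply: L2_xhart; [exact: L2_xcut|exact: xbounded_xcut].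
have LHi : L2 mu2 Hi by apply: L2_xhart; [exact: L2_xcut|exact: xbounded_xcut].
have Le f : L2 mu2 f -> L2 mu2 (xev f) by exact: (bounded_L2 hartley_op_xev.1).
have Lo f : L2 mu2 f -> L2 mu2 (xod f) by exact: (bounded_L2 hartley_op_xod.1).
have L1 := L2D (Le _ LHr) (Lo _ LHi); have L2' := L2B (Le _ LHi) (Lo _ LHr).
have sr := ae_integrable_section (L2_xcut n Lr) (xbounded_xcut n _).
have si := ae_integrable_section (L2_xcut n Li) (xbounded_xcut n _).
have mcos xi : measurable_fun setT (fun x : RR => cos (2 * pi * (x * xi))) by meas.
have msin xi : measurable_fun setT (fun x : RR => sin (2 * pi * (x * xi))) by meas.
have bcos xi (x : RR) : `|cos (2 * pi * (x * xi))| <= 1 by rewrite ler_norml cos_geN1 cos_le1.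
have bsin xi (x : RR) : `|sin (2 * pi * (x * xi))| <= 1 by rewrite ler_norml sin_geN1 sin_le1.
have [D1 E1] : L2 mu2 (fun p => chart_re aff_exp (fourier_cut g n) p - (xev Hr p + xod Hi p)) /\
    sqn mu2 (fun p => chart_re aff_exp (fourier_cut g n) p - (xev Hr p + xod Hi p)) = 0.
  apply: sqint_ae_section0; first by apply: measurable_funB => //; exact: L2_meas L1.
  apply: filterS2 sr si => y ir ii x; have [-> _] := fourier_cutE g n (x, y).
  rewrite /xev /xod /Hr /Hi /xhart/= hart_even// hart_odd// RintegralD//; first by rewrite subrr.
    exact: (integrable_mul_bounded ir (mcos x) (bcos x)).
  exact: (integrable_mul_bounded ii (msin x) (bsin x)).
have [D2 E2] : L2 mu2 (fun p => chart_im aff_exp (fourier_cut g n) p - (xev Hi p - xod Hr p)) /\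
    sqn mu2 (fun p => chart_im aff_exp (fourier_cut g n) p - (xev Hi p - xod Hr p)) = 0.
  apply: sqint_ae_section0; first by apply: measurable_funB => //; exact: L2_meas L2'.
  apply: filterS2 sr si => y ir ii x; have [_ ->] := fourier_cutE g n (x, y).
  rewrite /xev /xod /Hr /Hi /xhart/= hart_even// hart_odd// RintegralB//; first by rewrite subrr.
    exact: (integrable_mul_bounded ii (mcos x) (bcos x)).
  exact: (integrable_mul_bounded ir (msin x) (bsin x)).
split=> //; apply/(chart_inL2 chart_Aff); split.
- have := L2D D1 L1; congr (L2 _ _); apply/funext => p; ring.
- have := L2D D2 L2'; congr (L2 _ _); apply/funext => p; ring.
Qed.

Theorem partial_fourierP (g G : R * R -> R[i]) : inL2Aff g -> inL2Aff G ->
  partial_fourier g G <->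
  fourier1 (chart_re aff_exp g) (chart_im aff_exp g) (chart_re aff_exp G) (chart_im aff_exp G).
Proof.
move=> Lg LG; have /(chart_inL2 chart_Aff)[Lr Li] := Lg; have /(chart_inL2 chart_Aff)[LGr LGi] := LG.
have [a ha] := ex_hartley Lr; have [b hb] := ex_hartley Li.
have [_ La ca] := ha; have [_ Lb cb] := hb.
have LT n : inL2Aff (fourier_cut g n) by have [] := fourier_cut_hartley n Lg.
have LTr n : L2 mu2 (chart_re aff_exp (fourier_cut g n)) by have /(chart_inL2 chart_Aff)[] := LT n.
have LTi n : L2 mu2 (chart_im aff_exp (fourier_cut g n)) by have /(chart_inL2 chart_Aff)[] := LT n.
have LHr n : L2 mu2 (xhart (xcut n (chart_re aff_exp g))) by apply: L2_xhart; [exact: L2_xcut|exact: xbounded_xcut].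
have LHi n : L2 mu2 (xhart (xcut n (chart_im aff_exp g))) by apply: L2_xhart; [exact: L2_xcut|exact: xbounded_xcut].
have Le f : L2 mu2 f -> L2 mu2 (xev f) by exact: (bounded_L2 hartley_op_xev.1).
have Lo f : L2 mu2 f -> L2 mu2 (xod f) by exact: (bounded_L2 hartley_op_xod.1).
have ce F f : (forall n, L2 mu2 (F n)) -> L2 mu2 f -> cvgl2 mu2 F f -> cvgl2 mu2 (fun n => xev (F n)) (xev f).
  exact: (bounded_cvgl2 hartley_op_xev.1).
have co F f : (forall n, L2 mu2 (F n)) -> L2 mu2 f -> cvgl2 mu2 F f -> cvgl2 mu2 (fun n => xod (F n)) (xod f).
  exact: (bounded_cvgl2 hartley_op_xod.1).
have cr : cvgl2 mu2 (fun n => chart_re aff_exp (fourier_cut g n)) (fun p => xev a p + xod b p).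
  apply: (@cvgl2_near _ _ _ _ (fun n p => xev (xhart (xcut n (chart_re aff_exp g))) p + xod (xhart (xcut n (chart_im aff_exp g))) p)).
  - by move=> n; rewrite sqn_subC; have [] := fourier_cut_hartley n Lg.
  - by move=> n; apply: L2D; [exact: Le|exact: Lo].
  - exact: LTr.
  - by apply: L2D; [exact: Le|exact: Lo].
  apply: cvgl2D; [by move=> n; exact: Le|by move=> n; exact: Lo|exact: Le|exact: Lo|exact: ce|exact: co].
have ci : cvgl2 mu2 (fun n => chart_im aff_exp (fourier_cut g n)) (fun p => xev b p + -1 * xod a p).
  apply: (@cvgl2_near _ _ _ _ (fun n p => xev (xhart (xcut n (chart_im aff_exp g))) p + -1 * xod (xhart (xcut n (chart_re aff_exp g))) p)).
  - move=> n; rewrite sqn_subC; have [_ _ <-] := fourier_cut_hartley n Lg.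
    by congr sqn; apply/funext => p; rewrite mulN1r.
  - by move=> n; apply: L2D; [exact: Le|apply: L2Z; exact: Lo].
  - exact: LTi.
  - by apply: L2D; [exact: Le|apply: L2Z; exact: Lo].
  apply: cvgl2D; [by move=> n; exact: Le|by move=> n; apply: L2Z; exact: Lo|exact: Le|by apply: L2Z; exact: Lo|exact: ce|].
  by apply: cvgl2Z; [by move=> n; exact: Lo|exact: Lo|exact: co].
have EI : (fun p => xev b p + -1 * xod a p) = (fun p => xev b p - xod a p).
  by apply/funext => p; rewrite mulN1r.
rewrite EI in ci.
have Lab := L2D (Le _ La) (Lo _ Lb); have Lba := L2B (Le _ Lb) (Lo _ La).
split=> [[_ /(chart_cvgL2 chart_Aff LT LG)[c1 c2]]|[_ _ [a' [b' [ha' hb' Er Ei]]]]].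
  split=> //; exists a, b; split=> //.
    exact: (cvgl2_unique LTr LGr Lab c1 cr).
  exact: (cvgl2_unique LTi LGi Lba c2 ci).
have La' := hartley_L2r ha'; have Lb' := hartley_L2r hb'.
have Ea := hartley_uniq ha ha'; have Eb := hartley_uniq hb hb'.
have Lab' := L2D (Le _ La') (Lo _ Lb'); have Lba' := L2B (Le _ Lb') (Lo _ La').
have cong P (hP : bounded_op P) f f' := @bounded_congr R P f f' hP.
split=> //; apply/(chart_cvgL2 chart_Aff LT LG); split.
- apply: (cvgl2_lim_congr LTr Lab LGr _ cr).
  apply: (sqn_sub_trans LGr Lab' Lab Er); rewrite sqn_subC.
  apply: sqn_sub_add; try by [exact: Le|exact: Lo].
    exact: (cong _ hartley_op_xev.1 _ _ La La' Ea).
  exact: (cong _ hartley_op_xod.1 _ _ Lb Lb' Eb).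
- apply: (cvgl2_lim_congr LTi Lba LGi _ ci).
  apply: (sqn_sub_trans LGi Lba' Lba Ei); rewrite sqn_subC.
  apply: sqn_sub_sub; try by [exact: Le|exact: Lo].
    exact: (cong _ hartley_op_xev.1 _ _ Lb Lb' Eb).
  exact: (cong _ hartley_op_xod.1 _ _ La La' Ea).
Qed.

End affine_fourier.

(** * The function lambda, shears and tensor products *)

Section lambda_function.
Context {R : realType}.
Local Notation RR := (measurableTypeR R).

Lemma expR_sub1_neq0 (u : R) : u != 0 -> expR u - 1 != 0.
Proof.
by move=> u0; rewrite subr_eq0 -expR0; apply: contra u0 => /eqP/expR_inj/eqP.
Qed.

Lemma lambda_gt0 (u : R) : 0 < lambda u.
Proof.
rewrite /lambda; case: eqVneq => [//|u0].
have [up|un|e0] := ltrgtP u 0.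
- have h : expR u - 1 < 0 by rewrite subr_lt0 expR_lt1.
  by rewrite nmulr_lgt0 ?invr_lt0// pmulr_llt0// expR_gt0.
- have h : 0 < expR u - 1 by rewrite subr_gt0 expR_gt1.
  by rewrite divr_gt0// mulr_gt0// expR_gt0.
- by rewrite e0 eqxx in u0.
Qed.

Lemma lambdaN (u : R) : lambda u = expR u * lambda (- u).
Proof.
rewrite /lambda oppr_eq0; case: eqVneq => [->|u0]; first by rewrite expR0 mulr1.
have h : expR u - 1 != 0 by exact: expR_sub1_neq0.
rewrite expRN; have e0 := expR_gt0 u; move: (expR u) e0 h => E e0 h.
have E0 : E != 0 by rewrite gt_eqF.
have h' : 1 - E != 0 by rewrite subr_eq0 eq_sym -subr_eq0.
have -> : E^-1 - 1 = (1 - E) / E by field.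
by field; rewrite E0 h h'.
Qed.

Definition ell (u : R) : R := ln (lambda (- u)).

Lemma expR_ell u : expR (ell u) = lambda (- u).
Proof. by rewrite lnK// posrE lambda_gt0. Qed.

Lemma measurable_lambda : measurable_fun [set: RR] (@lambda R).
Proof.
rewrite (_ : @lambda R = fun u : RR => if 0 < `|u| then
    expR (ln `|u * expR u| - ln `|expR u - 1|) else 1 : R); first by meas.
apply/funext => u; rewrite normr_gt0 /lambda; case: eqVneq => //= u0.
have h : expR u - 1 != 0 by exact: expR_sub1_neq0.
have := lambda_gt0 u; rewrite /lambda (negbTE u0) => l0.
rewrite expRD expRN !lnK ?posrE ?normr_gt0// ?mulf_neq0//; last by rewrite gt_eqF ?expR_gt0.
by rewrite -normfV -normrM gtr0_norm.
Qed.

Lemma measurable_ell : measurable_fun [set: RR] (ell : RR -> RR).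
Proof. by rewrite /ell; have := measurable_lambda => ml; meas. Qed.

Lemma ln_mul_lambda (t u : R) : ln (expR t * lambda u) = t + ell u + u.
Proof.
rewrite lambdaN -expR_ell -!expRD expRK; lra.
Qed.

End lambda_function.

Section substitutions.
Context {R : realType}.
Notation mu := (@lebesgue_measure R).
Notation mu2 := (leb2 R).
Local Notation RR := (measurableTypeR R).
Local Notation fn := (RR * RR -> R).

Lemma contr_comp c (phi : RR * RR -> RR * RR) c' (phi' : RR * RR -> RR * RR) :
  contr c phi -> contr c' phi' -> contr (fun p => c p * c' (phi p)) (fun p => phi' (phi p)).
Proof.
move=> [mc mp H] [mc' mp' H']; split; [by meas|by meas|move=> F mF F0].
apply: le_trans (H' F mF F0).
apply: le_trans (H (fun q => F (phi' q) * (c' q ^+ 2)%:E)%E _ _).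
- rewrite le_eqVlt; apply/orP; left; apply/eqP/eq_integral => p _.
  by rewrite -muleA -EFinM exprMn mulrC.
- by meas.
- by move=> p; rewrite mule_ge0// lee_fin sqr_ge0.
Qed.

Definition msubst (phi : RR * RR -> RR * RR) : Prop := contr (fun=> 1) phi.

Lemma msubst_comp phi phi' : msubst phi -> msubst phi' -> msubst (fun p => phi' (phi p)).
Proof.
move=> h h'; have := contr_comp h h'; rewrite /msubst; congr contr.
by apply/funext => p; rewrite mulr1.
Qed.

Lemma wcomp1 phi (f : fn) : wcomp (fun=> 1) phi f = (fun p => f (phi p)).
Proof. by apply/funext => p; rewrite /wcomp mul1r. Qed.

Lemma L2_subst phi (f : fn) : msubst phi -> L2 mu2 f -> L2 mu2 (fun p => f (phi p)).
Proof. by move=> H Lf; rewrite -wcomp1; exact: L2_wcomp. Qed.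

Lemma sqn_subst_le phi (f : fn) : msubst phi -> L2 mu2 f ->
  sqn mu2 (fun p => f (phi p)) <= sqn mu2 f.
Proof. by move=> H Lf; rewrite -wcomp1; exact: sqn_wcomp_le. Qed.

Lemma subst_congr phi (f g : fn) : msubst phi -> L2 mu2 f -> L2 mu2 g ->
  sqn mu2 (fun p => f p - g p) = 0 -> sqn mu2 (fun p => f (phi p) - g (phi p)) = 0.
Proof. by move=> H Lf Lg /(wcomp_congr H Lf Lg); rewrite !wcomp1. Qed.

(** A contraction that a second contraction undoes is isometric, and polarization
    passes from norms to inner products. *)
Lemma ip_subst phi psi (f g : fn) : msubst phi -> msubst psi -> cancel psi phi ->
  L2 mu2 f -> L2 mu2 g -> ip mu2 (fun p => f (phi p)) (fun p => g (phi p)) = ip mu2 f g.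
Proof.
move=> H K c.
have E h : L2 mu2 h -> sqn mu2 (fun p => h (phi p)) = sqn mu2 h.
  move=> Lh; have Lhp := L2_subst H Lh; apply/eqP; rewrite eq_le sqn_subst_le//=.
  apply: le_trans (sqn_subst_le K Lhp); rewrite (_ : (fun p => _) = h)//.
  by apply/funext => p; rewrite c.
move=> Lf Lg; have Lfp := L2_subst H Lf; have Lgp := L2_subst H Lg.
have := E _ (L2D Lf Lg); rewrite (sqnD Lf Lg) (sqnD Lfp Lgp) !E//; lra.
Qed.

Lemma msubst_xtranslate (a : RR -> RR) : measurable_fun setT a ->
  msubst (fun p => (p.1 + a p.2, p.2)).
Proof.
move=> ma; apply: (@contr_xfibre _ (fun=> 1) (fun p => p.1 + a p.2)); [by meas|by meas|move=> y F mF F0].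
under eq_integral do rewrite expr1n mule1.
rewrite -(ge0_integral_translate (a y) mF F0) le_eqVlt; apply/orP; left; apply/eqP.
by apply: eq_integral => x _.
Qed.

Lemma msubst_swap : msubst (fun p => (p.2, p.1)).
Proof. exact: contr_swap. Qed.

(** The arguments ln (a lambda(u)) and ln (a lambda(- u)) of the Wigner function,
    at p = (u, ln a). *)
Definition shear (p : RR * RR) : RR * RR := (p.1 + (p.2 + ell p.1), p.2 + ell p.1).
Definition unshear (p : RR * RR) : RR * RR := (p.1 - p.2, p.2 - ell (p.1 - p.2)).

Lemma shearK : cancel shear unshear.
Proof.
by move=> [u t]; rewrite /shear /unshear/= (_ : u + (t + ell u) - (t + ell u) = u) ?addrK//; ring.
Qed.

Lemma unshearK : cancel unshear shear.
Proof. by move=> [r s]; rewrite /shear /unshear/= subrK subrK. Qed.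

Lemma msubst_shear : msubst shear.
Proof.
have ml := @measurable_ell R.
have h1 := msubst_comp msubst_swap (msubst_comp (msubst_xtranslate ml) msubst_swap).
have mid : measurable_fun setT (fun x : RR => x : RR) by meas.
exact: msubst_comp h1 (msubst_xtranslate mid).
Qed.

Lemma msubst_unshear : msubst unshear.
Proof.
have ml := @measurable_ell R.
have m1 : measurable_fun setT (fun x : RR => - x : RR) by meas.
have m2 : measurable_fun setT (fun x : RR => - ell x : RR) by meas.
have h2 := msubst_comp msubst_swap (msubst_comp (msubst_xtranslate m2) msubst_swap).
exact: msubst_comp (msubst_xtranslate m1) h2.
Qed.

End substitutions.

Section tensor.
Context {R : realType}.
Notation mu := (@lebesgue_measure R).
Notation mu2 := (leb2 R).
Local Notation RR := (measurableTypeR R).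
Implicit Types (v : RR * RR -> R) (phi psi : RR -> R).

Definition tensor psi phi (p : RR * RR) : R := psi p.1 * phi p.2.

Lemma L2_tensor psi phi : L2 mu psi -> L2 mu phi -> L2 mu2 (tensor psi phi).
Proof.
move=> Lpsi Lphi; have [mpsi hpsi] := Lpsi; have [mphi hphi] := Lphi.
have mt : measurable_fun setT (tensor psi phi) by rewrite /tensor; meas.
split=> //; rewrite sqint_sections//.
rewrite (eq_integral (fun y => sqint mu psi * (phi y ^+ 2)%:E)%E); last first.
  move=> y _; rewrite /sqint /tensor/= -ge0_integralZr//; last 3 first.
  - by meas.
  - by move=> x _; rewrite lee_fin sqr_ge0.
  - by rewrite lee_fin sqr_ge0.
  by apply: eq_integral => x _; rewrite exprMn EFinM.
rewrite ge0_integralZl//; last 3 first.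
- by meas.
- by move=> y _; rewrite lee_fin sqr_ge0.
- exact: sqint_ge0.
by rewrite -/(sqint mu phi) !sqintE// -EFinM ltry.
Qed.

Definition kapp v phi (x : RR) : R := \int[mu]_y (v (x, y) * phi y).

Lemma ae_L2_section_snd v : L2 mu2 v -> {ae mu, forall x, L2 mu (fun y => v (x, y))}.
Proof. by move=> Lv; exact: ae_L2_section (L2_subst msubst_swap Lv). Qed.

(** Cauchy-Schwarz on almost every section. *)
Lemma L2_kapp v phi : L2 mu2 v -> L2 mu phi -> L2 mu (kapp v phi).
Proof.
move=> Lv Lphi; have mv := L2_meas Lv; have mphi := L2_meas Lphi.
have mk : measurable_fun setT (kapp v phi).
  apply: (@measurable_Rintegral_snd _ _ RR RR R mu (fun p : RR * RR => v p * phi p.2)).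
  by meas.
split=> //.
have Ls := L2_subst msubst_swap Lv; have ms := L2_meas Ls.
apply: (@le_lt_trans _ _ (\int[mu]_x (sqint mu (fun y => v (x, y)) * (sqn mu phi)%:E))%E).
  apply: ae_ge0_le_integral => //.
  - by move=> x _; rewrite lee_fin sqr_ge0.
  - by meas.
  - by move=> x _; rewrite mule_ge0 ?sqint_ge0// lee_fin sqn_ge0.
  - by apply: emeasurable_funM; [exact: (measurable_sqint_section ms)|meas].
  apply: filterS (ae_L2_section_snd Lv) => x Lx _.
  by rewrite sqintE// -EFinM lee_fin; exact: (cauchy_schwarz Lx Lphi).
rewrite ge0_integralZr//; last 3 first.
- exact: (measurable_sqint_section ms).
- by move=> x _; exact: sqint_ge0.
- by rewrite lee_fin sqn_ge0.
by rewrite -(sqint_sections ms) sqintE// -EFinM ltry.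
Qed.

Lemma ip_tensor v psi phi : L2 mu2 v -> L2 mu psi -> L2 mu phi ->
  ip mu2 v (tensor psi phi) = ip mu (kapp v phi) psi.
Proof.
move=> Lv Lpsi Lphi; have i2 := L2_mul_integrable Lv (L2_tensor Lpsi Lphi).
have i1 := L2_mul_integrable (L2_kapp Lv Lphi) Lpsi.
rewrite /ip /Rintegral -(@integral12_prod_meas1 _ _ RR RR R mu mu _ i2); congr fine.
apply: ae_eq_integral => //.
- exact: (@measurable_fubini_F _ _ RR RR R mu mu _ i2).
- exact: measurable_int i1.
apply: filterS (ae_L2_section_snd Lv) => x Lx _; rewrite /fubini_F/= /tensor/=.
have ix := L2_mul_integrable Lx Lphi.
rewrite /kapp mulrC -RintegralZl// /Rintegral fineK.
  by apply: eq_integral => y _; rewrite mulrCA.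
exact: (integrable_fin_num measurableT (integrable_scalel (psi x) ix)).
Qed.

End tensor.

(** * The kernel of an operator with a given Weyl symbol *)

Section weyl_kernel.
Context {R : realType}.
Notation mu := (@lebesgue_measure R).
Notation mu2 := (leb2 R).
Local Notation RR := (measurableTypeR R).
Local Notation fn := (RR * RR -> R).
Local Notation log_re := (@chart_re _ RR R (@expR R)).
Local Notation log_im := (@chart_im _ RR R (@expR R)).
Implicit Types (phi psi : RR -> R) (A : (R -> R[i]) -> (R -> R[i])) (f : R * R -> R[i]).

Lemma inL2pos_real phi : L2 mu (fun t => phi (expR t)) -> inL2pos (fun r => (phi r)%:C%C).
Proof.
move=> Lphi; apply/(chart_inL2 (@chart_pos R)); split=> //.
by rewrite /chart_im; exact: L20.
Qed.

(** In logarithmic coordinates the Wigner function of psi and phi is the Fourier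
    transform of (psi (x) phi) o shear. Parseval's identity replaces the pairing
    of f with it by the pairing of k = kr + i ki with (psi (x) phi) o shear, and
    the shear moves to k. *)
Lemma weyl_pairing f A kr ki phi psi : inL2Aff f -> boundedL2pos A -> affine_weyl f A ->
  L2 mu2 kr -> L2 mu2 ki -> fourier1 kr ki (chart_re aff_exp f) (chart_im aff_exp f) ->
  L2 mu (fun t => phi (expR t)) -> L2 mu psi ->
  let t := tensor psi (fun t => phi (expR t)) in
  ip mu (log_re (A (fun r => (phi r)%:C%C))) psi = ip mu2 (fun p => kr (unshear p)) t /\
  ip mu (log_im (A (fun r => (phi r)%:C%C))) psi = ip mu2 (fun p => ki (unshear p)) t.
Proof.
move=> Lf [bA _] wA Lkr Lki hk Lphi Lpsi t.
have Lt : L2 mu2 t by exact: L2_tensor.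
have Lphi' := inL2pos_real Lphi; have LA := bA _ Lphi'.
have /(chart_inL2 (@chart_pos R))[LAr LAi] := LA.
(* [psi] is given on the logarithmic line, [phi] on R_+ *)
pose psi1 (r : R) := psi (ln r).
have psi1E : (fun s => psi1 (expR s)) = psi by apply/funext => s; rewrite /psi1 expRK.
have Lpsi1 : inL2pos (fun r => (psi1 r)%:C%C) by apply: inL2pos_real; rewrite psi1E.
pose w (p : R * R) : R[i] := (psi1 (p.2 * lambda p.1))%:C%C * ((phi (p.2 * lambda (- p.1)))%:C%C)^*%C.
have wr : chart_re aff_exp w = (fun p => t (shear p)).
  apply/funext => -[u s]; rewrite /chart_re /w /t /tensor /shear /aff_exp /psi1/=.
  by rewrite ln_mul_lambda -expR_ell -expRD mul0r subr0 (addrC u).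
have wi : chart_im aff_exp w = fun=> 0.
  by apply/funext => -[u s]; rewrite /chart_im /w /= oppr0 mulr0 mul0r addr0.
have Lts : L2 mu2 (fun p => t (shear p)) by exact: L2_subst (@msubst_shear R) Lt.
have Lw : inL2Aff w.
  by apply/(chart_inL2 (@chart_Aff R)); rewrite wr wi; split=> //; exact: L20.
have [c hc] := ex_hartley Lts; have Lc := hartley_L2r hc.
have Lec := bounded_L2 hartley_op_xev.1 Lc; have Loc := bounded_L2 hartley_op_xod.1 Lc.
pose W (p : R * R) : R[i] := (xev c (aff_ln p) +i* - xod c (aff_ln p))%C.
have Wr : chart_re aff_exp W = xev c by apply/funext => -[x y]; rewrite /chart_re /W /aff_exp /aff_ln/= expRK.
have Wi : chart_im aff_exp W = (fun p => - xod c p).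
  by apply/funext => -[x y]; rewrite /chart_im /W /aff_exp /aff_ln/= expRK.
have LW : inL2Aff W.
  by apply/(chart_inL2 (@chart_Aff R)); rewrite Wr Wi; split=> //; exact: L2N.
have hW : affine_wigner (fun r => (psi1 r)%:C%C) (fun r => (phi r)%:C%C) W.
  apply/(partial_fourierP Lw LW); rewrite Wr Wi wr wi; split=> //; first exact: L2N.
  exists c, (fun=> 0); split=> //; first exact: hartley0.
    apply: etrans (sqn_subxx mu2 (xev c)); congr sqn; apply/funext => p.
    by rewrite /xod !mulr0 !addr0.
  apply: etrans (sqn_subxx mu2 (fun p => - xod c p)); congr sqn; apply/funext => p.
  by rewrite /xev !mulr0 addr0 sub0r.
have := wA _ _ _ Lphi' Lpsi1 hW.
have [r1 i1] := chart_inner (@chart_pos R) LA Lpsi1.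
have [r2 i2] := chart_inner (@chart_Aff R) Lf LW.
have pr : log_re (fun r => (psi1 r)%:C%C) = psi by rewrite /chart_re/= psi1E.
have pi0 : log_im (fun r => (psi1 r)%:C%C) = fun=> 0 by [].
have ip0 h : ip mu h (fun=> 0) = 0.
  by rewrite /ip; under eq_Rintegral do rewrite mulr0; rewrite /Rintegral integral0.
have /(chart_inL2 (@chart_Aff R))[Lfr Lfi] := Lf.
rewrite pr pi0 !ip0 addr0 subr0 in r1 i1; rewrite Wr Wi !ipNr// in r2 i2.
have [p1 p2] := fourier1_parseval_real hk hc.
have us k : L2 mu2 k -> ip mu2 k (fun p => t (shear p)) = ip mu2 (fun p => k (unshear p)) t.
  move=> Lk; rewrite -(ip_subst (@msubst_unshear R) (@msubst_shear R) (@shearK R) Lk Lts).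
  by congr ip; apply/funext => p; rewrite unshearK.
rewrite -(us _ Lkr) -(us _ Lki) -p1 -p2 => E; split.
- by rewrite -r1; rewrite /innerL2pos /innerL2Aff in E; rewrite E r2.
- by rewrite -i1; rewrite /innerL2pos /innerL2Aff in E; rewrite E i2 opprK.
Qed.

(** Both sides have the same inner product with every real [psi], hence with
    their own difference. *)
Lemma weyl_kapp f A kr ki phi : inL2Aff f -> boundedL2pos A -> affine_weyl f A ->
  L2 mu2 kr -> L2 mu2 ki -> fourier1 kr ki (chart_re aff_exp f) (chart_im aff_exp f) ->
  L2 mu (fun t => phi (expR t)) ->
  {ae mu, forall t,
    log_re (A (fun r => (phi r)%:C%C)) t = kapp (fun p => kr (unshear p)) (fun t => phi (expR t)) t /\
    log_im (A (fun r => (phi r)%:C%C)) t = kapp (fun p => ki (unshear p)) (fun t => phi (expR t)) t}.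
Proof.
move=> Lf bA wA Lkr Lki hk Lphi.
have LKr := L2_subst (@msubst_unshear R) Lkr; have LKi := L2_subst (@msubst_unshear R) Lki.
have [bA' _] := bA; have /(chart_inL2 (@chart_pos R))[LAr LAi] := bA' _ (inL2pos_real Lphi).
have LEr := L2_kapp LKr Lphi; have LEi := L2_kapp LKi Lphi.
have P psi (Lpsi : L2 mu psi) := weyl_pairing Lf bA wA Lkr Lki hk Lphi Lpsi.
have ae0 (a b : RR -> R) : L2 mu a -> L2 mu b ->
    (forall psi, L2 mu psi -> ip mu a psi = ip mu b psi) -> {ae mu, forall t, a t = b t}.
  move=> La Lb ab; have Lab := L2B La Lb.
  have : sqn mu (fun t => a t - b t) = 0 by rewrite /sqn ipBl// ab// subrr.
  by move/(sqn0_ae Lab); apply: filterS => t /eqP; rewrite subr_eq0 => /eqP.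
apply: filterS2 (ae0 _ _ LAr LEr _) (ae0 _ _ LAi LEi _) => [t -> -> //|psi Lpsi|psi Lpsi].
- by rewrite -ip_tensor//; have [] := P psi Lpsi.
- by rewrite -ip_tensor//; have [] := P psi Lpsi.
Qed.

(** Here [part] is the real or the imaginary part. *)
Definition log_kernel (part : R[i] -> R) (K : R -> R -> R[i]) (p : RR * RR) : R :=
  part (K (expR p.1) (expR p.2)).

Lemma kernel_integral (K : R -> R -> R[i]) (psi : R -> R[i]) :
  L2 mu2 (log_kernel (@complex.Re R) K) -> L2 mu2 (log_kernel (@complex.Im R) K) ->
  inL2pos psi ->
  let Kr := log_kernel (@complex.Re R) K in let Ki := log_kernel (@complex.Im R) K in
  let pr := log_re psi in let pi := log_im psi in
  {ae mu, forall t,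
    cintegrable (leb R) (@Rpos R) (fun s => (s^-1)%:C%C * (K (expR t) s * psi s)) /\
    cintegral (leb R) (@Rpos R) (fun s => (s^-1)%:C%C * (K (expR t) s * psi s)) =
     ((kapp Kr pr t - kapp Ki pi t) +i* (kapp Kr pi t + kapp Ki pr t))%C}.
Proof.
move=> LKr LKi /(chart_inL2 (@chart_pos R))[Lr Li] Kr Ki pr pi.
apply: filterS2 (ae_L2_section_snd LKr) (ae_L2_section_snd LKi) => t Lt Lt'.
pose G1 s := complex.Re (K (expR t) s * psi s); pose G2 s := complex.Im (K (expR t) s * psi s).
have E1 : (fun s => G1 (expR s)) = (fun s => Kr (t, s) * pr s - Ki (t, s) * pi s).
  by apply/funext => s; rewrite /G1 /Kr /Ki /pr /pi /log_kernel /chart_re /chart_im/=; case: (K _ _); case: (psi _).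
have E2 : (fun s => G2 (expR s)) = (fun s => Kr (t, s) * pi s + Ki (t, s) * pr s).
  by apply/funext => s; rewrite /G2 /Kr /Ki /pr /pi /log_kernel /chart_re /chart_im/=; case: (K _ _); case: (psi _).
have i1 := L2_mul_integrable Lt Lr; have i2 := L2_mul_integrable Lt Li.
have i3 := L2_mul_integrable Lt' Lr; have i4 := L2_mul_integrable Lt' Li.
have I1 : mu.-integrable setT (fun s => (G1 (expR s))%:E).
  by rewrite (_ : (fun s => _) = EFin \o (fun s => G1 (expR s)))// E1; exact: (integrableB measurableT i1 i4).
have I2 : mu.-integrable setT (fun s => (G2 (expR s))%:E).
  by rewrite (_ : (fun s => _) = EFin \o (fun s => G2 (expR s)))// E2; exact: (integrableD measurableT i2 i3).
have F1 : (fun s => complex.Re ((s^-1)%:C%C * (K (expR t) s * psi s)) : R) = (fun s => s^-1 * G1 s).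
  by apply/funext => s; rewrite /G1; case: (K _ _ * _) => a b /=; rewrite mul0r subr0.
have F2 : (fun s => complex.Im ((s^-1)%:C%C * (K (expR t) s * psi s)) : R) = (fun s => s^-1 * G2 s).
  by apply/funext => s; rewrite /G2; case: (K _ _ * _) => a b /=; rewrite mul0r addr0.
split.
  split.
    rewrite (_ : (fun s => _) = (fun s => (s^-1 * G1 s)%:E)); last first.
      by apply/funext => s; rewrite -(congr1 (fun F => F s) F1).
    exact: (chart_integrable (@chart_pos R) I1).
  rewrite (_ : (fun s => _) = (fun s => (s^-1 * G2 s)%:E)); last first.
    by apply/funext => s; rewrite -(congr1 (fun F => F s) F2).
  exact: (chart_integrable (@chart_pos R) I2).
have m1 : measurable_fun setT (fun s : RR => G1 (expR s)) by apply/measurable_EFinP; exact: measurable_int I1.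
have m2 : measurable_fun setT (fun s : RR => G2 (expR s)) by apply/measurable_EFinP; exact: measurable_int I2.
rewrite /cintegral; congr (_ +i* _)%C.
- rewrite F1 (chart_Rintegral (@chart_pos R) m1) E1 RintegralB//.
- rewrite F2 (chart_Rintegral (@chart_pos R) m2) E2 RintegralD//.
Qed.

End weyl_kernel.

(** * Existence of the Fourier-Wigner transform *)

Section existence.
Context {R : realType}.
Notation mu := (@lebesgue_measure R).
Notation mu2 := (leb2 R).
Local Notation RR := (measurableTypeR R).
Local Notation fn := (RR * RR -> R).
Local Notation log_re := (@chart_re _ RR R (@expR R)).
Local Notation log_im := (@chart_im _ RR R (@expR R)).
Local Notation logRe := (log_kernel (@complex.Re R)).
Local Notation logIm := (log_kernel (@complex.Im R)).
Implicit Types (A : (R -> R[i]) -> (R -> R[i])) (f : R * R -> R[i]) (K : R -> R -> R[i]).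

(** By linearity of [A], from the real case [weyl_kapp] to psi = i Im psi + Re psi.
    The decomposition is exact on all of R, as [A] acts on representatives. *)
Lemma weyl_integral_kernel f A kr ki K : inL2Aff f -> linearL2pos A -> boundedL2pos A ->
  affine_weyl f A -> L2 mu2 kr -> L2 mu2 ki ->
  fourier1 kr ki (chart_re aff_exp f) (chart_im aff_exp f) ->
  logRe K = (fun p => kr (unshear p)) -> logIm K = (fun p => ki (unshear p)) ->
  integral_kernel A K.
Proof.
move=> Lf lA bA wA Lkr Lki hk Er Ei psi Lpsi.
have /(chart_inL2 (@chart_pos R))[Lr Li] := Lpsi.
pose p1 r := complex.Re (psi r) : R; pose p2 r := complex.Im (psi r) : R.
have Lp1 : L2 mu (fun t => p1 (expR t)) by [].
have Lp2 : L2 mu (fun t => p2 (expR t)) by [].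
have psiE : psi = (fun r => (0 +i* 1)%C * (p2 r)%:C%C + (p1 r)%:C%C).
  apply/funext => r; rewrite /p1 /p2; case: (psi r) => a b /=.
  by apply/eqP; rewrite eq_complex/=; apply/andP; split; apply/eqP; ring.
have LKr := L2_subst (@msubst_unshear R) Lkr; have LKi := L2_subst (@msubst_unshear R) Lki.
have := lA (0 +i* 1)%C _ _ (inL2pos_real Lp2) (inL2pos_real Lp1); rewrite -psiE.
move=> /(chart_ae (@chart_pos R)) lin.
have k1 := weyl_kapp Lf bA wA Lkr Lki hk Lp1.
have k2 := weyl_kapp Lf bA wA Lkr Lki hk Lp2.
have := @kernel_integral R K psi; rewrite Er Ei => /(_ LKr LKi Lpsi)/= ki1.
pose P (t : RR) := cintegrable (leb R) (@Rpos R) (fun s => (s^-1)%:C%C * (K (expR t) s * psi s)) /\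
  A psi (expR t) = cintegral (leb R) (@Rpos R) (fun s => (s^-1)%:C%C * (K (expR t) s * psi s)).
have aeP : {ae mu, forall t, P t}.
  apply: filterS2 lin (filterI k1 (filterI k2 ki1)) => t lint [[a1 a2] [[b1 b2] [c1 c2]]].
  split=> //; rewrite c2 lint; move: a1 a2 b1 b2; rewrite /chart_re /chart_im.
  case: (A _ _) => x y; case: (A _ _) => x' y' /= <- <- <- <-.
  by apply/eqP; rewrite eq_complex/=; apply/andP; split; apply/eqP; ring.
apply: filterS (chart_ae_inv (@chart_pos R) aeP) => r Pr r0.
by have := Pr r0; rewrite /P lnK.
Qed.

Definition sqrt_invpos (r : R) : R := Num.sqrt (invpos r).

Lemma contr_ln : contr (fun p : RR * RR => sqrt_invpos p.2) (fun p => (p.1, ln p.2)).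
Proof.
have mi := @measurable_invpos R.
apply: contr_yfibre; [by rewrite /sqrt_invpos; meas|by meas|move=> F mF F0].
rewrite -(ge0_integral_ln mF F0) le_eqVlt; apply/orP; left; apply/eqP.
by apply: eq_integral => y _; rewrite /sqrt_invpos sqr_sqrtr// invpos_ge0.
Qed.

Lemma sqrt_expR_invpos (t : R) : Num.sqrt (expR t) * sqrt_invpos (expR t) = 1.
Proof.
rewrite /sqrt_invpos invposE ?expR_gt0// -sqrtrM ?expR_ge0//.
by rewrite divff ?sqrtr1// gt_eqF ?expR_gt0.
Qed.

(** With G(r, a) = k(ln a, ln r - ell(ln a)) / sqrt r for r > 0, and 0 otherwise,
    sqrt r G(r, s / r) is the kernel of [A], the value of k o unshear at
    (ln s, ln r). *)
Lemma exists_fourier_wigner f A : inL2Aff f -> linearL2pos A -> boundedL2pos A ->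
  affine_weyl f A -> exists g, fourier_wigner A g.
Proof.
move=> Lf lA bA wA; have /(chart_inL2 (@chart_Aff R))[Lfr Lfi] := Lf.
have [kr [ki [Lkr Lki hk]]] := ex_fourier1_inv Lfr Lfi.
have m2 : measurable_fun setT (fun x : RR => - ell x : RR) by have ml := @measurable_ell R; meas.
have hB := msubst_comp (@msubst_swap R) (msubst_comp (msubst_xtranslate m2) (@msubst_swap R)).
pose G0 (k : fn) (p : RR * RR) := sqrt_invpos p.1 * k (p.2, ln p.1 - ell p.2).
have LG0 k : L2 mu2 k -> L2 mu2 (G0 k).
  by move=> Lk; exact: (L2_subst (@msubst_swap R) (L2_wcomp contr_ln (L2_subst hB Lk))).
pose G (p : R * R) : R[i] := (G0 kr (aff_ln p) +i* G0 ki (aff_ln p))%C.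
have Gr : chart_re aff_exp G = G0 kr.
  by apply/funext => -[x y]; rewrite /chart_re /G /aff_exp /aff_ln/= expRK.
have Gi : chart_im aff_exp G = G0 ki.
  by apply/funext => -[x y]; rewrite /chart_im /G /aff_exp /aff_ln/= expRK.
have LG : inL2Aff G.
  by apply/(chart_inL2 (@chart_Aff R)); rewrite Gr Gi; split; exact: LG0.
have [gr [gi [Lgr Lgi hg]]] := ex_fourier1_inv (LG0 _ Lkr) (LG0 _ Lki).
pose g (p : R * R) : R[i] := (gr (aff_ln p) +i* gi (aff_ln p))%C.
have gre : chart_re aff_exp g = gr.
  by apply/funext => -[x y]; rewrite /chart_re /g /aff_exp /aff_ln/= expRK.
have gie : chart_im aff_exp g = gi.
  by apply/funext => -[x y]; rewrite /chart_im /g /aff_exp /aff_ln/= expRK.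
have Lg : inL2Aff g.
  by apply/(chart_inL2 (@chart_Aff R)); rewrite gre gie.
have hgG : partial_fourier g G by apply/(partial_fourierP Lg LG); rewrite gre gie Gr Gi.
exists g; split.
  split=> //; exists G => //; apply: aeW => p _ p1.
  by rewrite /G /G0 /aff_ln/= /sqrt_invpos /invpos ifF ?sqrtr0 ?mul0r//; exact/negbTE/negP.
exists G => //; apply: (weyl_integral_kernel Lf lA bA wA Lkr Lki hk).
- apply/funext => -[r s]; rewrite /log_kernel/= /G0 /unshear/= mul0r subr0 mulrA sqrt_expR_invpos mul1r.
  by rewrite -expRN -expRD !expRK.
- apply/funext => -[r s]; rewrite /log_kernel/= /G0 /unshear/= mul0r addr0 mulrA sqrt_expR_invpos mul1r.
  by rewrite -expRN -expRD !expRK.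
Qed.

End existence.

(** * Uniqueness of integral kernels *)

Section kernel_uniqueness.
Context {R : realType}.
Notation mu := (@lebesgue_measure R).
Notation mu2 := (leb2 R).
Local Notation RR := (measurableTypeR R).
Local Notation logRe := (log_kernel (@complex.Re R)).
Local Notation logIm := (log_kernel (@complex.Im R)).
Implicit Types (A : (R -> R[i]) -> (R -> R[i])) (K : R -> R -> R[i]).

Lemma integral_kernel_log A K psi : integral_kernel A K -> inL2pos psi ->
  {ae mu, forall t : RR, A psi (expR t) =
    cintegral (leb R) (@Rpos R) (fun s => (s^-1)%:C%C * (K (expR t) s * psi s))}.
Proof.
move=> hK Lp; have [N [mN N0 sN]] := chart_ae (@chart_pos R) (hK _ Lp).
by exists N; split=> // t; apply: contra_notP => Nt; apply: contrapT => h; apply: Nt; apply: sN => -[].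
Qed.

(** Applied to the indicator of a bounded set J, the two kernel operators agree
    almost everywhere; hence the difference of the kernels is orthogonal to all
    rectangles. *)
Lemma kernel_unique A K K' : integral_kernel A K -> integral_kernel A K' ->
  L2 mu2 (logRe K) -> L2 mu2 (logIm K) -> L2 mu2 (logRe K') -> L2 mu2 (logIm K') ->
  sqn mu2 (fun p => logRe K p - logRe K' p) = 0 /\ sqn mu2 (fun p => logIm K p - logIm K' p) = 0.
Proof.
move=> hK hK' L1 L2' L1' L2''.
have E (phi : RR -> R) : L2 mu phi -> {ae mu, forall t,
    kapp (logRe K) phi t = kapp (logRe K') phi t /\ kapp (logIm K) phi t = kapp (logIm K') phi t}.
  move=> Lphi; pose phi1 r := phi (ln r).
  have phi1E : (fun t => phi1 (expR t)) = phi by apply/funext => t; rewrite /phi1 expRK.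
  have Lp : inL2pos (fun r => (phi1 r)%:C%C) by apply: inL2pos_real; rewrite phi1E.
  have pE : @chart_re _ RR R (@expR R) (fun r => (phi1 r)%:C%C) = phi by rewrite -[RHS]phi1E.
  have pE0 : @chart_im _ RR R (@expR R) (fun r => (phi1 r)%:C%C) = fun=> 0 by [].
  have k0 v t : kapp v (fun=> 0) t = 0 :> R.
    by rewrite /kapp; under eq_Rintegral do rewrite mulr0; rewrite /Rintegral integral0.
  have ev K0 : integral_kernel A K0 -> L2 mu2 (logRe K0) -> L2 mu2 (logIm K0) ->
      {ae mu, forall t : RR, A (fun r => (phi1 r)%:C%C) (expR t) =
        (kapp (logRe K0) phi t +i* kapp (logIm K0) phi t)%C}.
    move=> h Lr Li; have := kernel_integral Lr Li Lp; rewrite pE pE0 => e.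
    by apply: filterS2 (integral_kernel_log h Lp) e => t -> [_ ->]; rewrite !k0 subr0 add0r.
  apply: filterS2 (ev _ hK L1 L2') (ev _ hK' L1' L2'') => t ->.
  by case.
have LJ (J : set RR) n : measurable J -> (forall y : R, J y -> `|y| <= n%:R) -> L2 mu (\1_J : RR -> R).
  by move=> mJ Jn; exact: L2_indic mJ (bounded_measure_fin mJ Jn).
have Lab (a b : R) : L2 mu (indic_cc a b).
  by apply: L2_indic; [exact: measurable_itv|exact: itv_measure_fin].
have U v v' : L2 mu2 v -> L2 mu2 v' ->
    (forall phi, L2 mu phi -> {ae mu, forall t, kapp v phi t = kapp v' phi t}) ->
    sqn mu2 (fun p => v p - v' p) = 0.
  move=> Lv Lv' vv'; apply: rect_total; first exact: L2B.
  move=> a b J n mJ Jn; have LJn := LJ J n mJ Jn.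
  rewrite -[rect a b J]/(tensor (indic_cc a b) \1_J).
  rewrite ipBl//; last exact: L2_tensor.
  rewrite !ip_tensor//; apply/eqP; rewrite subr_eq0; apply/eqP.
  have Lk := L2_kapp Lv LJn; have Lk' := L2_kapp Lv' LJn.
  apply: ip_congrl => //; have Lkk := L2B Lk Lk'.
  have ae0 : {ae mu, forall t, kapp v \1_J t - kapp v' \1_J t = 0}.
    by apply: filterS (vv' _ LJn) => t ->; rewrite subrr.
  by have [] := ae_sqn0 (L2_meas Lkk) ae0.
split; apply: U => // phi Lphi; by apply: filterS (E phi Lphi) => t [].
Qed.

End kernel_uniqueness.

(** * The Kirillov transform in logarithmic coordinates *)

Section kirillov_transform.
Context {R : realType}.
Notation mu := (@lebesgue_measure R).
Notation mu2 := (leb2 R).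
Local Notation RR := (measurableTypeR R).
Local Notation fn := (RR * RR -> R).
Implicit Types (X Y h : fn) (p : RR * RR).

(** The isometry from L^2(da) on a > 0 to L^2(dt), for a = e^t. It kills the
    values at a <= 0. *)
Definition ulog X p : R := Num.sqrt (expR p.2) * X (p.1, expR p.2).

Lemma contr_expR : contr (fun p : RR * RR => Num.sqrt (expR p.2)) (fun p => (p.1, expR p.2)).
Proof.
apply: (@contr_yfibre _ (fun y => Num.sqrt (expR y)) expR); [by meas|by meas|move=> F mF F0].
rewrite (eq_integral (fun y : RR => F (expR y) * (expR y)%:E)%E); last first.
  by move=> y _; rewrite sqr_sqrtr// expR_ge0.
rewrite -(@ge0_integral_ln R (fun y => F (expR y) * (expR y)%:E)%E); last 2 first.
- by meas.
- by move=> y; rewrite mule_ge0// lee_fin expR_ge0.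
apply: ge0_le_integral => //.
- by move=> x _; rewrite !mule_ge0// lee_fin ?expR_ge0// invpos_ge0.
- by have mi := @measurable_invpos R; meas.
- move=> x _; rewrite /invpos; case: ifPn => [x0|_]; last by rewrite mule0.
  by rewrite lnK ?posrE// expRN lnK ?posrE// -muleA -EFinM divff ?mule1// gt_eqF.
Qed.

Lemma hartley_op_ulog : hartley_op ulog.
Proof.
have := @hartley_op_yfibre R (fun y => Num.sqrt (expR y)) expR.
by apply; [move=> y; exact: sqrtr_ge0|exact: contr_expR].
Qed.

(** If G(xi, u) is the transform in v of g(v, u), then [yscale G] is, at (u, a),
    the transform in v of the function [ko_weight g] introduced below. *)
Definition yscale X p : R := Num.sqrt (lambda (- p.1)) * X (lambda (- p.1) * p.2, p.1).

Lemma measurable_lambdaN : measurable_fun setT (fun y : RR => lambda (- y) : R).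
Proof. by have ml := @measurable_lambda R; meas. Qed.

Lemma bounded_yscale : bounded_op yscale.
Proof.
have h1 := contr_dilation measurable_lambdaN (fun y : RR => lambda_gt0 (- y)).
have h2 := bounded_comp (bounded_wcomp (@msubst_swap R)) (bounded_wcomp h1).
move: h2; congr bounded_op; apply/funext => X; apply/funext => p.
by rewrite wcomp1.
Qed.

(** These take the Hartley transform in both variables to the cosine, resp. sine,
    transform of the phase x u + a v. *)
Definition kcos X p : R := 2^-1 * X (p.1, - p.2) + 2^-1 * X (- p.1, p.2).
Definition ksin X p : R := 2^-1 * X p + - 2^-1 * X (- p.1, - p.2).

Lemma bounded_kcos : bounded_op kcos.
Proof. exact: bounded_lin hartley_op_yopp.1 hartley_op_xopp.1. Qed.

Lemma bounded_ksin : bounded_op ksin.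
Proof.
exact: bounded_lin bounded_id (bounded_comp hartley_op_xopp.1 hartley_op_yopp.1).
Qed.

Definition hcut n h p : R := h p * box n p.

Lemma boxE n p : box n p = ((`|p.1| <= n%:R) && (`|p.2| <= n%:R))%:R.
Proof.
rewrite /box /rect indic_ccE -ler_norml indicE mem_setE in_itv/= -ler_norml.
by case: (`|p.1| <= _); case: (`|p.2| <= _); rewrite ?mulr1 ?mulr0.
Qed.

Lemma hcut_le n h p : `|hcut n h p| <= `|h p|.
Proof. by rewrite /hcut boxE; case: (_ && _); rewrite ?mulr1 ?mulr0 ?normr0. Qed.

Lemma L2_hcut n h : L2 mu2 h -> L2 mu2 (hcut n h).
Proof.
move=> Lh; apply: L2_le (Lh) (hcut_le n h).
by have m1 := L2_meas Lh; have m2 := L2_meas (@L2_box R n); rewrite /hcut; meas.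
Qed.

Lemma integrable_hcut n h : L2 mu2 h -> mu2.-integrable setT (EFin \o hcut n h).
Proof. by move=> Lh; exact: (L2_mul_integrable Lh (L2_box n)). Qed.

Lemma cvgl2_hcut h : L2 mu2 h -> cvgl2 mu2 (fun n => hcut n h) h.
Proof.
move=> Lh; apply: cvgl2_dominated => //.
- by move=> n; exact: L2_meas (L2_hcut n Lh).
- by move=> n p; exact: hcut_le.
- move=> p; apply: cvg_near_cst.
  exists (maxn (Num.truncn `|p.1|).+1 (Num.truncn `|p.2|).+1) => // n /=.
  rewrite geq_max /hcut boxE => /andP[n1 n2]; rewrite (_ : _ && _) ?mulr1//; apply/andP; split.
    by rewrite (le_trans (ltW (truncnS_gt _)))// ler_nat.
  by rewrite (le_trans (ltW (truncnS_gt _)))// ler_nat.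
Qed.

Definition swap X p : R := X (p.2, p.1).

Definition hart2 h : fn := xhart (swap (xhart (swap h))).

(** As each one-variable transform is isometric, the error of the transforms is
    the error of the truncation. *)
Lemma hart2_hcut n h c Q : L2 mu2 h -> hartley (swap h) (swap c) -> hartley c Q ->
  L2 mu2 (hart2 (hcut n h)) /\
  sqn mu2 (fun p => hart2 (hcut n h) p - Q p) = sqn mu2 (fun p => hcut n h p - h p).
Proof.
move=> Lh hc hQ.
have Ln := L2_hcut n Lh; have Ls := L2_subst (@msubst_swap R) Ln.
have b1 : xbounded (swap (hcut n h)).
  by exists n => p pn; rewrite /swap /hcut boxE/= (leNgt `|p.1|) pn andbF mulr0.
have h1 := hartley_xbounded Ls b1; have L1 := hartley_L2r h1.
have L1s := L2_subst (@msubst_swap R) L1.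
have b2 : xbounded (swap (xhart (swap (hcut n h)))).
  exists n => p pn; rewrite /swap /xhart /hart/=.
  under eq_Rintegral do rewrite /hcut boxE/= (leNgt `|p.1|) pn mulr0 mul0r.
  by rewrite /Rintegral integral0.
have h2 := hartley_xbounded L1s b2; split; first exact: hartley_L2r h2.
have sw X Y : L2 mu2 X -> L2 mu2 Y ->
    sqn mu2 (fun p => swap X p - swap Y p) = sqn mu2 (fun p => X p - Y p).
  move=> LX LY; have LXY := L2B LX LY.
  have ss : cancel (fun p : RR * RR => (p.2, p.1)) (fun p => (p.2, p.1)) by case.
  exact: (ip_subst (@msubst_swap R) (@msubst_swap R) ss LXY LXY).
rewrite (hartley_sqn (hartleyB h2 hQ)).
have Lc := hartley_L2l hQ; rewrite -(sw _ _ L1s Lc).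
rewrite -(sw _ _ Ln Lh); exact: (hartley_sqn (hartleyB h1 hc)).
Qed.

Lemma hart2E h p : mu2.-integrable setT (EFin \o h) ->
  hart2 h p = \int[mu2]_q (h q * (cas (q.1 * p.1) * cas (q.2 * p.2))).
Proof.
move=> ih; have mh : measurable_fun setT h by apply/measurable_EFinP; exact: measurable_int ih.
have mc := @measurable_cas R.
have i2 : mu2.-integrable setT (fun q => (h q * (cas (q.1 * p.1) * cas (q.2 * p.2)))%:E).
  apply: (integrable_mul_bounded (M := 2 * 2)) => //; first by meas.
  by move=> q; rewrite normrM ler_pM// cas_bound.
rewrite /hart2 /xhart {1}/hart /swap/= /hart /Rintegral; congr fine.
rewrite -(@integral12_prod_meas1 _ _ RR RR R mu mu _ i2).
apply: ae_eq_integral => //.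
- apply/measurable_EFinP; apply: measurable_funM; last by meas.
  apply: (@measurable_Rintegral_snd _ _ RR RR R mu (fun q : RR * RR => h q * cas (q.2 * p.2))).
  by meas.
- exact: (@measurable_fubini_F _ _ RR RR R mu mu _ i2).
have := integrable_ae measurableT (integrable_fubini_F ih).
have := @ae_integrable1 _ _ RR RR R mu mu _ ih.
apply: filterS2 => x ix _ _; rewrite /fubini_F/=.
have ix' : mu.-integrable setT (EFin \o (fun v => h (x, v) * cas (v * p.2))).
  apply: (integrable_mul_bounded (M := 2)) => //; first by meas.
  by move=> v; exact: cas_bound.
rewrite mulrC -RintegralZl// /Rintegral fineK.
  by apply: eq_integral => y _; rewrite mulrCA.
exact: (integrable_fin_num measurableT (integrable_scalel (cas (x * p.1)) ix')).
Qed.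

End kirillov_transform.

(** * The Kirillov transform inverts the Fourier-Wigner transform *)

Section kirillov_inversion.
Context {R : realType}.
Notation mu := (@lebesgue_measure R).
Notation mu2 := (leb2 R).
Local Notation RR := (measurableTypeR R).
Local Notation fn := (RR * RR -> R).
Implicit Types (X Y h : fn) (p : RR * RR) (g f : R * R -> R[i]).

(** The integrand of the Kirillov transform without its phase, at p = (u, v). *)
Definition ko_weight X p : R :=
  Num.sqrt ((lambda (- p.1))^-1) * X ((lambda (- p.1))^-1 * p.2, p.1).

Lemma hartley_ko_weight X Y : hartley X Y ->
  hartley (swap (ko_weight X)) (swap (yscale Y)).
Proof.
have mw : measurable_fun setT (fun y : RR => (lambda (- y))^-1 : R).
  rewrite (_ : (fun y => _) = fun y : RR => expR (- ell y)); last first.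
    by apply/funext => y; rewrite expRN expR_ell.
  by have ml := @measurable_ell R; meas.
move=> h; apply: (hartley_dilation mw (@measurable_lambdaN R) _ _ h).
- by move=> y; rewrite invr_gt0 lambda_gt0.
- by move=> y; rewrite mulVf// gt_eqF// lambda_gt0.
Qed.

Lemma yscale_xev X p : yscale (xev X) p = yev (yscale X) p.
Proof. by rewrite /yscale /yev /xev/= mulrN; ring. Qed.

Lemma yscale_xod X p : yscale (xod X) p = yod (yscale X) p.
Proof. by rewrite /yscale /yod /xod/= mulrN; ring. Qed.

Lemma kcosE X p : xev (yev X) p - xod (yod X) p = kcos X p.
Proof. by rewrite /xev /yev /xod /yod /kcos/=; lra. Qed.

Lemma ksinE X p : xev (yod X) p + xod (yev X) p = ksin X p.
Proof. by rewrite /xev /yev /xod /yod /ksin/=; lra. Qed.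

Lemma integrable_hart2 h x y : mu2.-integrable setT (EFin \o h) ->
  mu2.-integrable setT (EFin \o (fun q : RR * RR => h q * (cas (q.1 * x) * cas (q.2 * y)))).
Proof.
move=> ih; have mh : measurable_fun setT h by apply/measurable_EFinP; exact: measurable_int ih.
have mc := @measurable_cas R.
apply: (integrable_mul_bounded (M := 2 * 2)) => //; first by meas.
by move=> q; rewrite normrM ler_pM// cas_bound.
Qed.

Lemma cos_cas (s t : R) : cos (2 * pi * (s + t)) =
  2^-1 * (cas s * cas (- t)) + 2^-1 * (cas (- s) * cas t).
Proof. by rewrite /cas !mulrN !cosN !sinN mulrDr cosD; lra. Qed.

Lemma sin_cas (s t : R) : sin (2 * pi * (s + t)) =
  2^-1 * (cas s * cas t) + - 2^-1 * (cas (- s) * cas (- t)).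
Proof. by rewrite /cas !mulrN !cosN !sinN mulrDr sinD; lra. Qed.

Lemma kcos_hart2 h p : mu2.-integrable setT (EFin \o h) ->
  kcos (hart2 h) p = \int[mu2]_q (h q * cos (2 * pi * (p.1 * q.1 + p.2 * q.2))).
Proof.
move=> ih; rewrite /kcos !hart2E//=.
have i1 := integrable_hart2 p.1 (- p.2) ih; have i2 := integrable_hart2 (- p.1) p.2 ih.
rewrite -!RintegralZl// -RintegralD//; [|exact: integrable_scalel|exact: integrable_scalel].
apply: eq_Rintegral => q _; rewrite cos_cas (mulrC p.1) (mulrC p.2) !mulrN; ring.
Qed.

Lemma ksin_hart2 h p : mu2.-integrable setT (EFin \o h) ->
  ksin (hart2 h) p = \int[mu2]_q (h q * sin (2 * pi * (p.1 * q.1 + p.2 * q.2))).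
Proof.
move=> ih; rewrite /ksin !hart2E//=.
have i1 := integrable_hart2 p.1 p.2 ih; have i2 := integrable_hart2 (- p.1) (- p.2) ih.
rewrite -!RintegralZl// -RintegralD//; [|exact: integrable_scalel|exact: integrable_scalel].
apply: eq_Rintegral => q _; rewrite sin_cas (mulrC p.1) (mulrC p.2) !mulrN; ring.
Qed.

Definition kirillov_cut g (n : nat) (p : R * R) : R[i] :=
  (Num.sqrt p.2)%:C%C *
    cintegral (leb2 R) (`[- n%:R, n%:R] `*` `[- n%:R, n%:R])
      (fun q => ((Num.sqrt (lambda (- q.1)))^-1)%:C%C *
        (g (q.2 / lambda (- q.1), expR q.1) *
         expmi (p.1 * q.1 + p.2 * q.2))).

Lemma Rintegral_box (F : fn) n :
  \int[mu2]_(q in (`[- n%:R, n%:R] `*` `[- n%:R, n%:R])) F q = \int[mu2]_q (F q * box n q).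
Proof.
rewrite /Rintegral integral_mkcond; congr fine; apply: eq_integral => q _.
rewrite patchE boxE; case: ifPn.
  by rewrite inE => -[/=]; rewrite !in_itv/= -!ler_norml => -> ->; rewrite mulr1.
rewrite notin_setE /= => nq; case: (boolP (_ && _)) => [/andP[h1 h2]|_]; last by rewrite mulr0.
by exfalso; apply: nq; split; rewrite /= in_itv/= -ler_norml.
Qed.

Lemma kirillov_cutE g n : L2 mu2 (ko_weight (chart_re aff_exp g)) -> L2 mu2 (ko_weight (chart_im aff_exp g)) ->
  let Qr := hart2 (hcut n (ko_weight (chart_re aff_exp g))) in
  let Qi := hart2 (hcut n (ko_weight (chart_im aff_exp g))) in
  chart_re aff_exp (kirillov_cut g n) = (fun p => ulog (kcos Qr) p + ulog (ksin Qi) p) /\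
  chart_im aff_exp (kirillov_cut g n) = (fun p => ulog (kcos Qi) p + -1 * ulog (ksin Qr) p).
Proof.
move=> Lr Li Qr Qi; have ir := integrable_hcut n Lr; have ii := integrable_hcut n Li.
have mc (a b : R) : measurable_fun setT (fun q : RR * RR => cos (2 * pi * (a * q.1 + b * q.2))) by meas.
have ms (a b : R) : measurable_fun setT (fun q : RR * RR => sin (2 * pi * (a * q.1 + b * q.2))) by meas.
have bc (a b : R) (q : RR * RR) : `|cos (2 * pi * (a * q.1 + b * q.2))| <= 1.
  by rewrite ler_norml cos_geN1 cos_le1.
have bs (a b : R) (q : RR * RR) : `|sin (2 * pi * (a * q.1 + b * q.2))| <= 1.
  by rewrite ler_norml sin_geN1 sin_le1.
have sV (q : RR * RR) : Num.sqrt ((lambda (- q.1))^-1) = (Num.sqrt (lambda (- q.1)))^-1 :> R.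
  by rewrite sqrtrV// ltW// lambda_gt0.
split; apply/funext => p; rewrite /chart_re /chart_im /kirillov_cut /cintegral /= !mul0r ?subr0 ?addr0 /ulog.
- rewrite Rintegral_box -mulrDr (kcos_hart2 _ ir) (ksin_hart2 _ ii)/= -RintegralD//; last 2 first.
  + exact: (integrable_mul_bounded ir (mc _ _) (bc _ _)).
  + exact: (integrable_mul_bounded ii (ms _ _) (bs _ _)).
  congr (_ * _); apply: eq_Rintegral => q _.
  rewrite /hcut /ko_weight sV /chart_re /chart_im /aff_exp/= (mulrC (lambda _)^-1) /expmi.
  by case: (g (q.2 / _, _)) => a b /=; ring.
- rewrite Rintegral_box mulN1r -mulrBr (kcos_hart2 _ ii) (ksin_hart2 _ ir)/= -RintegralB//; last 2 first.
  + exact: (integrable_mul_bounded ii (mc _ _) (bc _ _)).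
  + exact: (integrable_mul_bounded ir (ms _ _) (bs _ _)).
  congr (_ * _); apply: eq_Rintegral => q _.
  rewrite /hcut /ko_weight sV /chart_re /chart_im /aff_exp/= (mulrC (lambda _)^-1) /expmi.
  by case: (g (q.2 / _, _)) => a b /=; ring.
Qed.

Lemma ulog_yscale_shear X p :
  ulog (yscale X) p = Num.sqrt (expR (shear p).2) * X (expR (shear p).2, (shear p).1 - (shear p).2).
Proof.
rewrite /ulog /yscale /shear/= addrK mulrA -sqrtrM ?expR_ge0// expRD expR_ell.
by rewrite (mulrC (expR p.2)).
Qed.

(** With k the inverse Fourier transform of f and G the transform of g, the two
    kernels of [A] give k = ulog (yscale G). As [yscale] relates the transforms
    in v of [ko_weight g] to G, and [ulog] commutes with transforms in u, f is
    the image under [ulog] of the transform of [ko_weight g] in both variables;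
    the truncations converge to it by [hart2_hcut]. *)
Lemma kirillov_limit g f A : inL2Aff f -> linearL2pos A -> boundedL2pos A ->
  affine_weyl f A -> fourier_wigner A g -> fourier_kirillov g f.
Proof.
move=> Lf lA bA wA [[Lg _] [G hG kG]]; have LG : inL2Aff G by case: hG.
have /(chart_inL2 (@chart_Aff R))[Lfr Lfi] := Lf.
have /(chart_inL2 (@chart_Aff R))[Lgr Lgi] := Lg.
have /(chart_inL2 (@chart_Aff R))[LGr LGi] := LG.
have [kr [ki [Lkr Lki hk]]] := ex_fourier1_inv Lfr Lfi.
have [_ _ [ar [ai [har hai Er Ei]]]] := (partial_fourierP Lg LG).1 hG.
have Lar := hartley_L2r har; have Lai := hartley_L2r hai.
have [bu hu] := hartley_op_ulog (R := R); have by_ := @bounded_yscale R.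
have [be he] := hartley_op_yev (R := R); have [bo ho] := hartley_op_yod (R := R).
have [bxe hxe] := hartley_op_xev (R := R); have [bxo hxo] := hartley_op_xod (R := R).
have bD : bounded_op (fun X => ulog (yscale X)) by exact: bounded_comp bu by_.
(* the kernel [K1] obtained from f and the kernel [K2] obtained from g agree *)
pose K1 (s r : R) : R[i] := (kr (unshear (ln s, ln r)) +i* ki (unshear (ln s, ln r)))%C.
have K1r : log_kernel (@complex.Re R) K1 = (fun p => kr (unshear p)).
  by apply/funext => -[a b]; rewrite /log_kernel /K1/= !expRK.
have K1i : log_kernel (@complex.Im R) K1 = (fun p => ki (unshear p)).
  by apply/funext => -[a b]; rewrite /log_kernel /K1/= !expRK.
have hK1 := weyl_integral_kernel Lf lA bA wA Lkr Lki hk K1r K1i.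
have LK1r := L2_subst (@msubst_unshear R) Lkr; have LK1i := L2_subst (@msubst_unshear R) Lki.
pose K2 (s r : R) : R[i] := (Num.sqrt r)%:C%C * G (r, s / r).
have K2r : log_kernel (@complex.Re R) K2 = (fun p => ulog (yscale (chart_re aff_exp G)) (unshear p)).
  apply/funext => p; rewrite ulog_yscale_shear unshearK /log_kernel /K2 /chart_re /aff_exp/=.
  by rewrite expRB; case: (G (_, _)) => a b /=; rewrite mul0r subr0.
have K2i : log_kernel (@complex.Im R) K2 = (fun p => ulog (yscale (chart_im aff_exp G)) (unshear p)).
  apply/funext => p; rewrite ulog_yscale_shear unshearK /log_kernel /K2 /chart_im /aff_exp/=.
  by rewrite expRB; case: (G (_, _)) => a b /=; rewrite mul0r addr0.
have LDr := bounded_L2 bD LGr; have LDi := bounded_L2 bD LGi.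
have := kernel_unique hK1 kG; rewrite -/K2 K1r K1i K2r K2i.
move=> /(_ LK1r LK1i (L2_subst (@msubst_unshear R) LDr) (L2_subst (@msubst_unshear R) LDi))[N1 N2].
have unsh (X Y : fn) : L2 mu2 X -> L2 mu2 Y ->
    sqn mu2 (fun p => X (unshear p) - Y (unshear p)) = 0 -> sqn mu2 (fun p => X p - Y p) = 0.
  move=> LX LY.
  move/(subst_congr (@msubst_shear R) (L2_subst (@msubst_unshear R) LX) (L2_subst (@msubst_unshear R) LY)).
  by under eq_fun do rewrite !shearK.
have {N1} M1 := unsh _ _ Lkr LDr N1; have {N2} M2 := unsh _ _ Lki LDi N2.
(* [cr] and [ci] are the Hartley transforms in v of the two parts of [ko_weight g] *)
pose cr := yscale ar; pose ci := yscale ai.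
have Lcr : L2 mu2 cr by exact: bounded_L2 by_ Lar.
have Lci : L2 mu2 ci by exact: bounded_L2 by_ Lai.
have Le X : L2 mu2 X -> L2 mu2 (ulog (yev X)) by move=> LX; exact: (bounded_L2 bu (bounded_L2 be LX)).
have Lo X : L2 mu2 X -> L2 mu2 (ulog (yod X)) by move=> LX; exact: (bounded_L2 bu (bounded_L2 bo LX)).
have Lar1 := bounded_L2 bxe Lar; have Lai1 := bounded_L2 bxe Lai.
have Lar2 := bounded_L2 bxo Lar; have Lai2 := bounded_L2 bxo Lai.
have kr_c : sqn mu2 (fun p => kr p - (1 * ulog (yev cr) p + 1 * ulog (yod ci) p)) = 0.
  apply: (sqn_sub_trans Lkr LDr _ M1); first by apply: L2D; apply: L2Z; [exact: Le|exact: Lo].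
  have := bounded_congr bD LGr (L2D Lar1 Lai2) Er.
  congr (sqn _ _ = _); apply/funext => p; congr (_ - _).
  rewrite /ulog /cr /ci -!yscale_xev -!yscale_xod /yscale; ring.
have ki_c : sqn mu2 (fun p => ki p - (1 * ulog (yev ci) p + -1 * ulog (yod cr) p)) = 0.
  apply: (sqn_sub_trans Lki LDi _ M2); first by apply: L2D; apply: L2Z; [exact: Le|exact: Lo].
  have := bounded_congr bD LGi (L2B Lai1 Lar2) Ei.
  congr (sqn _ _ = _); apply/funext => p; congr (_ - _).
  rewrite /ulog /cr /ci -!yscale_xev -!yscale_xod /yscale; ring.
have [Qr hQr] := ex_hartley Lcr; have [Qi hQi] := ex_hartley Lci.
have LQr := hartley_L2r hQr; have LQi := hartley_L2r hQi.
have [_ _ [al [be_ [hal hbe Fr Fi]]]] := hk.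
have Lal := hartley_L2r hal; have Lbe := hartley_L2r hbe.
have hal' := hartleyDZ 1 1 (hu _ _ (he _ _ hQr)) (hu _ _ (ho _ _ hQi)).
have hbe' := hartleyDZ 1 (-1) (hu _ _ (he _ _ hQi)) (hu _ _ (ho _ _ hQr)).
have Lal' := hartley_L2r hal'; have Lbe' := hartley_L2r hbe'.
have Eal : sqn mu2 (fun p => al p - (1 * ulog (yev Qr) p + 1 * ulog (yod Qi) p)) = 0.
  by rewrite -kr_c; exact: (hartley_sqn (hartleyB hal hal')).
have Ebe : sqn mu2 (fun p => be_ p - (1 * ulog (yev Qi) p + -1 * ulog (yod Qr) p)) = 0.
  by rewrite -ki_c; exact: (hartley_sqn (hartleyB hbe hbe')).
have bc : bounded_op (fun X => ulog (kcos X)) by exact: bounded_comp bu (@bounded_kcos R).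
have bs : bounded_op (fun X => ulog (ksin X)) by exact: bounded_comp bu (@bounded_ksin R).
have Lc X : L2 mu2 X -> L2 mu2 (ulog (kcos X)) by exact: (bounded_L2 bc).
have Ls X : L2 mu2 X -> L2 mu2 (ulog (ksin X)) by exact: (bounded_L2 bs).
have fr : sqn mu2 (fun p => chart_re aff_exp f p - (ulog (kcos Qr) p + ulog (ksin Qi) p)) = 0.
  have h1 := sqn_sub_add (bounded_L2 bxe Lal) (bounded_L2 bxe Lal') (bounded_L2 bxo Lbe) (bounded_L2 bxo Lbe')
    (bounded_congr bxe Lal Lal' Eal) (bounded_congr bxo Lbe Lbe' Ebe).
  have := sqn_sub_trans Lfr (L2D (bounded_L2 bxe Lal) (bounded_L2 bxo Lbe))
    (L2D (bounded_L2 bxe Lal') (bounded_L2 bxo Lbe')) Fr h1.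
  congr (sqn _ _ = _); apply/funext => p; congr (_ - _).
  rewrite /ulog -!kcosE -!ksinE /xev /xod /=; ring.
have fi : sqn mu2 (fun p => chart_im aff_exp f p - (ulog (kcos Qi) p + -1 * ulog (ksin Qr) p)) = 0.
  have h1 := sqn_sub_sub (bounded_L2 bxe Lbe) (bounded_L2 bxe Lbe') (bounded_L2 bxo Lal) (bounded_L2 bxo Lal')
    (bounded_congr bxe Lbe Lbe' Ebe) (bounded_congr bxo Lal Lal' Eal).
  have := sqn_sub_trans Lfi (L2B (bounded_L2 bxe Lbe) (bounded_L2 bxo Lal))
    (L2B (bounded_L2 bxe Lbe') (bounded_L2 bxo Lal')) Fi h1.
  congr (sqn _ _ = _); apply/funext => p; congr (_ - _).
  rewrite /ulog -!kcosE -!ksinE /xev /xod /=; ring.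
have sw (X : fn) : L2 mu2 (swap X) -> L2 mu2 X.
  move=> LX; have := L2_subst (@msubst_swap R) LX; congr (L2 _ _).
  by apply/funext => -[a b].
have hwr := hartley_ko_weight har; have hwi := hartley_ko_weight hai.
have Lwr := sw _ (hartley_L2l hwr); have Lwi := sw _ (hartley_L2l hwi).
pose hr := ko_weight (chart_re aff_exp g); pose hi := ko_weight (chart_im aff_exp g).
have LTr n : L2 mu2 (hart2 (hcut n hr)) by have [] := hart2_hcut n Lwr hwr hQr.
have LTi n : L2 mu2 (hart2 (hcut n hi)) by have [] := hart2_hcut n Lwi hwi hQi.
have cTr : cvgl2 mu2 (fun n => hart2 (hcut n hr)) Qr.
  rewrite /cvgl2 (_ : (fun n => _) = (fun n => sqn mu2 (fun p => hcut n hr p - hr p))).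
    exact: cvgl2_hcut.
  by apply/funext => n; have [_ ->] := hart2_hcut n Lwr hwr hQr.
have cTi : cvgl2 mu2 (fun n => hart2 (hcut n hi)) Qi.
  rewrite /cvgl2 (_ : (fun n => _) = (fun n => sqn mu2 (fun p => hcut n hi p - hi p))).
    exact: cvgl2_hcut.
  by apply/funext => n; have [_ ->] := hart2_hcut n Lwi hwi hQi.
have LK n : inL2Aff (kirillov_cut g n).
  apply/(chart_inL2 (@chart_Aff R)); have [-> ->] := kirillov_cutE n Lwr Lwi; split.
    by apply: L2D; [exact: Lc|exact: Ls].
  by apply: L2D; [exact: Lc|apply: L2Z; exact: Ls].
split=> //; apply/(chart_cvgL2 (@chart_Aff R) LK Lf); split.
- rewrite (_ : (fun n => _) = (fun n p => ulog (kcos (hart2 (hcut n hr))) p + ulog (ksin (hart2 (hcut n hi))) p)); last first.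
    by apply/funext => n; have [-> _] := kirillov_cutE n Lwr Lwi.
  apply: (cvgl2_lim_congr _ _ Lfr fr).
  + by move=> n; apply: L2D; [exact: Lc|exact: Ls].
  + by apply: L2D; [exact: Lc|exact: Ls].
  apply: cvgl2D; [by move=> n; exact: Lc|by move=> n; exact: Ls|exact: Lc|exact: Ls| |].
    exact: (bounded_cvgl2 bc LTr LQr cTr).
  exact: (bounded_cvgl2 bs LTi LQi cTi).
- rewrite (_ : (fun n => _) = (fun n p => ulog (kcos (hart2 (hcut n hi))) p + -1 * ulog (ksin (hart2 (hcut n hr))) p)); last first.
    by apply/funext => n; have [_ ->] := kirillov_cutE n Lwr Lwi.
  apply: (cvgl2_lim_congr _ _ Lfi fi).
  + by move=> n; apply: L2D; [exact: Lc|apply: L2Z; exact: Ls].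
  + by apply: L2D; [exact: Lc|apply: L2Z; exact: Ls].
  apply: cvgl2D; [by move=> n; exact: Lc|by move=> n; apply: L2Z; exact: Ls|exact: Lc|by apply: L2Z; exact: Ls| |].
    exact: (bounded_cvgl2 bc LTi LQi cTi).
  apply: cvgl2Z; [by move=> n; exact: Ls|exact: Ls|].
  exact: (bounded_cvgl2 bs LTr LQr cTr).
Qed.

End kirillov_inversion.

(** * The diagram commutes *)

Theorem proposition5p8 (R : realType) (f : R * R -> R[i])
    (A : (R -> R[i]) -> (R -> R[i])) :
  inL2Aff f -> hilbert_schmidt A -> affine_weyl f A ->
  (exists g : R * R -> R[i], fourier_wigner A g) /\
  (forall g : R * R -> R[i], fourier_wigner A g -> fourier_kirillov g f).
Proof.
move=> Lf [lA bA _] wA; split; first exact: exists_fourier_wigner Lf lA bA wA.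
by move=> g hg; exact: kirillov_limit Lf lA bA wA hg.
Qed.
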